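(* Let $\Omega\subset\mathbb R^d$ be open and $\omega\in\mathcal W$. Let $T\in\mathcal D'^{\{\omega\}}(\Omega)$ be a Roumieu ultradistribution and $g=[(g_\varepsilon)]\in\mathcal G^{\{\omega\},\infty}(\Omega)$ a regular Roumieu generalized ultradifferentiable function such that: (A) both have compact supports inside the interior of a fixed compact $K\subset\Omega$ (that is, the supports of $T$ and of all $g_\varepsilon$ lie in the interior of $K$); (B) $\omega_\infty\in\mathcal W$ is such that for all $\omega'\in\mathcal W$ with $\omega'\ll\omega$, $\|g_\varepsilon\|_{K,1}^{\omega'}=o(e^{\omega_\infty(1/\varepsilon)})$ as $\varepsilon\to0^+$; (C) for $\varepsilon$ small enough the following holds: there exists $\omega_b\in\mathcal W$ with $\omega_\infty\ll\omega_b$ such that for all $\omega_2\in\mathcal W$ with $\omega_2\ll\omega$ there exists $C>0$ (independent of $\varepsilon$) such that for all $\rho\in\mathcal D^{\omega_2}(\Omega)$, $$|\langle T-g_\varepsilon,\rho\rangle|\le C e^{-\omega_b(1/\varepsilon)}\,\|\rho\|_{K,1}^{\omega_2}$$ (this property is called $\omega_b$-R-strong association); that is, there is $\varepsilon_0>0$ and such an $\omega_b$ for which this holds for all $\varepsilon\in(0,\varepsilon_0)$. Then $T$ is Roumieu regular: $T\in\mathcal E^{\{\omega\}}(\Omega)$.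
   Context: $\mathbb R^+=[0,\infty)$. $\mathcal W$ is the set of all nondecreasing continuous functions $\omega:\mathbb R^+\to\mathbb R^+$ such that $\omega(0)=0$; $\omega(x+y)\le\omega(x)+\omega(y)$ for all $x,y\ge 0$; $\int_1^\infty \frac{\omega(t)}{t^2}\,dt<\infty$; and $\lim_{t\to\infty}\frac{\omega(t)}{\log(1+t)}=\infty$. For $\omega_1,\omega_2\in\mathcal W$, $\omega_1\ll\omega_2$ means $\omega_1(t)=o(\omega_2(t))$ as $t\to\infty$. For a compactly supported continuous $f$ on $\mathbb R^d$, $\sigma\in\mathcal W$ and $l>0$: $\|f\|_l^{\sigma}=\int|\hat f(\xi)|e^{l\sigma(|\xi|)}d\xi\in[0,\infty]$, with $\hat f$ the Fourier transform. $\mathcal D^{\{\omega\}}(\Omega)$ is the set of continuous $f$ with compact support in $\Omega$ and $\|f\|_l^\omega<\infty$ for some $l>0$. $\mathcal D'^{\{\omega\}}(\Omega)$ is the space of linear functionals on $\mathcal D^{\{\omega\}}(\Omega)$ whose restriction to each Banach space $\{f:\operatorname{supp}f\subset L,\ \|f\|_l^\omega<\infty\}$ ($L\subset\Omega$ compact, $l>0$) is continuous. $\mathcal E^{\{\omega\}}(\Omega)$ is the set of smooth $f:\Omega\to\mathbb C$ with $\psi f\in\mathcal D^{\{\omega\}}(\Omega)$ for all $\psi\in\mathcal D^{\{\omega\}}(\Omega)$, regarded as a subspace of $\mathcal D'^{\{\omega\}}(\Omega)$ via $\langle f,\phi\rangle=\int f\phi$. For compact $L\subset\Omega$, $\|f\|_{L,l}^{\sigma}=\inf\{\|\psi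 f\|_l^{\sigma}:\psi\in\mathcal D^{\{\omega\}}(\Omega),\ \psi=1\text{ on }L\}$. For $\omega_2\ll\omega$, $\mathcal D^{\omega_2}(\Omega)$ is the space of continuous $\rho$ with compact support in $\Omega$ and $\|\rho\|_1^{\omega_2}<\infty$; it contains $\mathcal D^{\{\omega\}}(\Omega)$. In (C) it is understood that $T$ acts on $\mathcal D^{\omega_2}(\Omega)$, i.e. $\langle T,\cdot\rangle$ denotes a linear functional on $\mathcal D^{\omega_2}(\Omega)$ extending $T$, while $\langle g_\varepsilon,\rho\rangle=\int g_\varepsilon\rho$. Nets in $\mathcal E^{\{\omega\}}(\Omega)$ are indexed by $\varepsilon\in(0,1)$, $o(\cdot)$ is as $\varepsilon\to0^+$, $L$ ranges over compact subsets of $\Omega$. Moderate: $\forall L\,\forall k>0\,\exists h>0$: $\|g_\varepsilon\|_{L,h}^\omega=o(e^{k\omega(1/\varepsilon)})$. Negligible: $\forall L\,\exists k>0\,\exists h>0$: $\|g_\varepsilon\|_{L,h}^\omega=o(e^{-k\omega(1/\varepsilon)})$. $\mathcal G^{\{\omega\}}(\Omega)$ is the quotient of moderate by negligible nets. $g=[(g_\varepsilon)]\in\mathcal G^{\{\omega\},\infty}(\Omega)$ (regular) means that the moderate representative satisfies $\forall L\ \exists h>0\ \forall k>0$: $\|g_\varepsilon\|_{L,h}^\omega=o(e^{k\omega(1/\varepsilon)})$. *)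

(* Defs.v *)
From HB Require Import structures.
From mathcomp Require Import all_boot all_order all_algebra.
From mathcomp Require Import complex.
From mathcomp Require Import all_classical all_reals all_analysis.
Set Implicit Arguments.
Unset Strict Implicit.
Unset Printing Implicit Defensive.
Import Order.TTheory GRing.Theory Num.Theory.
Import numFieldNormedType.Exports.
Local Open Scope classical_set_scope.
Local Open Scope ring_scope.

(* A function on [0, +oo[ is a total function on R of which only the values at
   nonnegative arguments are constrained or used.  Likewise a function on an
   open set Om is a total function on 'rV[R]_d of which only the values on Om
   matter, and a net indexed by ]0, 1[ is a function on R. *)

Section Weights.
Context {R : realType}.
Implicit Types w v : R -> R.

Record weight w : Prop := Weight {
  weight_ge0 : forall t : R, 0 <= t -> 0 <= w t;
  weight_nondecreasing : forall s t : R, 0 <= s -> s <= t -> w s <= w t;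
  weight_continuous : {within `[0, +oo[, continuous w};
  weight0 : w 0 = 0;
  weight_subadditive :
    forall s t : R, 0 <= s -> 0 <= t -> w (s + t) <= w s + w t;
  weight_integral :
    (\int[lebesgue_measure]_(t in `[1%R, +oo[) (w t / t ^+ 2)%:E < +oo)%E;
  weight_log : w t / ln (1 + t) @[t --> +oo] --> +oo }.

Definition weight_ll w v : Prop :=
  forall c : R, 0 < c -> \forall t \near +oo, `|w t| <= c * `|v t|.

(* F e = o(b e) as e -> 0+ for an extended-real-valued F >= 0. *)
Definition elittleo0 (F : R -> \bar R) (b : R -> R) : Prop :=
  forall c : R, 0 < c -> \forall e \near 0^'+, (F e <= (c * b e)%:E)%E.

End Weights.

Section EuclideanSpace.
Context {R : realType}.

(* The library's norm on 'rV[R]_d is the sup norm. *)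
Definition euclidean_norm d (x : 'rV[R]_d) : R :=
  Num.sqrt (\sum_i x 0 i ^+ 2).

Definition dotp d (x y : 'rV[R]_d) : R := \sum_i x 0 i * y 0 i.

(* Lebesgue integral over R^d as an iterated integral; by Fubini-Tonelli this
   is the usual integral for the only integrands used below: nonnegative
   continuous functions, and continuous functions of compact support. *)
Fixpoint integral_rV d : ('rV[R]_d -> \bar R) -> \bar R :=
  match d with
  | 0 => fun f => f 0
  | d'.+1 => fun f =>
      (\int[lebesgue_measure]_(t in [set: R])
         integral_rV (fun x : 'rV[R]_d' => f (row_mx (const_mx t : 'rV_1) x)))%E
  end.

Definition cintegral_rV d (f : 'rV[R]_d -> R[i]) : R[i] :=
  Complex (fine (integral_rV (fun x => (complex.Re (f x))%:E)))
          (fine (integral_rV (fun x => (complex.Im (f x))%:E))).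

Definition ccontinuous d (f : 'rV[R]_d -> R[i]) : Prop :=
  continuous (fun x => complex.Re (f x)) /\
  continuous (fun x => complex.Im (f x)).

Fixpoint Cn_on d (n : nat) (Om : set 'rV[R]_d) (u : 'rV[R]_d -> R) : Prop :=
  (forall x, Om x -> {for x, continuous u}) /\
  match n with
  | 0 => True
  | n'.+1 => forall i : 'I_d,
      (forall x, Om x -> derivable u x (delta_mx 0 i)) /\
      Cn_on n' Om (fun x => 'D_(delta_mx 0 i) u x)
  end.

Definition csmooth_on d (Om : set 'rV[R]_d) (f : 'rV[R]_d -> R[i]) : Prop :=
  forall n, Cn_on n Om (fun x => complex.Re (f x)) /\
            Cn_on n Om (fun x => complex.Im (f x)).

Definition fourier d (f : 'rV[R]_d -> R[i]) (xi : 'rV[R]_d) : R[i] :=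
  cintegral_rV (fun x => f x * Complex (cos (dotp x xi)) (- sin (dotp x xi))).

Definition wnorm d (s : R -> R) (l : R) (f : 'rV[R]_d -> R[i]) : \bar R :=
  integral_rV (fun xi =>
    (Normc.normc (fourier f xi) * expR (l * s (euclidean_norm xi)))%:E).

End EuclideanSpace.

Section Spaces.
Context {R : realType} {d : nat}.
Implicit Types (Om A L : set 'rV[R]_d) (f g rho psi : 'rV[R]_d -> R[i]).
Implicit Types (w s : R -> R) (T : ('rV[R]_d -> R[i]) -> R[i]).

Definition supp f : set 'rV[R]_d := closure [set x | f x != 0].

Definition Cc A : set ('rV[R]_d -> R[i]) :=
  [set f | [/\ ccontinuous f, compact (supp f) & supp f `<=` A]].

Definition Dbanach s l A : set ('rV[R]_d -> R[i]) :=
  [set f | Cc A f /\ (wnorm s l f < +oo)%E].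

Definition Droumieu w Om : set ('rV[R]_d -> R[i]) :=
  [set f | exists2 l, 0 < l & Dbanach w l Om f].

Definition linear_on (D : set ('rV[R]_d -> R[i])) T : Prop :=
  forall (a : R[i]) f g, D f -> D g ->
    T (fun x => a * f x + g x) = a * T f + T g.

Definition continuous_on_banach w l L T : Prop :=
  forall f, Dbanach w l L f -> forall e : R, 0 < e ->
    exists2 delta : R, 0 < delta &
      forall g, Dbanach w l L g ->
        (wnorm w l (fun x => (g x - f x)%R) < delta%:E)%E ->
        Normc.normc (T g - T f) < e.

Definition ultradistribution w Om T : Prop :=
  linear_on (Droumieu w Om) T /\
  forall L l, compact L -> L `<=` Om -> 0 < l -> continuous_on_banach w l L T.

Definition supp_dual w Om T : set 'rV[R]_d :=
  [set x | Om x /\ forall U, open U -> U x -> U `<=` Om ->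
             exists2 phi, Droumieu w U phi & T phi != 0].

(* Support, relatively to Om, of a function on Om. *)
Definition supp_in Om f : set 'rV[R]_d :=
  Om `&` closure (Om `&` [set x | f x != 0]).

Definition Eroumieu w Om : set ('rV[R]_d -> R[i]) :=
  [set f | csmooth_on Om f /\
    forall psi, Droumieu w Om psi -> Droumieu w Om (fun x => psi x * f x)].

Definition pairing f rho : R[i] := cintegral_rV (fun x => f x * rho x).

Definition roumieu_regular w Om T : Prop :=
  exists2 f, Eroumieu w Om f &
    forall phi, Droumieu w Om phi -> T phi = pairing f phi.

(* ||f||_{L,l}^s; the cutoffs are taken in Droumieu w Om whatever s is. *)
Definition lnorm w Om s L l f : \bar R :=
  ereal_inf [set wnorm s l (fun x => psi x * f x) |
    psi in [set psi | Droumieu w Om psi /\ forall x, L x -> psi x = 1]].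

End Spaces.

Section GeneralizedFunctions.
Context {R : realType} {d : nat}.
Notation net := (R -> 'rV[R]_d -> R[i]).
Implicit Types (Om L : set 'rV[R]_d) (w : R -> R) (g h : net).

Definition Enet w Om g : Prop :=
  forall e : R, 0 < e < 1 -> Eroumieu w Om (g e).

Definition moderate_net w Om g : Prop :=
  Enet w Om g /\
  forall L, compact L -> L `<=` Om -> forall k : R, 0 < k ->
    exists2 l : R, 0 < l &
      elittleo0 (fun e => lnorm w Om w L l (g e))
                (fun e => expR (k * w e^-1)).

Definition negligible_net w Om g : Prop :=
  Enet w Om g /\
  forall L, compact L -> L `<=` Om ->
    exists2 k : R, 0 < k & exists2 l : R, 0 < l &
      elittleo0 (fun e => lnorm w Om w L l (g e))
                (fun e => expR (- k * w e^-1)).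

Definition regular_net w Om g : Prop :=
  forall L, compact L -> L `<=` Om ->
    exists2 l : R, 0 < l & forall k : R, 0 < k ->
      elittleo0 (fun e => lnorm w Om w L l (g e))
                (fun e => expR (k * w e^-1)).

(* Elements of the quotient are the classes of moderate nets modulo
   negligible ones. *)
Definition gclass w Om g : set net :=
  [set h | moderate_net w Om h /\ negligible_net w Om (fun e x => h e x - g e x)].

Definition represents w Om g (G : set net) : Prop :=
  moderate_net w Om g /\ G = gclass w Om g.

Definition regular_gfun w Om : set (set net) :=
  [set G | exists2 g, represents w Om g G & regular_net w Om g].

(* wb-R-strong association of T and g, for e in ]0, e0[. *)
Definition strong_association w Om (K : set 'rV[R]_d)
    (T : ('rV[R]_d -> R[i]) -> R[i]) g (e0 : R) (wb : R -> R) : Prop :=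
  forall w2 : R -> R, weight w2 -> weight_ll w2 w ->
    exists2 T2 : ('rV[R]_d -> R[i]) -> R[i],
      linear_on (Dbanach w2 1 Om) T2 /\
      (forall phi, Droumieu w Om phi -> T2 phi = T phi) &
    exists2 C : R, 0 < C &
      forall e : R, 0 < e < e0 -> forall rho, Dbanach w2 1 Om rho ->
        ((Normc.normc (T2 rho - pairing (g e) rho))%:E <=
         (C * expR (- wb e^-1))%:E * lnorm w Om w2 K 1 rho)%E.

End GeneralizedFunctions.

(* Main.v *)
From HB Require Import structures.
Require Import Defs.
From mathcomp Require Import all_boot all_order all_algebra.
From mathcomp Require Import complex.
From mathcomp Require Import all_classical all_reals all_analysis.
From mathcomp Require Import measurable_realfun.
From mathcomp Require Import ring lra.
Set Implicit Arguments.
Unset Strict Implicit.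
Unset Printing Implicit Defensive.
Import Order.TTheory GRing.Theory Num.Theory.
Import numFieldNormedType.Exports.
Local Open Scope classical_set_scope.
Local Open Scope ring_scope.

(** Let [chi] be a cutoff equal to 1 on [K] and put [u n = chi g_(e n)] with
[e n = 2 ^- n.+1].  Fix a weight [s << w].  The Fourier transform of [u n] at
[xi] is the pairing of [g_(e n)] with the function [chi(x) e^(-i x xi)], whose
[s]-norm is [O(e^(s |xi|))].  Strong association compares the pairings at two
consecutive indices with the same value of the extension of [T], so
[|F(u n.+1 - u n)(xi)| = O(e^(-wb(2 ^ n.+1)) e^(s |xi|))]
([fourier_sub_cutoff_le]).  The bound on [g] for the weight [4 s] says that the
[4 s]-norm of [u n] is at most [e^(winf(2 ^ n.+1))].  Interpolating between the
two ([wnorm_interpolation]) bounds the [s]-norm of [u n.+1 - u n] by a constant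
times [e^(-wb/2 + wb/4)] at [2 ^ n.+1], since [winf << wb] and weights are
subadditive; as [wb] dominates the logarithm this is [O(2 ^- n)]
([increments_geometric]).

Hence [u n] converges uniformly, to a continuous [f] vanishing off [K], and
Fatou's lemma gives [f] a finite [s]-norm, for every [s << w].  Such Beurling
conditions amount to a Roumieu condition ([roumieu_of_beurling]): if
[|F f| e^(l w)] were not integrable for any [l > 0], choosing balls on which
[|F f| e^(w / k.+1)] already has integral at least [k] would produce a weight
[s << w] lying above [w / k.+1] on the [k]-th ball ([weight_below]), with [f] of
infinite [s]-norm.  So [f] belongs to [Droumieu w Om]; it is smooth since its
Fourier transform has all moments ([csmooth_of_wnorm]), and multiplication
preserves the class because [e^(l w)] is submultiplicative along the convolution
of the transforms ([wnormM]).  Finally, for a test function [phi], the pairings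
of [g_(e n)] with [phi] tend to [T phi] by strong association and to the pairing
of [f] with [phi] by uniform convergence, so [f] represents [T].

All of this rests on Fourier inversion ([fourier_inversion]).  It is obtained by
damping with a product of one-dimensional exponentials [e^(-a |t|)] rather than
a Gaussian, because [e^(-a |t|) cos (y t)] has an elementary antiderivative in
[t], and so has its integral, the Poisson kernel, in [y]. *)

(** * Lebesgue measure on row vectors *)

Section MeasureOnRows.
Context {R : realType}.

(** The sigma-algebra generated by the coordinates makes the recursion on the
dimension a product of measurable spaces; by [open_measurable_rV] it contains
the open sets, hence it is the Borel one. *)
Definition coord_sets d : set (set 'rV[R]_d) :=
  [set A | exists i (B : set R), measurable B /\
     A = (fun x : 'rV[R]_d => x 0 i) @^-1` B].

Definition mrV d := g_sigma_algebraType (@coord_sets d).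

Lemma measurable_coord d (i : 'I_d) :
  measurable_fun setT (fun x : mrV d => (x : 'rV[R]_d) 0 i).
Proof.
move=> _ B mB; rewrite setTI; apply: sub_sigma_algebra.
by exists i, B.
Qed.

Lemma measurable_fun_rV dd (T : measurableType dd) d (f : T -> mrV d) :
  (forall i, measurable_fun setT (fun t => (f t : 'rV[R]_d) 0 i)) ->
  measurable_fun setT f.
Proof.
move=> mf; apply: (@measurability _ _ _ _ setT f (@coord_sets d)) => //.
move=> _ [_ [i [B [mB ->]]] <-]; rewrite setTI.
have := mf i measurableT B mB; rewrite setTI; exact.
Qed.

(** An open set is the union of the rational boxes that it contains, and these
are countably many. *)
Lemma open_measurable_rV d (O : set 'rV[R]_d) :
  open O -> measurable (O : set (mrV d)).
Proof.
move=> oO.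
pose box (q : 'rV[rat]_d) (n : nat) : set 'rV[R]_d :=
  [set x | forall i, `|x 0 i - ratr (q 0 i)| < n.+1%:R^-1].
have mbox q n : measurable (box q n : set (mrV d)).
  rewrite (_ : box q n = \bigcap_(i in [set: 'I_d])
     ((fun x : mrV d => (x : 'rV[R]_d) 0 i) @^-1` (ball (ratr (q 0 i) : R) n.+1%:R^-1))).
    apply: fin_bigcap_measurable => // i _.
    rewrite -[X in measurable X]setTI; apply: measurable_coord => //.
    exact: measurable_ball.
  apply/seteqP; split=> x /=.
    by move=> bx i _; rewrite /= /ball/= distrC.
  by move=> bx i; have := bx i I; rewrite /= /ball/= distrC.
have -> : O = \bigcup_(qn : 'rV[rat]_d * nat)
   (if `[< box qn.1 qn.2 `<=` O >] then box qn.1 qn.2 else set0).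
  apply/seteqP; split; last first.
    by move=> x [qn _]; case: ifPn => // /asboolP; apply.
  move=> x Ox.
  have /nbhs_ballP[e /= e0 eO] : nbhs x O by exact: open_nbhs_nbhs.
  have [n ne] : exists n : nat, n.+1%:R^-1 < e / 2.
    have /ltr_add_invr : 0 < e / 2 by rewrite divr_gt0.
    by case=> n; rewrite add0r => ?; exists n.
  have /choice[q hq] : forall i, exists q : rat, `|x 0 i - ratr q| < n.+1%:R^-1.
    move=> i.
    have [|q /[!in_itv]/= /andP[q1 q2]] := @rat_in_itvoo R (x 0 i - n.+1%:R^-1) (x 0 i + n.+1%:R^-1).
      by rewrite ltrD2l gtrN ?invr_gt0.
    exists q; move: q1 q2; move: (n.+1%:R^-1) => a q1 q2.
    by rewrite ltr_norml; apply/andP; split; lra.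
  exists (\row_i q i, n) => //=.
  case: ifPn => [_ i|/asboolPn]; first by rewrite mxE.
  apply: contra_notP => _ y yb; apply: eO.
  split => // i j; rewrite !ord1 /ball/=.
  have := yb j; have := hq j; rewrite mxE !ltr_norml.
  move: (n.+1%:R^-1) ne => a ae /andP[? ?] /andP[? ?].
  by apply/andP; split; lra.
apply: countable_bigcupT_measurable => [|qn]; last by case: ifP.
exact: countableP.
Qed.

Lemma continuous_measurable_rV d (f : 'rV[R]_d -> R) : continuous f ->
  measurable_fun setT (f : mrV d -> R).
Proof.
move=> cf; apply: (@measurability _ _ _ _ setT (f : mrV d -> R) _ (RGenOpens.measurableE R)).
move=> _ [_ [a [b ->]] <-]; rewrite setTI; apply: open_measurable_rV.
by apply: open_comp => // x _; exact: cf.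
Qed.


Definition cons_rV d (t : R) (x : 'rV[R]_d) : 'rV[R]_d.+1 :=
  row_mx (const_mx t : 'rV_1) x.

Lemma cons_rV0 d t (x : 'rV[R]_d) : cons_rV t x 0 0 = t.
Proof.
rewrite /cons_rV.
have -> : (0 : 'I_(1 + d)) = lshift d (0 : 'I_1) by exact: val_inj.
exact: (etrans (row_mxEl (const_mx t) x 0 0) (mxE _ _ _ _)).
Qed.

Lemma cons_rVS d t (x : 'rV[R]_d) i : cons_rV t x 0 (lift ord0 i) = x 0 i.
Proof.
rewrite /cons_rV.
have -> : (lift ord0 i : 'I_(1 + d)) = rshift 1 i by exact: val_inj.
exact: (row_mxEr (const_mx t) x 0 i).
Qed.

Definition tail_rV d (x : 'rV[R]_d.+1) : 'rV[R]_d := \row_i x 0 (lift ord0 i).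

Lemma cons_rVK d (x : 'rV[R]_d.+1) : cons_rV (x 0 0) (tail_rV x) = x.
Proof.
apply/rowP => i; case: (unliftP ord0 i) => [j|] ->.
  by rewrite cons_rVS mxE.
by rewrite cons_rV0.
Qed.

Lemma tail_rVK d t (x : 'rV[R]_d) : tail_rV (cons_rV t x) = x.
Proof. by apply/rowP => i; rewrite mxE cons_rVS. Qed.

Lemma measurable_cons_rV d :
  measurable_fun setT (fun p : R * mrV d => cons_rV p.1 p.2 : mrV d.+1).
Proof.
apply: measurable_fun_rV => i; case: (unliftP ord0 i) => [j|] ->.
  under eq_fun do rewrite cons_rVS.
  exact: (measurableT_comp (measurable_coord j)).
rewrite (_ : (fun t => _) = fst) //.
by apply/funext => p; exact: cons_rV0.
Qed.

Lemma measurable_uncons_rV d :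
  measurable_fun setT
    (fun x : mrV d.+1 => ((x : 'rV[R]_d.+1) 0 0, tail_rV x : mrV d)).
Proof.
apply: measurable_fun_pair => /=; first exact: measurable_coord.
apply: measurable_fun_rV => i.
under eq_fun do rewrite mxE.
exact: measurable_coord.
Qed.


Lemma measurable_cons_rV2 d (t : R) :
  measurable_fun setT (fun x : mrV d => cons_rV t x : mrV d.+1).
Proof.
exact: (measurableT_comp (@measurable_cons_rV d) (pair1_measurable (t : measurableTypeR R))).
Qed.

Definition leb1 : {sigma_finite_measure set (measurableTypeR R) -> \bar R} :=
  @lebesgue_measure R.

Lemma product_sigma_finite d1 d2 (T1 : measurableType d1) (T2 : measurableType d2)
    (m1 : {sigma_finite_measure set T1 -> \bar R})
    (m2 : {sigma_finite_measure set T2 -> \bar R}) :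
  sigma_finite setT (m1 \x m2)%E.
Proof.
have /sigma_finiteP[F [FT ndF F_fin]] := sigma_finiteT m1.
have /sigma_finiteP[G [GT ndG G_fin]] := sigma_finiteT m2.
exists (fun n => F n `*` G n) => [|n].
  apply/seteqP; split=> // -[x y] _.
  have [i _ Fx] : (\bigcup_n F n) x by rewrite -FT.
  have [j _ Gy] : (\bigcup_n G n) y by rewrite -GT.
  exists (maxn i j) => //; split => /=.
  - by move: Fx; apply/subsetPset/ndF/leq_maxl.
  - by move: Gy; apply/subsetPset/ndG/leq_maxr.
have [mF Foo] := F_fin n; have [mG Goo] := G_fin n.
split; first exact: measurableX.
by rewrite product_measure1E// lte_mul_pinfty// ge0_fin_numE.
Qed.

(** In dimension [d.+1] the measure is the image of the product measure under
[cons_rV], so that Tonelli's theorem is the recursion defining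
[integral_rV]. *)
Lemma rV_measure_ex d : exists m : {sigma_finite_measure set (mrV d) -> \bar R},
  forall f : 'rV[R]_d -> \bar R, measurable_fun setT (f : mrV d -> \bar R) ->
    (forall x, 0 <= f x)%E -> integral_rV f = (\int[m]_x f x)%E.
Proof.
elim: d => [|d [m IH]].
  exists (dirac (0%R : mrV 0) : {sigma_finite_measure set (mrV 0) -> \bar R}).
  by move=> f mf f0 /=; rewrite integral_dirac// diracT mul1e.
pose phi (p : measurableTypeR R * mrV d) : mrV d.+1 := cons_rV p.1 p.2.
have mphi : measurable_fun setT phi by exact: measurable_cons_rV.
pose mu1 : {measure set (mrV d.+1) -> \bar R} :=
  pushforward (leb1 \x m)%E phi.
pose mu0 := mu1 mphi.
have sf : sigma_finite setT mu0.
  have [F FT Foo] := product_sigma_finite leb1 m.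
  exists (fun n => (fun x : mrV d.+1 => ((x : 'rV[R]_d.+1) 0 0, tail_rV x : mrV d)) @^-1` (F n)).
    by rewrite -preimage_bigcup -FT preimage_setT.
  move=> n; have [mF Fn] := Foo n; split.
    by rewrite -[X in measurable X]setTI; exact: measurable_uncons_rV.
  rewrite (_ : mu0 _ = (leb1 \x m)%E (F n))//.
  congr ((leb1 \x m)%E _); apply/seteqP.
  by split=> -[t x] /=; rewrite /phi/= cons_rV0 tail_rVK.
pose mm := HB.pack_for {sigma_finite_measure set (mrV d.+1) -> \bar R} (Measure.sort mu0)
  (Measure_isSigmaFinite.Build _ _ _ _ sf).
exists mm => f mf f0 /=.
rewrite -[RHS]/(\int[mu0]_x f x)%E ge0_integral_pushforward// preimage_setT.
rewrite fubini_tonelli1//; last 2 first.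
  exact: measurableT_comp.
  by move=> p /=.
apply: eq_integral => t _; apply: IH => [|x]; last exact: f0.
exact: (measurableT_comp mf (measurable_cons_rV2 t)).
Qed.

(** Everything that is used of this measure follows from [integral_rVE], which
determines it. *)
Definition leb d : {sigma_finite_measure set (mrV d) -> \bar R} :=
  projT1 (cid (rV_measure_ex d)).

Lemma integral_rVE d (f : 'rV[R]_d -> \bar R) :
  measurable_fun setT (f : mrV d -> \bar R) ->
  (forall x, 0 <= f x)%E -> integral_rV f = (\int[leb d]_x f x)%E.
Proof. exact: (projT2 (cid (rV_measure_ex d))). Qed.

Lemma leb_ge0_cons d (f : 'rV[R]_d.+1 -> \bar R) :
  measurable_fun setT (f : mrV d.+1 -> \bar R) -> (forall x, 0 <= f x)%E ->
  (\int[leb d.+1]_x f x =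
  \int[leb1]_t \int[leb d]_x f (cons_rV t x))%E.
Proof.
move=> mf f0; rewrite -integral_rVE//=.
apply: eq_integral => t _; apply: integral_rVE => //.
exact: (measurableT_comp mf (measurable_cons_rV2 t)).
Qed.

Lemma measurable_leb_cons d (f : 'rV[R]_d.+1 -> \bar R) :
  measurable_fun setT (f : mrV d.+1 -> \bar R) -> (forall x, 0 <= f x)%E ->
  measurable_fun setT
    (fun t : measurableTypeR R => \int[leb d]_x f (cons_rV t x))%E.
Proof.
move=> mf f0; apply: (@measurable_fun_fubini_tonelli_F _ _ (measurableTypeR R)
  (mrV d) R (leb d) (fun p => f (cons_rV p.1 p.2))) => //.
exact: (measurableT_comp mf (@measurable_cons_rV d)).
Qed.

Lemma leb_ge0_0 (f : 'rV[R]_0 -> \bar R) :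
  measurable_fun setT (f : mrV 0 -> \bar R) -> (forall x, 0 <= f x)%E ->
  (\int[leb 0]_x f x)%E = f 0%R.
Proof. by move=> mf f0; rewrite -integral_rVE. Qed.

Lemma lebS d (A : set (mrV d.+1)) : measurable A ->
  leb d.+1 A = pushforward (leb1 \x leb d)%E (fun p => cons_rV p.1 p.2 : mrV d.+1) A.
Proof.
move=> mA; rewrite -[LHS]mul1e -integral_cst// integral_mkcond/= leb_ge0_cons; last first.
- by move=> x; rewrite patchE; case: ifP.
- by apply/(measurable_restrictT _ _).1.
rewrite /pushforward -[RHS]mul1e -integral_cst; last first.
  by rewrite -[X in measurable X]setTI; exact: measurable_cons_rV.
rewrite [RHS]integral_mkcond fubini_tonelli1; first by [].
  apply/(measurable_restrictT _ _).1 => //.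
  by rewrite -[X in measurable X]setTI; exact: measurable_cons_rV.
by move=> x; rewrite patchE; case: ifP.
Qed.

Lemma leb_integrable_consP d (f : 'rV[R]_d.+1 -> R) :
  (leb d.+1).-integrable setT (EFin \o f : mrV d.+1 -> \bar R) ->
  (leb1 \x leb d)%E.-integrable setT (fun p => (f (cons_rV p.1 p.2))%:E).
Proof.
move=> /integrableP[mf fi]; apply/integrableP; split.
  exact: (measurableT_comp mf (@measurable_cons_rV d)).
rewrite fubini_tonelli1//; last first.
  apply: measurableT_comp => //.
  exact: (measurableT_comp mf (@measurable_cons_rV d)).
move: fi; rewrite leb_ge0_cons//.
exact: measurableT_comp.
Qed.

Lemma leb_cons d (f : 'rV[R]_d.+1 -> R) :
  (leb d.+1).-integrable setT (EFin \o f : mrV d.+1 -> \bar R) ->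
  (\int[leb d.+1]_x (f x)%:E = \int[leb1]_t \int[leb d]_x (f (cons_rV t x))%:E)%E.
Proof.
move=> fi.
pose mu1 : {measure set (mrV d.+1) -> \bar R} :=
  pushforward (leb1 \x leb d)%E (fun p => cons_rV p.1 p.2 : mrV d.+1).
have mc : measurable_fun setT
  (fun p : measurableTypeR R * mrV d => cons_rV p.1 p.2 : mrV d.+1).
  exact: measurable_cons_rV.
rewrite (eq_measure_integral (mu1 mc)); last by move=> A mA _; exact: lebS.
rewrite integral_pushforward//; last 2 first.
- by case/integrableP : fi.
- exact: leb_integrable_consP.
rewrite preimage_setT -integral12_prod_meas1//.
exact: leb_integrable_consP.
Qed.

Lemma leb_0 (f : 'rV[R]_0 -> R) :
  (leb 0).-integrable setT (EFin \o f : mrV 0 -> \bar R) ->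
  (\int[leb 0]_x (f x)%:E)%E = (f 0)%:E.
Proof.
move=> fi; rewrite integralE !leb_ge0_0//.
- by have /(congr1 (fun g => g 0)) := funeposneg (EFin \o f).
- by apply: measurable_funeneg; case/integrableP : fi.
- by apply: measurable_funepos; case/integrableP : fi.
Qed.


Lemma measurable_prod_coord d (h : R -> R) : measurable_fun setT h ->
  measurable_fun setT (fun x : mrV d => \prod_i h ((x : 'rV[R]_d) 0 i)).
Proof.
move=> mh; apply: measurable_prod => i _.
exact: (measurableT_comp mh (measurable_coord i)).
Qed.

Lemma leb_prod_ge0 d (h : R -> R) : measurable_fun setT h -> (forall x, 0 <= h x) ->
  (\int[leb d]_x (\prod_i h ((x : 'rV[R]_d) ord0 i))%:E =
   \prod_(i < d) \int[leb1]_t (h t)%:E)%E.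
Proof.
move=> mh h0; elim: d => [|d IH].
  rewrite leb_ge0_0 ?big_ord0//.
  - by apply/measurable_EFinP; exact: measurable_prod_coord.
  - by move=> x; rewrite lee_fin prodr_ge0.
rewrite leb_ge0_cons; last 2 first.
  - by apply/measurable_EFinP; exact: measurable_prod_coord.
  - by move=> x; rewrite lee_fin prodr_ge0.
under eq_integral => t _.
  under eq_integral => x _.
    rewrite big_ord_recl cons_rV0.
    under eq_bigr do rewrite cons_rVS.
    rewrite EFinM; over.
  rewrite ge0_integralZl//; last 3 first.
    + by apply/measurable_EFinP; exact: measurable_prod_coord.
    + by move=> x _; rewrite lee_fin prodr_ge0.
    + by rewrite lee_fin.
  rewrite IH; over.
rewrite big_ord_recl ge0_integralZr//.
- exact/measurable_EFinP.
- by move=> x _; rewrite lee_fin.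
- by apply: prode_ge0 => i _; apply: integral_ge0 => x _; rewrite lee_fin.
Qed.


(** The image of [a] times Lebesgue measure under [z |-> b + a z] gives every
interval its length, and this characterizes Lebesgue measure. *)
Lemma lebesgue_affine (a b : R) (F : R -> \bar R) : 0 < a ->
  measurable_fun setT F -> (forall x, 0 <= F x)%E ->
  (\int[leb1]_y F y = a%:E * \int[leb1]_z F (b + a * z)%R)%E.
Proof.
move=> a0 mF F0.
pose phi (z : measurableTypeR R) : measurableTypeR R := b + a * z.
have mphi : measurable_fun setT phi.
  by apply: measurable_funD => //; exact: measurable_funM.
have an : 0 <= a by exact: ltW.
pose nu1 : {measure set (measurableTypeR R) -> \bar R} := pushforward leb1 phi.
pose nu := mscale (NngNum an) (nu1 mphi).
rewrite (eq_measure_integral nu) => [|A mA _].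
  rewrite ge0_integral_mscale// ge0_integral_pushforward//.
apply: lebesgue_measure_unique mA => _ [[u v] _ <-] /=.
rewrite /nu /= /mscale /= /pushforward.
have -> : phi @^-1` `]u, v] = `](u - b) / a, (v - b) / a]%classic.
  apply/seteqP; split=> z /=; rewrite !in_itv/= ltr_pdivrMr// ler_pdivlMr// /phi;
  by rewrite ltrBlDl lerBrDl (mulrC z).
rewrite !lebesgue_measure_itv/= !lte_fin ltr_pM2r ?invr_gt0// ltrD2r.
case: ifP => uv; last by rewrite mule0.
by rewrite -!EFinB -EFinM; congr EFin; field; rewrite gt_eqF.
Qed.

Lemma cons_rVD d (s t a : R) (x y : 'rV[R]_d) :
  cons_rV s x + a *: cons_rV t y = cons_rV (s + a * t) (x + a *: y).
Proof.
apply/rowP => i; case: (unliftP ord0 i) => [j|] ->.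
  rewrite [LHS]mxE [X in _ + X]mxE !cons_rVS.
  by rewrite [RHS]mxE [X in _ = _ + X]mxE.
by rewrite [LHS]mxE [X in _ + X]mxE !cons_rV0.
Qed.

Lemma measurable_affine_rV d (a : R) (x : 'rV[R]_d) :
  measurable_fun setT (fun z : mrV d => (x + a *: (z : 'rV[R]_d)) : mrV d).
Proof.
apply: measurable_fun_rV => i; under eq_fun do rewrite !mxE.
by apply: measurable_funD => //; apply: measurable_funM => //; exact: measurable_coord.
Qed.

Lemma leb_affine d (a : R) (x : 'rV[R]_d) (F : 'rV[R]_d -> \bar R) : 0 < a ->
  measurable_fun setT (F : mrV d -> \bar R) -> (forall y, 0 <= F y)%E ->
  (\int[leb d]_y F y = (a ^+ d)%:E * \int[leb d]_z F (x + a *: (z : 'rV[R]_d))%R)%E.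
Proof.
move=> a0; elim: d x F => [|d IH] x F mF F0.
  rewrite !leb_ge0_0//; last exact: (measurableT_comp mF (measurable_affine_rV a x)).
  by rewrite expr0 mul1e; congr F; apply/rowP => -[].
have mFa : measurable_fun setT (fun z : mrV d.+1 => F (x + a *: (z : 'rV[R]_d.+1))).
  exact: (measurableT_comp mF (measurable_affine_rV a x)).
rewrite (leb_ge0_cons mF F0) (lebesgue_affine (x 0 0) a0 (measurable_leb_cons mF F0)); last first.
  by move=> t; apply: integral_ge0.
rewrite (leb_ge0_cons mFa (fun z => F0 _)) exprS EFinM -[RHS]muleA.
congr (_ * _)%E.
rewrite -ge0_integralZl//; last 3 first.
- exact: (measurable_leb_cons mFa).
- by move=> t _; apply: integral_ge0.
- by rewrite lee_fin exprn_ge0// ltW.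
apply: eq_integral => t _.
rewrite (IH (tail_rV x) (fun y => F (cons_rV (x 0 0 + a * t) y)))//; last first.
  exact: (measurableT_comp mF (measurable_cons_rV2 _)).
congr (_ * _)%E; apply: eq_integral => y _.
by rewrite -[x in RHS]cons_rVK cons_rVD.
Qed.

Definition cube d (r : R) : set 'rV[R]_d := [set x | forall i, `|x 0 i| <= r].

Lemma measurable_cube d r : measurable (@cube d r : set (mrV d)).
Proof.
rewrite (_ : cube r = \bigcap_(i in [set: 'I_d])
     ((fun x : mrV d => (x : 'rV[R]_d) 0 i) @^-1` `[- r, r]%classic)).
  apply: fin_bigcap_measurable => // i _.
  by rewrite -[X in measurable X]setTI; apply: measurable_coord.
apply/seteqP; split=> x /=.
  by move=> bx i _; rewrite /= in_itv/= -ler_norml.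
by move=> bx i; have := bx i I; rewrite /= in_itv/= -ler_norml.
Qed.

Lemma leb_cube_fin d (r : R) : (leb d (@cube d r) < +oo)%E.
Proof.
rewrite -[X in (X < _)%E]mul1e -integral_cst; last exact: measurable_cube.
rewrite integral_mkcond/=.
apply: (@le_lt_trans _ _ (\int[leb d]_x
  (\prod_i \1_(`[-r, r]) ((x : 'rV[R]_d) ord0 i))%:E)%E).
  apply: ge0_le_integral => //.
  - by move=> x _; rewrite patchE; case: ifP.
  - by apply/(measurable_restrictT _ _).1; [exact: measurable_cube|].
  - by apply/measurable_EFinP; exact: measurable_prod_coord.
  - move=> x _; rewrite patchE; case: ifPn => [|_]; last first.
      by rewrite lee_fin prodr_ge0.
    rewrite inE => cx; rewrite big1// => i _.
    by rewrite indicE mem_set//= in_itv/= -ler_norml.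
rewrite leb_prod_ge0//.
have -> : (\int[leb1]_t (\1_`[(- r), r] t)%:E = leb1 (`[(- r)%R, r]%classic : set R))%E.
  by rewrite integral_indic// setIT.
have -> : (leb1 (`[(- r)%R, r]%classic : set R) = (if - r < r then r - - r else 0)%:E)%E.
  rewrite -[LHS]/(lebesgue_measure _) lebesgue_measure_itv/= lte_fin.
  by case: ifP.
by rewrite prodEFin ltry.
Qed.

Lemma integrable_bounded d (f : 'rV[R]_d -> R) M r :
  measurable_fun setT (f : mrV d -> R) -> (forall x, `|f x| <= M) ->
  (forall x, f x != 0 -> cube r x) ->
  (leb d).-integrable setT (EFin \o f : mrV d -> \bar R).
Proof.
move=> mf fM fr; apply/integrableP; split; first exact/measurable_EFinP.
apply: (@le_lt_trans _ _ (\int[leb d]_(x in cube r) (cst M%:E x))%E).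
  rewrite [leRHS]integral_mkcond; apply: ge0_le_integral => //.
  - by apply: measurableT_comp => //; exact/measurable_EFinP.
  - by apply/(measurable_restrictT _ _).1; [exact: measurable_cube|].
  - move=> x _; rewrite /= patchE; case: ifPn => [_|]; first by rewrite lee_fin.
    rewrite notin_setE lee_fin => nx; have [->|/fr//] := eqVneq (f x) 0.
    by rewrite normr0.
rewrite integral_cst; last exact: measurable_cube.
by rewrite lte_mul_pinfty ?lee_fin ?leb_cube_fin// (le_trans _ (fM 0)).
Qed.

(** For a function of varying sign the iterated integral has a meaning at each
stage because the partial functions stay bounded with bounded support. *)
Lemma integral_rV_bounded d (f : 'rV[R]_d -> R) M r :
  measurable_fun setT (f : mrV d -> R) -> (forall x, `|f x| <= M) ->
  (forall x, f x != 0 -> cube r x) ->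
  integral_rV (fun x => (f x)%:E) = (\int[leb d]_x (f x)%:E)%E.
Proof.
elim: d f => [|d IH] f mf fM fr.
  by rewrite leb_0//; exact: (integrable_bounded mf fM fr).
rewrite leb_cons; last exact: (integrable_bounded mf fM fr).
apply: eq_integral => t _; apply: IH => //.
- exact: (measurableT_comp mf (measurable_cons_rV2 _)).
- move=> x /fr fx i; have := fx (lift ord0 i).
  by rewrite cons_rVS.
Qed.

End MeasureOnRows.

(** * Complex-valued integrals *)

Local Notation cRe := (@complex.Re _).
Local Notation cIm := (@complex.Im _).
Local Notation cnorm := (@Normc.normc _).

Section ComplexNumbers.
Context {R : realType}.
Implicit Types z u v : R[i].

Lemma cReD u v : cRe (u + v) = cRe u + cRe v.
Proof. by case: u v => [a b] [c d]. Qed.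
Lemma cImD u v : cIm (u + v) = cIm u + cIm v.
Proof. by case: u v => [a b] [c d]. Qed.
Lemma cReN u : cRe (- u) = - cRe u.
Proof. by case: u. Qed.
Lemma cImN u : cIm (- u) = - cIm u.
Proof. by case: u. Qed.
Lemma cReM u v : cRe (u * v) = cRe u * cRe v - cIm u * cIm v.
Proof. by case: u v => [a b] [c d]. Qed.
Lemma cImM u v : cIm (u * v) = cRe u * cIm v + cIm u * cRe v.
Proof. by case: u v => [a b] [c d]. Qed.
Definition cpart := (cReD, cImD, cReN, cImN, cReM, cImM).

Lemma cplx_ext u v : cRe u = cRe v -> cIm u = cIm v -> u = v.
Proof. by case: u v => [a b] [c d] /= -> ->. Qed.

Lemma cnormE z : cnorm z = Num.sqrt (cRe z ^+ 2 + cIm z ^+ 2).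
Proof. by case: z. Qed.

Lemma cnorm_ge0 z : 0 <= cnorm z.
Proof. by rewrite cnormE sqrtr_ge0. Qed.

Lemma cnormD u v : cnorm (u + v) <= cnorm u + cnorm v.
Proof. exact: le_normcD. Qed.

Lemma cnormN u : cnorm (- u) = cnorm u.
Proof. exact: normcN. Qed.

Lemma cnormB u v : cnorm (u - v) = cnorm (v - u).
Proof. by rewrite -cnormN opprB. Qed.

Lemma cnorm0 : cnorm (0 : R[i]) = 0. Proof. exact: Normc.normc0. Qed.

Lemma cnorm_eq0 z : cnorm z = 0 -> z = 0.
Proof. exact: Normc.eq0_normc. Qed.

Lemma cRe_le z : `|cRe z| <= cnorm z.
Proof. by rewrite cnormE -sqrtr_sqr ler_wsqrtr// lerDl sqr_ge0. Qed.

Lemma cIm_le z : `|cIm z| <= cnorm z.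
Proof. by rewrite cnormE -sqrtr_sqr ler_wsqrtr// lerDr sqr_ge0. Qed.

Lemma cnorm_le z : cnorm z <= `|cRe z| + `|cIm z|.
Proof.
rewrite cnormE -[leRHS]ger0_norm ?addr_ge0// -sqrtr_sqr ler_wsqrtr//.
by rewrite sqrrD !real_normK ?num_real// addrAC lerDl mulrn_wge0// mulr_ge0.
Qed.

Definition cis (t : R) : R[i] := Complex (cos t) (sin t).

Lemma cisD s t : cis (s + t) = cis s * cis t.
Proof.
by apply: cplx_ext; rewrite ?cpart /= ?cosD ?sinD; [|rewrite addrC].
Qed.

Lemma cis0 : cis 0 = 1.
Proof. by apply: cplx_ext; rewrite /= ?cos0 ?sin0. Qed.

Lemma cnorm_cis t : cnorm (cis t) = 1.
Proof. by rewrite cnormE /= cos2Dsin2 sqrtr1. Qed.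

Lemma cnorm_real (x : R) : cnorm (x%:C)%C = `|x|.
Proof. by rewrite cnormE /= expr0n/= addr0 sqrtr_sqr. Qed.

End ComplexNumbers.

Section ComplexIntegral.
Context {R : realType} {dd : measure_display} {T : measurableType dd}.
Variable mu : {measure set T -> \bar R}.
Implicit Types f g : T -> R[i].

Definition cmeasurable f :=
  measurable_fun setT (cRe \o f) /\ measurable_fun setT (cIm \o f).

Definition cint f : R[i] :=
  Complex (fine (\int[mu]_x (cRe (f x))%:E)%E) (fine (\int[mu]_x (cIm (f x))%:E)%E).

Definition cintegrable f :=
  mu.-integrable setT (fun x => (cRe (f x))%:E) /\
  mu.-integrable setT (fun x => (cIm (f x))%:E).

Lemma cmeasurable_norm f : cmeasurable f -> measurable_fun setT (cnorm \o f).
Proof.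
move=> [mr mi]; rewrite (_ : _ \o _ =
  Num.sqrt \o (fun x => cRe (f x) ^+ 2 + cIm (f x) ^+ 2)); last first.
  by apply/funext => x /=; rewrite cnormE.
apply: measurableT_comp.
  by apply: continuous_measurable_fun; exact: sqrt_continuous.
by apply: measurable_funD; apply: measurable_funX.
Qed.

Lemma cmeasurableD f g : cmeasurable f -> cmeasurable g ->
  cmeasurable (fun x => f x + g x).
Proof.
move=> [mf1 mf2] [mg1 mg2]; split; rewrite /comp.
- by under eq_fun do rewrite cReD; exact: measurable_funD.
- by under eq_fun do rewrite cImD; exact: measurable_funD.
Qed.

Lemma cmeasurableN f : cmeasurable f -> cmeasurable (fun x => - f x).
Proof.
move=> [mf1 mf2]; split; rewrite /comp.
- under eq_fun do rewrite cReN; exact: measurable_funN.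
- under eq_fun do rewrite cImN; exact: measurable_funN.
Qed.

Lemma cmeasurableB f g : cmeasurable f -> cmeasurable g ->
  cmeasurable (fun x => f x - g x).
Proof. by move=> mf mg; apply: cmeasurableD => //; exact: cmeasurableN. Qed.

Lemma cmeasurableM f g : cmeasurable f -> cmeasurable g ->
  cmeasurable (fun x => f x * g x).
Proof.
move=> [mf1 mf2] [mg1 mg2]; split; rewrite /comp.
- by under eq_fun do rewrite cReM; apply: measurable_funB; exact: measurable_funM.
- by under eq_fun do rewrite cImM; apply: measurable_funD; exact: measurable_funM.
Qed.

Lemma cmeasurable_cst (a : R[i]) : cmeasurable (fun=> a).
Proof. by split; exact: measurable_cst. Qed.

Lemma cmeasurable_real (h : T -> R) : measurable_fun setT h ->
  cmeasurable (fun x => ((h x)%:C)%C).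
Proof. by move=> mh; split => //=; exact: measurable_cst. Qed.

Lemma cmeasurable_cis (h : T -> R) : measurable_fun setT h ->
  cmeasurable (fun x => cis (h x)).
Proof.
by move=> mh; split => /=; apply: measurableT_comp => //;
  apply: continuous_measurable_fun; [exact: continuous_cos|exact: continuous_sin].
Qed.

Lemma cintegrableP f : cintegrable f <->
  cmeasurable f /\ (\int[mu]_x (cnorm (f x))%:E < +oo)%E.
Proof.
split=> [[/integrableP[m1 i1] /integrableP[m2 i2]]|[mf nf]].
  have mf : cmeasurable f by split; exact/measurable_EFinP.
  split=> //.
  apply: (@le_lt_trans _ _ (\int[mu]_x (`|(cRe (f x))%:E| + `|(cIm (f x))%:E|))%E).
    apply: ge0_le_integral => //.
    - by move=> x _; rewrite lee_fin cnorm_ge0.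
    - by apply/measurable_EFinP; exact: cmeasurable_norm.
    - by apply: emeasurable_funD; exact: measurableT_comp.
    - by move=> x _; rewrite /= -EFinD lee_fin cnorm_le.
  rewrite ge0_integralD//; first exact: lte_add_pinfty.
  - exact: measurableT_comp.
  - exact: measurableT_comp.
have H (h : T -> R) : measurable_fun setT h -> (forall x, `|h x| <= cnorm (f x)) ->
    mu.-integrable setT (fun x => (h x)%:E).
  move=> mh hf; apply/integrableP; split; first exact/measurable_EFinP.
  apply: le_lt_trans nf; apply: ge0_le_integral => //.
  - by apply: measurableT_comp => //; exact/measurable_EFinP.
  - by apply/measurable_EFinP; exact: cmeasurable_norm.
  - by move=> x _; rewrite lee_fin.
by case: mf => m1 m2; split; apply: H => // x; [exact: cRe_le|exact: cIm_le].
Qed.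

Lemma cintegrable_le f (h : T -> R) : cmeasurable f ->
  (forall x, cnorm (f x) <= h x) -> mu.-integrable setT (EFin \o h) ->
  cintegrable f.
Proof.
move=> mf fh /integrableP[mh hi]; apply/cintegrableP; split=> //.
apply: le_lt_trans hi; apply: ge0_le_integral => //.
- by move=> x _; rewrite lee_fin cnorm_ge0.
- by apply/measurable_EFinP; exact: cmeasurable_norm.
- exact: measurableT_comp.
- by move=> x _; rewrite lee_fin (le_trans (fh x))// ler_norm.
Qed.

Lemma cintegrable_norm f : cintegrable f ->
  mu.-integrable setT (fun x => (cnorm (f x))%:E).
Proof.
move=> /cintegrableP[mf nf]; apply/integrableP; split.
  by apply/measurable_EFinP; exact: cmeasurable_norm.
rewrite (eq_integral (fun x => (cnorm (f x))%:E))// => x _.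
by rewrite /= ger0_norm ?cnorm_ge0.
Qed.

Lemma cintegrableD f g : cintegrable f -> cintegrable g ->
  cintegrable (fun x => f x + g x).
Proof.
move=> [f1 f2] [g1 g2]; split.
- by under eq_fun do rewrite cReD EFinD; exact: integrableD.
- by under eq_fun do rewrite cImD EFinD; exact: integrableD.
Qed.

Lemma cintegrableZ (a : R[i]) f : cintegrable f -> cintegrable (fun x => a * f x).
Proof.
move=> [f1 f2]; split.
- under eq_fun do rewrite cReM EFinB !EFinM.
  by apply: integrableB => //; exact: integrableZl.
- under eq_fun do rewrite cImM EFinD !EFinM.
  by apply: integrableD => //; exact: integrableZl.
Qed.

Lemma cintegrableN f : cintegrable f -> cintegrable (fun x => - f x).
Proof. by move=> /(cintegrableZ (-1)); under eq_fun do rewrite mulN1r. Qed.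

Lemma cintegrableB f g : cintegrable f -> cintegrable g ->
  cintegrable (fun x => f x - g x).
Proof. by move=> fi gi; apply: cintegrableD => //; exact: cintegrableN. Qed.

Lemma fine_integralD (h k : T -> R) : mu.-integrable setT (EFin \o h) ->
  mu.-integrable setT (EFin \o k) ->
  fine (\int[mu]_x (h x + k x)%:E)%E =
  fine (\int[mu]_x (h x)%:E)%E + fine (\int[mu]_x (k x)%:E)%E.
Proof.
move=> hi ki; under eq_integral do rewrite EFinD.
by rewrite integralD//= fineD// integrable_fin_num.
Qed.

Lemma fine_integralZ a (h : T -> R) : mu.-integrable setT (EFin \o h) ->
  fine (\int[mu]_x (a * h x)%:E)%E = a * fine (\int[mu]_x (h x)%:E)%E.
Proof.
move=> hi; under eq_integral do rewrite EFinM.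
by rewrite integralZl//= fineM// integrable_fin_num.
Qed.

Lemma cintD f g : cintegrable f -> cintegrable g ->
  cint (fun x => f x + g x) = cint f + cint g.
Proof.
move=> [f1 f2] [g1 g2]; apply: cplx_ext; rewrite ?cpart /=.
- by rewrite -fine_integralD//; under eq_integral do rewrite cReD.
- by rewrite -fine_integralD//; under eq_integral do rewrite cImD.
Qed.

Lemma cintZ a f : cintegrable f -> cint (fun x => a * f x) = a * cint f.
Proof.
have Z b h : mu.-integrable setT (EFin \o h) ->
    mu.-integrable setT (EFin \o (fun x : T => b * h x)).
  by move=> hi; under [EFin \o _]eq_fun do rewrite /= EFinM; exact: integrableZl.
move=> [f1 f2]; apply: cplx_ext; rewrite ?cpart /=.
- rewrite -mulNr -!fine_integralZ// -fine_integralD; [|exact: Z..].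
  by under eq_integral do rewrite cReM -mulNr.
- rewrite -!fine_integralZ// -fine_integralD; [|exact: Z..].
  by under eq_integral do rewrite cImM.
Qed.

Lemma cintZr a f : cintegrable f -> cint (fun x => f x * a) = cint f * a.
Proof.
move=> fi; rewrite [RHS]mulrC -cintZ//.
by congr cint; apply/funext => x; rewrite mulrC.
Qed.

Lemma cintB f g : cintegrable f -> cintegrable g ->
  cint (fun x => f x - g x) = cint f - cint g.
Proof.
move=> fi gi; rewrite cintD//; last exact: cintegrableN.
congr (_ + _); rewrite -mulN1r -cintZ//.
by congr cint; apply/funext => x; rewrite mulN1r.
Qed.

(** Rotating [f] by the conjugate of its integral reduces the triangle
inequality to the real one. *)
Lemma cnorm_cint f : cintegrable f ->
  ((cnorm (cint f))%:E <= \int[mu]_x (cnorm (f x))%:E)%E.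
Proof.
move=> fi; set z := cint f.
have [/eqP z0|z0] := eqVneq (cnorm z) 0.
  by rewrite (eqP z0); apply: integral_ge0 => x _; rewrite lee_fin cnorm_ge0.
have zp : 0 < cnorm z by rewrite lt_neqAle eq_sym z0 cnorm_ge0.
have zbfi : cintegrable (fun x => (z^*)%C * f x) by exact: cintegrableZ.
have : (cnorm z ^+ 2)%:E = (\int[mu]_x (cRe ((z^*)%C * f x))%:E)%E.
  rewrite -[RHS]fineK; last by apply: integrable_fin_num => //; case: zbfi.
  rewrite -[fine _]/(cRe (cint (fun x => (z^*)%C * f x))) cintZ// -/z.
  congr EFin; rewrite cnormE sqr_sqrtr ?addr_ge0 ?sqr_ge0//.
  by case: (z) => a b; rewrite cReM/= mulNr opprK !expr2.
move=> zE.
have fn := cintegrable_norm fi.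
have : ((cnorm z ^+ 2)%:E <= \int[mu]_x ((cnorm z)%:E * (cnorm (f x))%:E))%E.
  rewrite zE; apply: le_integral => //.
  - by case: zbfi.
  - exact: integrableZl.
  - move=> x _; rewrite -EFinM lee_fin (le_trans (ler_norm _))//.
    rewrite (le_trans (cRe_le _))// Normc.normcM ler_wpM2r ?cnorm_ge0//.
    by case: (z) => a b; rewrite /= sqrrN.
rewrite integralZl// -[X in (_ <= _ * X)%E -> _]fineK ?integrable_fin_num//.
rewrite -EFinM lee_fin expr2 ler_pM2l// -lee_fin fineK//.
exact: integrable_fin_num.
Qed.

Lemma cint_dominated (f_ : nat -> T -> R[i]) f (h : T -> R) :
  (forall n, cmeasurable (f_ n)) -> cmeasurable f ->
  (forall n x, cnorm (f_ n x) <= h x) -> (forall x, cnorm (f x) <= h x) ->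
  mu.-integrable setT (EFin \o h) ->
  (forall x, cnorm (f_ n x - f x) @[n --> \oo] --> 0) ->
  cnorm (cint (f_ n) - cint f) @[n --> \oo] --> 0.
Proof.
move=> mf_ mf f_h fh hi f_f.
have fi : cintegrable f by exact: cintegrable_le hi.
have f_i n : cintegrable (f_ n) by exact: cintegrable_le hi.
have dm n : measurable_fun setT (fun x => (cnorm (f_ n x - f x))%:E).
  by apply/measurable_EFinP; apply: cmeasurable_norm; exact: cmeasurableB.
have H1 : {ae mu, forall x, setT x ->
    (cnorm (f_ n x - f x))%:E @[n --> \oo] --> cst 0%E x}.
  by apply: aeW => x _; apply: cvg_EFin; [exact: nearW|exact: f_f].
have H2 : mu.-integrable setT (fun x => (h x + h x)%:E).
  by under eq_fun do rewrite EFinD; exact: integrableD.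
have H3 : {ae mu, forall x n, setT x ->
    (`|(cnorm (f_ n x - f x))%:E| <= (h x + h x)%:E)%E}.
  apply: aeW => x n _; rewrite /= lee_fin ger0_norm ?cnorm_ge0//.
  by rewrite (le_trans (cnormD _ _))// cnormN lerD.
have [_ _] := dominated_convergence measurableT dm (measurable_cst _) H1 H2 H3.
rewrite integral_cst// mul0e => H.
have di n : cintegrable (fun x => f_ n x - f x) by exact: cintegrableB.
have {}H : fine (\int[mu]_x (cnorm (f_ n x - f x))%:E)%E @[n --> \oo] --> 0.
  by apply: fine_cvg.
apply: squeeze_cvgr (cvg_cst 0) H; apply: nearW => n.
rewrite cnorm_ge0 -(cintB (f_i n) fi)/= -lee_fin fineK ?cnorm_cint//.
exact: integrable_fin_num (cintegrable_norm (di n)).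
Qed.

End ComplexIntegral.

Section ComplexFubini.
Context {R : realType} {d1 d2 : measure_display}.
Context {T1 : measurableType d1} {T2 : measurableType d2}.
Variable m1 : {sigma_finite_measure set T1 -> \bar R}.
Variable m2 : {sigma_finite_measure set T2 -> \bar R}.

Lemma cFubini (f : T1 * T2 -> R[i]) : cmeasurable f ->
  (\int[m1]_x \int[m2]_y (cnorm (f (x, y)))%:E < +oo)%E ->
  (forall x, cintegrable m2 (fun y => f (x, y))) ->
  (forall y, cintegrable m1 (fun x => f (x, y))) ->
  cintegrable m1 (fun x => cint m2 (fun y => f (x, y))) /\
  cint m1 (fun x => cint m2 (fun y => f (x, y))) =
  cint m2 (fun y => cint m1 (fun x => f (x, y))).
Proof.
move=> mf ffin i2 i1.
have H (h : T1 * T2 -> R) : measurable_fun setT h ->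
    (forall p, `|h p| <= cnorm (f p)) ->
    (m1 \x m2)%E.-integrable setT (EFin \o h).
  move=> mh hf; apply/integrable12ltyP; first exact/measurable_EFinP.
  apply: le_lt_trans ffin; apply: ge0_le_integral => //.
  - by move=> x _; exact: integral_ge0.
  - apply: (measurable_fun_fubini_tonelli_F (fun p => `|(h p)%:E|)%E) => //.
    by apply: measurableT_comp => //; exact/measurable_EFinP.
  - apply: (measurable_fun_fubini_tonelli_F (fun p => (cnorm (f p))%:E)) => //.
      by apply/measurable_EFinP; exact: cmeasurable_norm.
    by move=> p; rewrite lee_fin cnorm_ge0.
  - move=> x _; apply: ge0_le_integral => //.
    + apply: measurableT_comp => //; apply/measurable_EFinP.
      exact: (measurableT_comp mh (pair1_measurable x)).
    + apply/measurable_EFinP.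
      exact: (measurableT_comp (cmeasurable_norm mf) (pair1_measurable x)).
    + by move=> y _; rewrite /= lee_fin.
have HR : (m1 \x m2)%E.-integrable setT (fun p => (cRe (f p))%:E).
  by apply: H => [|p]; [case: mf|exact: cRe_le].
have HI : (m1 \x m2)%E.-integrable setT (fun p => (cIm (f p))%:E).
  by apply: H => [|p]; [case: mf|exact: cIm_le].
have fR x : (fine (\int[m2]_y (cRe (f (x, y)))%:E))%:E = (\int[m2]_y (cRe (f (x, y)))%:E)%E.
  by rewrite fineK//; apply: integrable_fin_num => //; case: (i2 x).
have fI x : (fine (\int[m2]_y (cIm (f (x, y)))%:E))%:E = (\int[m2]_y (cIm (f (x, y)))%:E)%E.
  by rewrite fineK//; apply: integrable_fin_num => //; case: (i2 x).
have gR y : (fine (\int[m1]_x (cRe (f (x, y)))%:E))%:E = (\int[m1]_x (cRe (f (x, y)))%:E)%E.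
  by rewrite fineK//; apply: integrable_fin_num => //; case: (i1 y).
have gI y : (fine (\int[m1]_x (cIm (f (x, y)))%:E))%:E = (\int[m1]_x (cIm (f (x, y)))%:E)%E.
  by rewrite fineK//; apply: integrable_fin_num => //; case: (i1 y).
split.
- split; rewrite /cint/=.
  + by under eq_fun do rewrite fR; exact: (integrable_fubini_F HR).
  + by under eq_fun do rewrite fI; exact: (integrable_fubini_F HI).
- apply: cplx_ext; rewrite /cint/=; congr fine.
  + under eq_integral do rewrite fR; under [RHS]eq_integral do rewrite gR.
    exact: (Fubini HR).
  + under eq_integral do rewrite fI; under [RHS]eq_integral do rewrite gI.
    exact: (Fubini HI).
Qed.

End ComplexFubini.

Section ComplexRows.
Context {R : realType} {d : nat}.
Implicit Types f : 'rV[R]_d -> R[i].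
Notation lebd := (@leb R d).

Lemma cintegral_rVE f M r : @cmeasurable _ _ (mrV d) f ->
  (forall x, cnorm (f x) <= M) -> (forall x, f x != 0 -> cube r x) ->
  @cintegrable _ _ (mrV d) lebd f /\ cintegral_rV f = cint lebd f.
Proof.
move=> [m1 m2] fM fr.
have b1 x : `|cRe (f x)| <= M by rewrite (le_trans (cRe_le _)).
have b2 x : `|cIm (f x)| <= M by rewrite (le_trans (cIm_le _)).
have r1 x : cRe (f x) != 0 -> cube r x.
  by move=> n; apply: fr; apply: contra_neq n => ->.
have r2 x : cIm (f x) != 0 -> cube r x.
  by move=> n; apply: fr; apply: contra_neq n => ->.
split; first by split; [exact: (integrable_bounded m1 b1 r1)|
                        exact: (integrable_bounded m2 b2 r2)].
by apply: cplx_ext; rewrite /= ?(integral_rV_bounded m1 b1 r1)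
  ?(integral_rV_bounded m2 b2 r2).
Qed.

Lemma cintegrable_affine f (a : R) (x : 'rV[R]_d) : 0 < a ->
  @cintegrable _ _ (mrV d) lebd f ->
  @cintegrable _ _ (mrV d) lebd (fun z => f (x + a *: (z : 'rV[R]_d))) /\
  cint lebd f = ((a ^+ d)%:C)%C * cint lebd (fun z : mrV d => f (x + a *: (z : 'rV[R]_d))).
Proof.
move=> a0 fi; have [mf nf] := (cintegrableP _ _).1 fi.
have ad : 0 < a ^+ d by exact: exprn_gt0.
have mfa : @cmeasurable _ _ (mrV d) (fun z => f (x + a *: (z : 'rV[R]_d))).
  by case: mf => m1 m2; split;
    [exact: (measurableT_comp m1 (measurable_affine_rV a x))|
     exact: (measurableT_comp m2 (measurable_affine_rV a x))].
have fai : @cintegrable _ _ (mrV d) lebd (fun z => f (x + a *: (z : 'rV[R]_d))).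
  apply/cintegrableP; split=> //.
  move: nf; rewrite (leb_affine x a0)//; last 2 first.
  - by apply/measurable_EFinP; exact: cmeasurable_norm.
  - by move=> y; rewrite lee_fin cnorm_ge0.
  move: (\int[_]_z _)%E => [r _||]; rewrite ?ltry// ?ltNyr//.
  by rewrite mulry gtr0_sg// mul1e.
split=> //.
have H (h : 'rV[R]_d -> R) : lebd.-integrable setT (EFin \o h : mrV d -> \bar R) ->
  lebd.-integrable setT (fun z : mrV d => (h (x + a *: (z : 'rV[R]_d)))%:E) ->
  fine (\int[lebd]_y (h y)%:E)%E =
  a ^+ d * fine (\int[lebd]_z (h (x + a *: (z : 'rV[R]_d)))%:E)%E.
  move=> hi hai; have mh := measurable_int _ hi.
  rewrite [X in fine X = _]integralE [X in _ = _ * fine X]integralE.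
  have -> := leb_affine x a0 (measurable_funepos mh) (fun=> funepos_ge0 _ _).
  have -> := leb_affine x a0 (measurable_funeneg mh) (fun=> funeneg_ge0 _ _).
  have Pf := integrable_pos_fin_num measurableT hai.
  have Nf := integrable_neg_fin_num measurableT hai.
  move: Pf Nf; set P := (\int[_]_z _^\+ z)%E; set N := (\int[_]_z _^\- z)%E => Pf Nf.
  have -> : (\int[lebd]_z (EFin \o h)^\+ (x + a *: (z : 'rV[R]_d))%R = P)%E.
    by apply: eq_integral => z _; rewrite !funeposE.
  have -> : (\int[lebd]_z (EFin \o h)^\- (x + a *: (z : 'rV[R]_d))%R = N)%E.
    by apply: eq_integral => z _; rewrite !funenegE.
  by rewrite -muleBr ?fin_num_adde_defr// fineM// fin_numB Pf Nf.
apply: cplx_ext; rewrite ?cpart /= mul0r ?subr0 ?addr0; apply: H.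
- by case: fi.
- by case: fai.
- by case: fi.
- by case: fai.
Qed.

End ComplexRows.

(** * Laplace and Poisson kernels *)

Section PoissonKernel.
Context {R : realType}.
Implicit Types (a y t : R).

Definition lapl a t : R := expR (- (a * `|t|)).

Lemma lapl_ge0 a t : 0 <= lapl a t.
Proof. exact: expR_ge0. Qed.

Lemma continuous_lapl a : continuous (lapl a).
Proof.
move=> t; apply: continuous_comp; last exact: continuous_expR.
apply: continuousN; apply: continuousM; first exact: cst_continuous.
exact: norm_continuous.
Qed.

Lemma measurable_lapl a : measurable_fun setT (lapl a).
Proof. by apply: continuous_measurable_fun; exact: continuous_lapl. Qed.

Let E a t : R := expR (- a * t).
Let G a y t : R := y * sin (y * t) - a * cos (y * t).
(* [F] is an antiderivative of [(1 + cos (y t)) e^(-a t)]: adding 1 to the cosine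
   keeps the integrand nonnegative, as required to integrate over a half-line. *)
Let F a y t : R := (- a^-1) * E a t + (a ^+ 2 + y ^+ 2)^-1 * (E a t * G a y t).

Let dlin c t : is_derive t 1 (fun t => c * t) c.
Proof.
have := is_deriveZ c (is_derive_id t (1 : R)).
by rewrite /GRing.scale/= mulr1.
Qed.

Let dE a t : is_derive t 1 (E a) (- a * E a t).
Proof.
have := is_derive1_comp (is_derive_expR (- a * t)) (dlin (- a) t).
by rewrite mulrC.
Qed.

Let dG a y t : is_derive t 1 (G a y) (y ^+ 2 * cos (y * t) + a * y * sin (y * t)).
Proof.
have h1 := is_derive1_comp (is_derive_sin (y * t)) (dlin y t).
have h2 := is_derive1_comp (is_derive_cos (y * t)) (dlin y t).
have := is_deriveB (is_deriveZ y h1) (is_deriveZ a h2).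
by move/is_derive_eq; apply; rewrite /GRing.scale/=; ring.
Qed.

Let dF a y t : 0 < a -> is_derive t 1 (F a y) ((1 + cos (y * t)) * E a t).
Proof.
move=> a0.
have := is_deriveD (is_deriveZ (- a^-1) (dE a t))
  (is_deriveZ (a ^+ 2 + y ^+ 2)^-1 (is_deriveM (dE a t) (dG a y t))).
move/is_derive_eq; apply; rewrite /GRing.scale/= /G; field.
by rewrite ?gt_eqF// ltr_wpDr ?sqr_ge0// exprn_gt0.
Qed.

Let E0 a : 0 < a -> E a t @[t --> +oo] --> 0.
Proof.
move=> a0; apply/cvgr0Pnorm_lt => e e0.
near=> t.
rewrite ger0_norm ?expR_ge0// /E -[ltRHS]lnK ?posrE// ltr_expR mulNr ltrNl.
rewrite mulrC -ltr_pdivrMr//.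
by near: t; apply: nbhs_pinfty_gt; exact: num_real.
Unshelve. all: by end_near. Qed.

Let F0 a y : 0 < a -> F a y t @[t --> +oo] --> 0.
Proof.
move=> a0; rewrite -[X in _ --> X](_ : - a^-1 * 0 + (a ^+ 2 + y ^+ 2)^-1 * 0 = 0); last by lra.
apply: cvgD; apply: cvgMr; first exact: E0.
have bG t : `|G a y t| <= `|y| + `|a|.
  rewrite (le_trans (ler_normB _ _))// !normrM lerD// ler_piMr//.
  - by rewrite ler_norml sin_geN1 sin_le1.
  - by rewrite ler_norml cos_geN1 cos_le1.
apply/cvgr0Pnorm_lt => e e0.
have b0 : 0 < `|y| + `|a| + 1 by rewrite ltr_wpDl// addr_ge0.
have := E0 a0 => /cvgr0Pnorm_lt /(_ (e / (`|y| + `|a| + 1))).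
rewrite divr_gt0// => /(_ isT); apply: filterS => t /=.
rewrite normrM ltr_pdivlMr//; apply: le_lt_trans.
by rewrite ler_wpM2l// (le_trans (bG t))// lerDl.
Qed.

Let half a y : 0 < a ->
  (\int[lebesgue_measure]_(t in `[0%R, +oo[) ((1 + cos (y * t)) * E a t)%:E =
  (a^-1 + a / (a ^+ 2 + y ^+ 2))%:E)%E.
Proof.
move=> a0; rewrite (@ge0_continuous_FTC2y _ _ (F a y) _ 0).
- rewrite -EFinB /F /E /G !mulr0 expR0 sin0 cos0; congr EFin; ring.
- move=> t _; apply: mulr_ge0; last exact: expR_ge0.
  by have := cos_geN1 (y * t); lra.
- apply: continuous_subspaceT => t; apply: cvgM.
    apply: cvgD; first exact: cvg_cst.
    apply: continuous_comp; last exact: continuous_cos.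
    by apply: cvgM; [exact: cvg_cst|exact: cvg_id].
  apply: continuous_comp; last exact: continuous_expR.
  by apply: cvgM; [exact: cvg_cst|exact: cvg_id].
- exact: F0.
- by move=> t _; have [] := dF y t a0.
- apply: cvg_at_right_filter; apply: differentiable_continuous.
  by apply/derivable1_diffP; have [] := dF y 0 a0.
- by move=> t _; rewrite derive1E; have [_ ->] := dF y t a0.
Qed.

Lemma lapl_cos_int a y : 0 < a ->
  (\int[leb1]_t ((1 + cos (y * t)) * lapl a t)%:E =
  (2 * a^-1 + 2 * a / (a ^+ 2 + y ^+ 2))%:E)%E.
Proof.
move=> a0; rewrite -[LHS]/(\int[lebesgue_measure]_t _)%E ge0_symfun_integralT.
- rewrite (_ : (\int[lebesgue_measure]_(t in _) _)%E =
      (a^-1 + a / (a ^+ 2 + y ^+ 2))%:E).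
    by rewrite -EFinM; congr EFin; ring.
  rewrite -half// set_itvcy; apply: eq_integral => t; rewrite inE/= => t0.
  by rewrite /lapl ger0_norm// /E mulNr.
- move=> t; apply: mulr_ge0; last exact: expR_ge0.
  by have := cos_geN1 (y * t); lra.
- move=> t; apply: cvgM; last exact: continuous_lapl.
  apply: cvgD; first exact: cvg_cst.
  apply: continuous_comp; last exact: continuous_cos.
  by apply: cvgM; [exact: cvg_cst|exact: cvg_id].
- by move=> t; rewrite /= /lapl normrN mulrN cosN.
Qed.

Lemma lapl_int a : 0 < a -> (\int[leb1]_t (lapl a t)%:E = (2 / a)%:E)%E.
Proof.
move=> a0.
transitivity (\int[leb1]_t ((2^-1)%:E * ((1 + cos (0 * t)) * lapl a t)%:E))%E.
  by apply: eq_integral => t _; rewrite -EFinM mul0r cos0; congr EFin; field.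
rewrite ge0_integralZl//; last 2 first.
- apply/measurable_EFinP; apply: measurable_funM; last exact: measurable_lapl.
  by under eq_fun do rewrite mul0r; exact: measurable_cst.
- move=> t _; rewrite lee_fin mul0r cos0.
  by apply: mulr_ge0; [lra|exact: lapl_ge0].
by rewrite lapl_cos_int// -EFinM; congr EFin; field; rewrite gt_eqF.
Qed.

Lemma lapl_integrable a : 0 < a -> leb1.-integrable setT (EFin \o lapl a).
Proof.
move=> a0; apply/integrableP; split.
  by apply/measurable_EFinP; exact: measurable_lapl.
under eq_integral do rewrite /= ger0_norm ?lapl_ge0//.
by rewrite lapl_int// ltry.
Qed.

Lemma lapl_cis_meas a y : cmeasurable (fun t => cis (y * t) * ((lapl a t)%:C)%C).
Proof.
apply: cmeasurableM; first by apply: cmeasurable_cis; exact: measurable_funM.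
by apply: cmeasurable_real; exact: measurable_lapl.
Qed.

Lemma lapl_cis_integrable a y : 0 < a ->
  cintegrable leb1 (fun t => cis (y * t) * ((lapl a t)%:C)%C).
Proof.
move=> a0; apply: cintegrable_le (lapl_integrable a0).
  exact: lapl_cis_meas.
by move=> t; rewrite Normc.normcM cnorm_cis mul1r cnorm_real ger0_norm ?lapl_ge0.
Qed.

Lemma leb1_reflect (h : R -> \bar R) : measurable_fun setT h ->
  (forall t, 0 <= h t)%E -> (\int[leb1]_t h (- t)%R = \int[leb1]_t h t)%E.
Proof.
move=> mh h0.
have mN : measurable_fun setT (fun t : measurableTypeR R => - t : measurableTypeR R).
  exact: (@oppr_measurable R setT).
pose nu : {measure set (measurableTypeR R) -> \bar R} :=
  pushforward leb1 (-%R : measurableTypeR R -> measurableTypeR R).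
rewrite [RHS](eq_measure_integral (nu mN)); last first.
  by move=> A mA _; rewrite -[LHS]lebesgue_measureN.
by rewrite ge0_integral_pushforward.
Qed.

(** The imaginary part vanishes by symmetry: reflecting the nonnegative function
[(1 + sin (y t)) e^(-a |t|)] changes the sign of the sine term only. *)
Lemma lapl_cint a y : 0 < a ->
  cint leb1 (fun t => cis (y * t) * ((lapl a t)%:C)%C) =
  ((2 * a / (a ^+ 2 + y ^+ 2))%:C)%C.
Proof.
move=> a0; have [ci si] := lapl_cis_integrable y a0.
have li := lapl_integrable a0.
have cE t : cRe (cis (y * t) * ((lapl a t)%:C)%C) = cos (y * t) * lapl a t.
  by rewrite cReM /= mulr0 subr0.
have sE t : cIm (cis (y * t) * ((lapl a t)%:C)%C) = sin (y * t) * lapl a t.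
  by rewrite cImM /= mulr0 add0r.
have {}ci : leb1.-integrable setT (fun t => (cos (y * t) * lapl a t)%:E).
  by under eq_fun do rewrite -cE.
have {}si : leb1.-integrable setT (fun t => (sin (y * t) * lapl a t)%:E).
  by under eq_fun do rewrite -sE.
apply: cplx_ext.
  rewrite -[LHS]/(fine (\int[leb1]_t (cRe (cis (y * t) * ((lapl a t)%:C)%C))%:E)%E)
    -[RHS]/(2 * a / (a ^+ 2 + y ^+ 2)).
  under eq_integral do rewrite cE.
  have : (\int[leb1]_t ((lapl a t)%:E + (cos (y * t) * lapl a t)%:E) =
      (2 / a + 2 * a / (a ^+ 2 + y ^+ 2))%:E)%E.
    rewrite -lapl_cos_int//; apply: eq_integral => t _.
    by rewrite -EFinD mulrDl mul1r.
  rewrite integralD//= lapl_int// -[X in (_ + X)%E = _ -> _]fineK ?integrable_fin_num//.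
  by rewrite -EFinD => -[]; lra.
rewrite -[LHS]/(fine (\int[leb1]_t (cIm (cis (y * t) * ((lapl a t)%:C)%C))%:E)%E) -[RHS]/0.
under eq_integral do rewrite sE.
have : (\int[leb1]_t ((lapl a t)%:E - (sin (y * t) * lapl a t)%:E) =
  \int[leb1]_t ((lapl a t)%:E + (sin (y * t) * lapl a t)%:E))%E.
  pose h t : \bar R := ((1 + sin (y * t)) * lapl a t)%:E.
  have mh : measurable_fun setT h.
    apply/measurable_EFinP; apply: measurable_funM; last exact: measurable_lapl.
    apply: measurable_funD => //; apply: measurableT_comp.
      by apply: continuous_measurable_fun; exact: continuous_sin.
    exact: measurable_funM.
  have h0 t : (0 <= h t)%E.
    rewrite lee_fin; apply: mulr_ge0; last exact: lapl_ge0.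
    by have := sin_geN1 (y * t); lra.
  transitivity (\int[leb1]_t h (- t)%R)%E.
    apply: eq_integral => t _.
    by rewrite /h mulrN sinN /lapl normrN mulrBl mul1r EFinB.
  by rewrite leb1_reflect//; apply: eq_integral => t _; rewrite /h mulrDl mul1r EFinD.
rewrite integralB//= integralD//= lapl_int//.
have := integrable_fin_num measurableT si.
move: (\int[_]_x _)%E => [r|//|//] _.
move=> /(congr1 fine); rewrite /= => h.
lra.
Qed.

Lemma poisson_int :
  (\int[leb1]_t (2 / (1 + t ^+ 2))%:E = (2 * pi)%:E :> \bar R)%E.
Proof.
have V0 t : 0 <= 2 / (1 + t ^+ 2) :> R by rewrite divr_ge0// addr_ge0// sqr_ge0.
rewrite -[LHS]/(\int[lebesgue_measure]_t _)%E ge0_symfun_integralT//.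
- rewrite -set_itvcy.
  under eq_integral do rewrite EFinM.
  rewrite ge0_integralZl//; last 2 first.
  + apply/measurable_EFinP/measurable_funTS.
    by apply: continuous_measurable_fun; exact: continuous_oneDsqrV.
  + by move=> t _; rewrite lee_fin invr_ge0 addr_ge0// sqr_ge0.
  by rewrite integral0y_oneDsqr -!EFinM; congr EFin; field.
- move=> t; apply: cvgM; first exact: cvg_cst.
  exact: continuous_oneDsqrV.
- by move=> t /=; rewrite sqrrN.
Qed.

Lemma measurable_poisson : measurable_fun setT (fun t : R => 2 / (1 + t ^+ 2)).
Proof.
apply: measurable_funM => //.
by apply: continuous_measurable_fun; exact: continuous_oneDsqrV.
Qed.

End PoissonKernel.

Section ProductKernels.
Context {R : realType}.

Lemma cint_cons d (f : 'rV[R]_d.+1 -> R[i]) :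
  @cintegrable _ _ (mrV d.+1) (leb d.+1) f ->
  (forall t, @cintegrable _ _ (mrV d) (leb d) (fun x => f (cons_rV t x))) ->
  cint (leb d.+1) f = cint leb1 (fun t => cint (leb d) (fun x : mrV d => f (cons_rV t x))).
Proof.
move=> [f1 f2] fs; apply: cplx_ext; rewrite /cint/= leb_cons//; congr fine;
  apply: eq_integral => t _; have [s1 s2] := fs t;
  by rewrite fineK//; exact: integrable_fin_num.
Qed.

Lemma cmeasurable_prod dd (T : measurableType dd) (I : finType) (F : I -> T -> R[i]) :
  (forall i, cmeasurable (F i)) -> cmeasurable (fun x => \prod_i F i x).
Proof.
move=> mF.
have -> : (fun x => \prod_i F i x) = (fun x => \prod_(i <- enum I) F i x).
  by apply/funext => x; rewrite big_enum.
elim: (enum I) => [|i s IH].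
  by under eq_fun do rewrite big_nil; exact: cmeasurable_cst.
by under eq_fun do rewrite big_cons; exact: cmeasurableM.
Qed.

Lemma cnorm_prod (I : finType) (F : I -> R[i]) :
  cnorm (\prod_i F i) = \prod_i cnorm (F i).
Proof.
by apply: (big_morph (@Normc.normc R)); [exact: Normc.normcM|exact: Normc.normc1].
Qed.

Lemma integrable_prod d (h : R -> R) : (forall t, 0 <= h t) ->
  leb1.-integrable setT (EFin \o h) ->
  (leb d).-integrable setT (fun x : mrV d => (\prod_i h ((x : 'rV[R]_d) 0 i))%:E).
Proof.
move=> h0 hi; have mh : measurable_fun setT h.
  by apply/measurable_EFinP; exact: measurable_int _ hi.
apply/integrableP; split.
  by apply/measurable_EFinP; exact: measurable_prod_coord.
under eq_integral do rewrite /= ger0_norm ?prodr_ge0//.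
rewrite leb_prod_ge0// -[X in (\prod_(_ < d) X)%E]fineK; last exact: integrable_fin_num.
by rewrite prodEFin ltry.
Qed.

(** Fubini's theorem for a product of functions of one variable each, by
induction on the dimension. *)
Lemma cint_prod d (phi : 'I_d -> R -> R[i]) (h : R -> R) : (forall t, 0 <= h t) ->
  (forall i, cmeasurable (phi i)) -> (forall i t, cnorm (phi i t) <= h t) ->
  leb1.-integrable setT (EFin \o h) ->
  @cintegrable _ _ (mrV d) (leb d) (fun x => \prod_i phi i ((x : 'rV[R]_d) 0 i)) /\
  cint (leb d) (fun x : mrV d => \prod_i phi i ((x : 'rV[R]_d) 0 i)) =
  \prod_i cint leb1 (phi i).
Proof.
move=> h0 mphi phih hi.
have I n (psi : 'I_n -> R -> R[i]) : (forall i, cmeasurable (psi i)) ->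
  (forall i t, cnorm (psi i t) <= h t) ->
  @cintegrable _ _ (mrV n) (leb n) (fun x => \prod_i psi i ((x : 'rV[R]_n) 0 i)).
  move=> mpsi psih; apply: cintegrable_le (integrable_prod n h0 hi).
    apply: cmeasurable_prod => i; have [m1 m2] := mpsi i.
    by split; [exact: (measurableT_comp m1 (measurable_coord i))|
               exact: (measurableT_comp m2 (measurable_coord i))].
  by move=> x; rewrite cnorm_prod ler_prod// => i _; rewrite cnorm_ge0 psih.
split; first exact: I.
elim: d phi mphi phih => [|d IH] phi mphi phih.
  have [i1 i2] := I _ phi mphi phih.
  by apply: cplx_ext; rewrite big_ord0 /= leb_0// big_ord0.
have E t (x : 'rV[R]_d) : \prod_i phi i (cons_rV t x 0 i) =
    phi ord0 t * \prod_i phi (lift ord0 i) (x 0 i).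
  by rewrite big_ord_recl cons_rV0; congr (_ * _); apply: eq_bigr => i _; rewrite cons_rVS.
have i0 := I _ (fun i => phi (lift ord0 i)) (fun i => mphi _) (fun i => phih _).
rewrite cint_cons; [|exact: I|]; last first.
  by move=> t; under eq_fun do rewrite E; exact: cintegrableZ.
rewrite [X in cint _ X](_ : _ = fun t => (\prod_i cint leb1 (phi (lift ord0 i))) * phi ord0 t).
  rewrite cintZ; first by rewrite big_ord_recl mulrC.
  by apply: cintegrable_le hi => //; exact: mphi.
apply/funext => t; rewrite mulrC -IH// -cintZ//.
by congr cint; apply/funext => x; rewrite E.
Qed.

Lemma prod_cis (I : finType) (F : I -> R) : \prod_i cis (F i) = cis (\sum_i F i).
Proof. by apply/esym; apply: (big_morph (@cis R)); [exact: cisD|exact: cis0]. Qed.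

Definition laplace d a (x : 'rV[R]_d) : R := \prod_i lapl a (x 0 i).
Definition poisson d (x : 'rV[R]_d) : R := \prod_i (2 / (1 + (x 0 i) ^+ 2)).

Lemma laplace_kernel d (a : R) (z : 'rV[R]_d) : 0 < a ->
  cint (leb d) (fun xi : mrV d => cis (dotp z xi) * ((laplace a xi)%:C)%C) =
  ((\prod_i (2 * a / (a ^+ 2 + z 0 i ^+ 2)))%:C)%C.
Proof.
move=> a0.
pose phi (i : 'I_d) t : R[i] := cis (z 0 i * t) * ((lapl a t)%:C)%C.
have phil i t : cnorm (phi i t) <= lapl a t.
  by rewrite Normc.normcM cnorm_cis mul1r cnorm_real ger0_norm ?lapl_ge0.
have [_] := cint_prod (lapl_ge0 a) (fun i => lapl_cis_meas a _) phil (lapl_integrable a0).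
under [X in _ = X -> _]eq_bigr do rewrite lapl_cint//.
rewrite -rmorph_prod => <-; congr cint; apply/funext => xi.
by rewrite big_split /= prod_cis -rmorph_prod.
Qed.

Lemma integrable_laplace d (a : R) : 0 < a ->
  (leb d).-integrable setT (fun x : mrV d => (laplace a x)%:E).
Proof. by move=> a0; apply: integrable_prod (lapl_ge0 a) (lapl_integrable a0). Qed.

Lemma integrable_poisson d :
  (leb d).-integrable setT (fun x : mrV d => (poisson x)%:E).
Proof.
apply: (@integrable_prod d (fun t => 2 / (1 + t ^+ 2))) => [t|].
  by rewrite divr_ge0// addr_ge0// sqr_ge0.
apply/integrableP; split; first by apply/measurable_EFinP; exact: measurable_poisson.
under eq_integral do rewrite /= ger0_norm ?divr_ge0 ?addr_ge0 ?sqr_ge0//.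
by rewrite poisson_int ltry.
Qed.

Lemma poisson_ge0 d (x : 'rV[R]_d) : 0 <= poisson x.
Proof. by apply: prodr_ge0 => i _; rewrite divr_ge0// addr_ge0// sqr_ge0. Qed.

Lemma poisson_mass d : (\int[leb d]_x (poisson x)%:E = ((2 * pi) ^+ d)%:E)%E.
Proof.
rewrite (leb_prod_ge0 d measurable_poisson); last first.
  by move=> t; rewrite divr_ge0// addr_ge0// sqr_ge0.
by rewrite poisson_int prodEFin prodr_const card_ord.
Qed.

Lemma cint_poisson d :
  @cintegrable _ _ (mrV d) (leb d) (fun z => ((poisson z)%:C)%C) /\
  cint (leb d) (fun z : mrV d => ((poisson z)%:C)%C) = (((2 * pi) ^+ d)%:C)%C.
Proof.
split; first by split; [exact: integrable_poisson|exact: integrable0].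
apply: cplx_ext; first by rewrite /cint/= poisson_mass.
by rewrite /cint/= integral0.
Qed.

End ProductKernels.

(** * Euclidean norm *)

Section EuclideanNorm.
Context {R : realType} {d : nat}.
Implicit Types x y z : 'rV[R]_d.

Lemma dotpDr x y z : dotp x (y + z) = dotp x y + dotp x z.
Proof. by rewrite /dotp -big_split; apply: eq_bigr => i _; rewrite mxE mulrDr. Qed.

Lemma dotpDl x y z : dotp (x + y) z = dotp x z + dotp y z.
Proof. by rewrite /dotp -big_split; apply: eq_bigr => i _; rewrite mxE mulrDl. Qed.

Lemma dotpNr x y : dotp x (- y) = - dotp x y.
Proof. by rewrite /dotp -sumrN; apply: eq_bigr => i _; rewrite mxE mulrN. Qed.

Lemma dotpNl x y : dotp (- x) y = - dotp x y.
Proof. by rewrite /dotp -sumrN; apply: eq_bigr => i _; rewrite mxE mulNr. Qed.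

Lemma dotpZl a x y : dotp (a *: x) y = a * dotp x y.
Proof. by rewrite /dotp mulr_sumr; apply: eq_bigr => i _; rewrite mxE mulrA. Qed.

Lemma dotpZr a x y : dotp x (a *: y) = a * dotp x y.
Proof. by rewrite /dotp mulr_sumr; apply: eq_bigr => i _; rewrite mxE mulrCA. Qed.

Lemma dotpC x y : dotp x y = dotp y x.
Proof. by apply: eq_bigr => i _; rewrite mulrC. Qed.

Lemma dotp_ge0 x : 0 <= dotp x x.
Proof. by apply: sumr_ge0 => i _; rewrite -expr2 sqr_ge0. Qed.

Lemma euclidean_normE x : euclidean_norm x = Num.sqrt (dotp x x).
Proof. by congr Num.sqrt; apply: eq_bigr => i _; rewrite expr2. Qed.

Lemma euclidean_norm_ge0 x : 0 <= euclidean_norm x.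
Proof. exact: sqrtr_ge0. Qed.

(** Expanding the square of [(x.x) y - (x.y) x]. *)
Lemma Cauchy_Schwarz_dotp x y : dotp x y ^+ 2 <= dotp x x * dotp y y.
Proof.
have [x0|x0] := eqVneq (dotp x x) 0.
  have xi i : x 0 i = 0.
    move/eqP: x0; rewrite /dotp psumr_eq0 => [|j _]; last by rewrite -expr2 sqr_ge0.
    by move=> /allP /(_ i); rewrite mem_index_enum => /(_ isT); rewrite mulf_eq0 orbb => /eqP.
  rewrite x0 mul0r /dotp big1 ?expr0n//= => i _.
  by rewrite xi mul0r.
have xp : 0 < dotp x x by rewrite lt_neqAle eq_sym x0 dotp_ge0.
have := dotp_ge0 (dotp x x *: y - dotp x y *: x).
rewrite dotpDl !dotpDr !dotpNl !dotpNr !dotpZl !dotpZr (dotpC y x).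
set A := dotp x x; set B := dotp x y; set C := dotp y y.
rewrite (_ : _ + _ = A * (A * C - B ^+ 2)); last by ring.
by rewrite pmulr_rge0// subr_ge0.
Qed.

Lemma euclidean_normD x y :
  euclidean_norm (x + y) <= euclidean_norm x + euclidean_norm y.
Proof.
rewrite !euclidean_normE.
rewrite -[leRHS]ger0_norm ?addr_ge0 ?sqrtr_ge0// -sqrtr_sqr ler_wsqrtr//.
rewrite sqrrD !sqr_sqrtr ?dotp_ge0// dotpDl !dotpDr (dotpC y x).
rewrite [leLHS](_ : _ = dotp x x + dotp x y *+ 2 + dotp y y); last by ring.
rewrite lerD2r lerD2l lerMn2r/= -sqrtrM ?dotp_ge0//.
by rewrite (le_trans (ler_norm _))// -sqrtr_sqr ler_wsqrtr// Cauchy_Schwarz_dotp.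
Qed.

Lemma coord_le_euclidean_norm x i : `|x 0 i| <= euclidean_norm x.
Proof.
rewrite -sqrtr_sqr ler_wsqrtr// (bigD1 i)//= lerDl.
by apply: sumr_ge0 => j _; rewrite sqr_ge0.
Qed.

Lemma measurable_euclidean_norm :
  measurable_fun setT (fun x : mrV d => euclidean_norm (x : 'rV[R]_d)).
Proof.
apply: (measurableT_comp (f := @Num.sqrt R)).
  by apply: continuous_measurable_fun; exact: sqrt_continuous.
by apply: measurable_sum => i; apply: measurable_funX; exact: measurable_coord.
Qed.

Lemma measurable_dotp : measurable_fun setT
  (fun p : mrV d * mrV d => dotp (p.1 : 'rV[R]_d) (p.2 : 'rV[R]_d)).
Proof.
apply: measurable_sum => i; apply: measurable_funM.
- exact: (measurableT_comp (measurable_coord i)).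
- exact: (measurableT_comp (measurable_coord i)).
Qed.

Lemma measurable_dotpr x :
  measurable_fun setT (fun y : mrV d => dotp x (y : 'rV[R]_d)).
Proof. exact: (measurableT_comp measurable_dotp (pair1_measurable (x : mrV d))). Qed.

Lemma measurable_dotpl x :
  measurable_fun setT (fun y : mrV d => dotp (y : 'rV[R]_d) x).
Proof. exact: (measurableT_comp measurable_dotp (pair2_measurable (x : mrV d))). Qed.

End EuclideanNorm.

Opaque cint.

Lemma clim_unique (R : realType) (u : nat -> R[i]) (A B : R[i]) :
  cnorm (u n - A) @[n --> \oo] --> 0 -> cnorm (u n - B) @[n --> \oo] --> 0 ->
  A = B.
Proof.
move=> uA uB; have L : cnorm (u n - A) + cnorm (u n - B) @[n --> \oo] --> (0 : R).
  by rewrite -[X in _ --> X]addr0; exact: cvgD uA uB.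
have Z : cnorm (A - B) @[n --> \oo] --> (0 : R).
  apply: squeeze_cvgr (cvg_cst 0) L; apply: nearW => n.
  rewrite cnorm_ge0/= (_ : A - B = - (u n - A) + (u n - B)); last by ring.
  by rewrite (le_trans (cnormD _ _))// cnormN.
apply/eqP; rewrite -subr_eq0; apply/eqP/cnorm_eq0.
exact: (cvg_unique _ (cvg_cst (cnorm (A - B))) Z).
Qed.

(** * Fourier inversion *)

Section Fourier.
Context {R : realType} {d : nat}.
Notation lebd := (@leb R d).
Notation cmeas := (@cmeasurable R _ (mrV d)).
Notation cinteg := (@cintegrable R _ (mrV d) lebd).
Implicit Types f g : 'rV[R]_d -> R[i].

(** Bounded measurable functions supported in a cube: on them the iterated
integrals are Lebesgue integrals, and the class is stable under multiplication by
bounded measurable functions such as characters. *)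
Definition bcs f := cmeas f /\
  exists M r, (forall x, cnorm (f x) <= M) /\ (forall x, f x != 0 -> cube r x).

Lemma ccontinuous_cmeasurable f : ccontinuous f -> cmeas f.
Proof. by case=> c1 c2; split; exact: continuous_measurable_rV. Qed.

Lemma ccontinuous_cnormB f x : ccontinuous f ->
  cnorm (f y - f x) @[y --> x] --> 0.
Proof.
move=> [c1 c2].
have H (h : 'rV[R]_d -> R) : continuous h -> `|h y - h x| @[y --> x] --> 0.
  move=> ch; have -> : 0 = `|h x - h x| by rewrite subrr normr0.
  have FF : ProperFilter (nbhs (x : 'rV[R]_d)) by exact: nbhs_pfilter.
  by apply: cvg_norm; exact: cvgB (ch x) (cvg_cst (h x)).
have h : `|cRe (f y) - cRe (f x)| + `|cIm (f y) - cIm (f x)| @[y --> x] --> 0.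
  by rewrite -[X in _ --> X]addr0; exact: cvgD (H _ c1) (H _ c2).
apply: squeeze_cvgr (cvg_cst 0) h; apply: nearW => y.
by rewrite cnorm_ge0/= (le_trans (cnorm_le _))// !cpart.
Qed.

Lemma compact_cube (K : set 'rV[R]_d) : compact K -> exists r, K `<=` cube r.
Proof.
move=> /compact_bounded[r [_ /(_ (r + 1))]]; rewrite ltrDl ltr01 => /(_ isT) hr.
exists (r + 1) => x /hr/= xr i; apply: le_trans xr.
by rewrite [leRHS]mx_normrE (le_trans _ (le_bigmax _ _ (ord0, i)))//=.
Qed.

Lemma Cc_bcs A f : Cc A f -> bcs f.
Proof.
move=> [cf ks _]; have [c1 c2] := cf; split; first exact: ccontinuous_cmeasurable.
have bdd (h : 'rV[R]_d -> R) : continuous h ->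
    exists M, forall x, supp f x -> `|h x| <= M.
  move=> ch; have /compact_bounded := continuous_compact (continuous_subspaceT ch) ks.
  move=> [M [_ /(_ (M + 1))]]; rewrite ltrDl ltr01 => /(_ isT) hM.
  by exists (M + 1) => x sx; apply: hM; exists x.
have [M1 hM1] := bdd _ c1; have [M2 hM2] := bdd _ c2.
have [r sr] := compact_cube ks.
have s0 x : f x != 0 -> supp f x by move=> fx; exact: subset_closure.
exists (Num.max 0 (M1 + M2)), r; split => x; last by move=> /s0 /sr.
have [->|/s0 sx] := eqVneq (f x) 0; first by rewrite cnorm0 le_max lexx.
rewrite le_max; apply/orP; right.
by rewrite (le_trans (cnorm_le _))// lerD ?hM1 ?hM2.
Qed.

Lemma fourier_integrable f xi : bcs f ->
  cinteg (fun x => f x * cis (- dotp x xi)) /\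
  fourier f xi = cint lebd (fun x => f x * cis (- dotp x xi)).
Proof.
move=> [mf [M [r [fM fr]]]].
rewrite /fourier (_ : (fun x => _) = fun x => f x * cis (- dotp x xi)); last first.
  by apply/funext => x; rewrite /cis cosN sinN.
apply: (@cintegral_rVE _ _ _ M r).
- apply: cmeasurableM => //; apply: cmeasurable_cis.
  by apply: measurable_funN; exact: measurable_dotpl.
- by move=> x; rewrite Normc.normcM cnorm_cis mulr1.
- by move=> x h; apply: fr; apply: contra_neq h => ->; rewrite mul0r.
Qed.

Lemma fourierE f : bcs f ->
  fourier f = fun xi => cint lebd (fun x : mrV d => f x * cis (- dotp (x : 'rV[R]_d) xi)).
Proof. by move=> bf; apply/funext => xi; case: (fourier_integrable xi bf). Qed.

Lemma bcs_integrable f : bcs f -> cinteg f.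
Proof. by move=> [mf [M [r [fM fr]]]]; have [] := cintegral_rVE mf fM fr. Qed.

Lemma bcsM f g : bcs f -> cmeas g -> (exists M, forall x, cnorm (g x) <= M) ->
  bcs (fun x => f x * g x).
Proof.
move=> [mf [M [r [fM fr]]]] mg [N gN]; split; first exact: cmeasurableM.
exists (M * N), r; split => x.
  by rewrite Normc.normcM ler_pM ?cnorm_ge0.
by move=> h; apply: fr; apply: contra_neq h => ->; rewrite mul0r.
Qed.

Lemma bcsB f g : bcs f -> bcs g -> bcs (fun x => f x - g x).
Proof.
move=> [mf [M [r [fM fr]]]] [mg [N [s [gN gs]]]]; split; first exact: cmeasurableB.
exists (M + N), (Num.max r s); split => x.
  by rewrite (le_trans (cnormD _ _))// cnormN lerD.
move=> h i; have [f0|/fr/(_ i) h1] := eqVneq (f x) 0; last by rewrite le_max h1.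
have [g0|/gs/(_ i) h1] := eqVneq (g x) 0; last by rewrite le_max h1 orbT.
by rewrite f0 g0 subrr eqxx in h.
Qed.

Lemma cmeasurable_cint1 dd1 dd2 (T1 : measurableType dd1) (T2 : measurableType dd2)
   (m2 : {sigma_finite_measure set T2 -> \bar R}) (F : T1 * T2 -> R[i]) :
  cmeasurable F -> cmeasurable (fun x => cint m2 (fun y => F (x, y))).
Proof.
have H (h : T1 * T2 -> R) : measurable_fun setT h ->
    measurable_fun setT (fun x => fine (\int[m2]_y (h (x, y))%:E)%E).
  move=> mh; apply: (measurableT_comp (@fine_measurable R setT measurableT)).
  have mh' : measurable_fun setT (EFin \o h) by exact/measurable_EFinP.
  under eq_fun do rewrite integralE.
  apply: emeasurable_funB.
  - have := measurable_fun_fubini_tonelli_F (m2 := m2) _ (measurable_funepos mh') (funepos_ge0 _).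
    apply: eq_measurable_fun => x _; apply: eq_integral => y _.
    by rewrite !funeposE.
  - have := measurable_fun_fubini_tonelli_F (m2 := m2) _ (measurable_funeneg mh') (funeneg_ge0 _).
    apply: eq_measurable_fun => x _; apply: eq_integral => y _.
    by rewrite !funenegE.
by move=> [m m']; split; [exact: (H _ m)|exact: (H _ m')].
Qed.

Lemma fourier_cmeasurable f : bcs f -> cmeas (fourier f).
Proof.
move=> bf; rewrite fourierE//; apply: (cmeasurable_cint1 lebd
  (F := fun p : mrV d * mrV d => f p.2 * cis (- dotp (p.2 : 'rV[R]_d) (p.1 : 'rV[R]_d)))).
have [[m1 m2] _] := bf.
apply: cmeasurableM.
  by split; [exact: (measurableT_comp m1 measurable_snd)|
             exact: (measurableT_comp m2 measurable_snd)].
apply: cmeasurable_cis; apply: measurable_funN.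
by under eq_fun do rewrite dotpC; exact: measurable_dotp.
Qed.

Lemma fourierB f g xi : bcs f -> bcs g ->
  fourier (fun x => f x - g x) xi = fourier f xi - fourier g xi.
Proof.
move=> bf bg; have [fi ->] := fourier_integrable xi bf.
have [gi ->] := fourier_integrable xi bg.
have [_ ->] := fourier_integrable xi (bcsB bf bg).
rewrite -cintB//; congr cint; apply/funext => x; by rewrite mulrBl.
Qed.

Lemma fourier_modulation f xi eta : bcs f ->
  fourier (fun x => f x * cis (- dotp x xi)) eta = fourier f (eta + xi).
Proof.
move=> bf; rewrite /fourier; congr cintegral_rV; apply/funext => x.
rewrite -mulrA; congr (_ * _).
have E t : Complex (cos t) (- sin t) = cis (- t) by rewrite /cis cosN sinN.
by rewrite !E -cisD dotpDr opprD addrC.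
Qed.

Lemma laplaceE a (xi : 'rV[R]_d) : laplace a xi = expR (- (a * \sum_i `|xi 0 i|)).
Proof.
rewrite /laplace /lapl mulr_sumr -sumrN; apply/esym.
by apply: (big_morph (@expR R)); [exact: expRD|exact: expR0].
Qed.

Lemma cmeas_cis_dotpr (x : 'rV[R]_d) : cmeas (fun xi => cis (dotp x xi)).
Proof. by apply: cmeasurable_cis; exact: measurable_dotpr. Qed.

Lemma cnorm_mulB1 (u : R[i]) (t : R) :
  cnorm (u * (t%:C)%C - u) = cnorm u * `|t - 1|.
Proof.
rewrite -{2}(mulr1 u) -mulrBr Normc.normcM; congr (_ * _).
by rewrite -cnorm_real; congr (cnorm _); apply: cplx_ext; rewrite ?cpart/= ?subr0.
Qed.

Lemma cnorm_mulBl (u v : R[i]) (t : R) :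
  cnorm (u * (t%:C)%C - v * (t%:C)%C) = cnorm (u - v) * `|t|.
Proof. by rewrite -mulrBl Normc.normcM cnorm_real. Qed.

Lemma laplace_le1 a (xi : 'rV[R]_d) : 0 <= a -> 0 <= laplace a xi <= 1.
Proof.
move=> a0; rewrite laplaceE expR_ge0/= -[leRHS]expR0 ler_expR oppr_le0.
by apply: mulr_ge0 => //; exact: sumr_ge0.
Qed.

Lemma cnorm_cis_real t (u : R) : 0 <= u -> cnorm (cis t * (u%:C)%C) = u.
Proof. by move=> u0; rewrite Normc.normcM cnorm_cis mul1r cnorm_real ger0_norm. Qed.

Lemma cmeasurable_laplace a : cmeas (fun xi => ((laplace a xi)%:C)%C).
Proof.
by apply: cmeasurable_real; apply: measurable_prod_coord; exact: measurable_lapl.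
Qed.

Lemma cmeasurable_poisson : cmeas (fun xi => ((poisson xi)%:C)%C).
Proof.
apply: cmeasurable_real.
exact: (measurable_prod_coord (@measurable_poisson R)).
Qed.

Lemma cintegrable_cis_laplace a (z : 'rV[R]_d) : 0 < a ->
  cinteg (fun xi => cis (dotp z xi) * ((laplace a xi)%:C)%C).
Proof.
move=> a0; apply: cintegrable_le (integrable_laplace d a0).
  by apply: cmeasurableM; [exact: cmeas_cis_dotpr|exact: cmeasurable_laplace].
move=> xi; rewrite cnorm_cis_real ?lexx//.
by case/andP: (laplace_le1 xi (ltW a0)).
Qed.

Let a_ (n : nat) : R := n.+1%:R^-1.

Let a_gt0 n : 0 < a_ n. Proof. by rewrite invr_gt0. Qed.

Let a_0 : a_ n @[n --> \oo] --> 0. Proof. exact: cvg_harmonic. Qed.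

Let laplace_cvg (xi : 'rV[R]_d) : laplace (a_ n) xi @[n --> \oo] --> (1 : R).
Proof.
rewrite (_ : (fun n => _) = fun n => expR (- (a_ n * \sum_i `|xi 0 i|))); last first.
  by apply/funext => n; exact: laplaceE.
rewrite -[X in _ --> X]expR0 -[X in expR X]oppr0 -[X in expR (- X)](mul0r (\sum_i `|xi 0 i|)).
apply: continuous_cvg; first exact: continuous_expR.
exact: cvgN (cvgM a_0 (cvg_cst _)).
Qed.

(* The transform of [laplace a]; [kern_scale] says that it is [poisson] dilated
   by [a] and normalized, which makes it an approximate identity up to the factor
   [(2 pi) ^ d]. *)
Let kern a (z : 'rV[R]_d) : R := \prod_i (2 * a / (a ^+ 2 + z 0 i ^+ 2)).

Let kern_scale a x (z : 'rV[R]_d) : 0 < a ->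
  a ^+ d * kern a (x - (x + a *: z)) = poisson z.
Proof.
move=> a0; rewrite /kern /poisson -[in a ^+ d](card_ord d) -prodr_const -big_split/=.
apply: eq_bigr => i _; rewrite !mxE.
have -> : a ^+ 2 + (x 0 i - (x 0 i + a * z 0 i)) ^+ 2 = a ^+ 2 * (1 + z 0 i ^+ 2).
  by ring.
by field; rewrite (gt_eqF a0)/= gt_eqF// ltr_wpDr// sqr_ge0.
Qed.

Let kern_bound a (z : 'rV[R]_d) : 0 < a -> 0 <= kern a z <= (2 / a) ^+ d.
Proof.
move=> a0; have p i : 0 < a ^+ 2 + z 0 i ^+ 2.
  by rewrite ltr_wpDr ?sqr_ge0// exprn_gt0.
have q i : 0 <= 2 * a / (a ^+ 2 + z 0 i ^+ 2).
  by rewrite divr_ge0 ?mulr_ge0// ltW.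
apply/andP; split; first exact: prodr_ge0.
rewrite -[in leRHS](card_ord d) -prodr_const; apply: ler_prod => i _.
rewrite q/= ler_pdivrMr// mulrAC ler_pdivlMr// -mulrA ler_pM2l//.
by rewrite -expr2 lerDl sqr_ge0.
Qed.

Let kern_measurable a x : 0 < a ->
  cmeas (fun y : mrV d => ((kern a (x - (y : 'rV[R]_d)))%:C)%C).
Proof.
move=> a0; apply: cmeasurable_real.
have mh : measurable_fun setT (fun t : R => 2 * a / (a ^+ 2 + t ^+ 2)).
  apply: measurable_funM => //; apply: continuous_measurable_fun => t.
  apply: cvgV; first by rewrite gt_eqF// ltr_wpDr ?sqr_ge0// exprn_gt0.
  apply: cvgD; first exact: cvg_cst.
  by rewrite expr2; apply: cvgM; exact: cvg_id.
have := measurableT_comp (measurable_prod_coord mh) (measurable_affine_rV (-1) x).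
by apply: eq_measurable_fun => y _ /=; rewrite scaleN1r.
Qed.

Let kern_integrable f a x : 0 < a -> bcs f ->
  cinteg (fun y : mrV d => f y * ((kern a (x - (y : 'rV[R]_d)))%:C)%C).
Proof.
move=> a0 bf.
have B : exists M, forall y : 'rV[R]_d, cnorm (((kern a (x - y))%:C)%C) <= M.
  exists ((2 / a) ^+ d) => y; have /andP[k0 k1] := kern_bound (x - y) a0.
  by rewrite cnorm_real (ger0_norm k0).
exact: (bcs_integrable (bcsM bf (kern_measurable x a0) B)).
Qed.

(** Writing out the transform of [f] and exchanging the integrals turns damping
by [laplace a] into convolution with the Poisson kernel of width [a]. *)
Lemma fourier_summation f a x : 0 < a -> bcs f ->
  cint lebd (fun xi : mrV d => fourier f xi * cis (dotp x xi) * ((laplace a xi)%:C)%C) =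
  cint lebd (fun z : mrV d => f (x + a *: (z : 'rV[R]_d)) * ((poisson z)%:C)%C).
Proof.
move=> a0 bf; have [mf [M [r [fM fr]]]] := bf.
have mlap : measurable_fun setT (fun xi : mrV d => laplace a (xi : 'rV[R]_d)).
  by apply: measurable_prod_coord; exact: measurable_lapl.
pose H (p : mrV d * mrV d) : R[i] := f p.1 * cis (- dotp (p.1 : 'rV[R]_d) p.2) *
  (cis (dotp x p.2) * ((laplace a (p.2 : 'rV[R]_d))%:C)%C).
have mH : cmeasurable H.
  apply: cmeasurableM; apply: cmeasurableM.
  - by case: mf => m1 m2; split; [exact: (measurableT_comp m1 measurable_fst)|
      exact: (measurableT_comp m2 measurable_fst)].
  - by apply: cmeasurable_cis; apply: measurable_funN; exact: measurable_dotp.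
  - by apply: cmeasurable_cis; exact: (measurableT_comp (measurable_dotpr x) measurable_snd).
  - by apply: cmeasurable_real; exact: (measurableT_comp mlap measurable_snd).
have nH y xi : cnorm (H (y, xi)) = cnorm (f y) * laplace a xi.
  rewrite /H !Normc.normcM !cnorm_cis mulr1 mul1r cnorm_real ger0_norm//.
  by case/andP: (laplace_le1 xi (ltW a0)).
have li := integrable_laplace d a0.
have fi := cintegrable_norm (bcs_integrable bf).
have Hfin : (\int[lebd]_y \int[lebd]_xi (cnorm (H (y, xi)))%:E < +oo)%E.
  have [c cE] : exists c, (\int[lebd]_xi (laplace a xi)%:E = c%:E)%E.
    by exists (fine (\int[lebd]_xi (laplace a xi)%:E)); rewrite fineK// integrable_fin_num.
  have [e eE] : exists e, (\int[lebd]_y (cnorm (f y))%:E = e%:E)%E.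
    by exists (fine (\int[lebd]_y (cnorm (f y))%:E)); rewrite fineK// integrable_fin_num.
  rewrite (_ : (\int[_]_y _)%E = (\int[lebd]_y ((cnorm (f y))%:E * c%:E))%E).
    by rewrite integralZr// eE -EFinM ltry.
  apply: eq_integral => y _; rewrite -cE -integralZl//.
  by apply: eq_integral => xi _; rewrite nH EFinM.
have i2 y : cintegrable lebd (fun xi => H (y, xi)).
  apply: cintegrable_le (integrableZl measurableT (cnorm (f y)) li).
  - case: mH => m1 m2; split; [exact: (measurableT_comp m1 (pair1_measurable y))|
      exact: (measurableT_comp m2 (pair1_measurable y))].
  - by move=> xi; rewrite nH.
have i1 xi : cintegrable lebd (fun y => H (y, xi)).
  apply: cintegrable_le fi.
  - case: mH => m1 m2; split; [exact: (measurableT_comp m1 (pair2_measurable xi))|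
      exact: (measurableT_comp m2 (pair2_measurable xi))].
  - move=> y; rewrite nH ler_piMr ?cnorm_ge0//.
    by case/andP: (laplace_le1 xi (ltW a0)).
have [_ HF] := cFubini mH Hfin i2 i1.
transitivity (cint lebd (fun xi => cint lebd (fun y => H (y, xi)))).
  congr cint; apply/funext => xi; have [fi' ->] := fourier_integrable xi bf.
  exact: etrans (esym (mulrA _ _ _)) (esym (cintZr _ fi')).
rewrite -HF.
transitivity (cint lebd (fun y : mrV d => f y * ((kern a (x - (y : 'rV[R]_d)))%:C)%C)).
  congr cint; apply/funext => y.
  have ci := cintegrable_cis_laplace (x - (y : 'rV[R]_d)) a0.
  rewrite -(laplace_kernel (x - (y : 'rV[R]_d)) a0) -(cintZ (f y) ci).
  congr cint; apply/funext => xi; rewrite /H dotpDl dotpNl cisD.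
  by move: (f y) (cis _) (cis _) (_%:C)%C => u v w t; ring.
have ki := kern_integrable x a0 bf.
have [ki' ->] := cintegrable_affine x a0 ki.
rewrite -(cintZ _ ki'); congr cint; apply/funext => z.
rewrite -(kern_scale x z a0) rmorphM /=.
by move: (f _) (_%:C)%C (_%:C)%C => u v w; ring.
Qed.

(** Let [a] tend to 0 in [fourier_summation]: both sides converge by dominated
convergence, on the right because [f] is continuous and bounded and [poisson] has
mass [(2 pi) ^ d]. *)
Theorem fourier_inversion f x : bcs f -> ccontinuous f ->
  (\int[lebd]_xi (cnorm (fourier f xi))%:E < +oo)%E ->
  cint lebd (fun xi : mrV d => fourier f xi * cis (dotp x xi)) =
  (((2 * pi) ^+ d)%:C)%C * f x.
Proof.
move=> bf cf hfin; have [mf [M [r [fM fr]]]] := bf.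
have mh := fourier_cmeasurable bf.
have hi : cinteg (fourier f) by apply/cintegrableP.
have mhc : cmeas (fun xi => fourier f xi * cis (dotp x xi)).
  by apply: cmeasurableM => //; exact: cmeas_cis_dotpr.
have mlap := cmeasurable_laplace.
have lim1 : cnorm (cint lebd (fun xi : mrV d => fourier f xi * cis (dotp x xi) *
     ((laplace (a_ n) xi)%:C)%C) -
   cint lebd (fun xi : mrV d => fourier f xi * cis (dotp x xi))) @[n --> \oo] --> 0.
  apply: (@cint_dominated _ _ _ lebd (fun n xi => fourier f xi * cis (dotp x xi) *
     ((laplace (a_ n) xi)%:C)%C) _ (fun xi => cnorm (fourier f xi))) => //.
  - by move=> n; exact: cmeasurableM.
  - move=> n xi; rewrite !Normc.normcM cnorm_cis mulr1 cnorm_real.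
    have /andP[l0 l1] := laplace_le1 xi (ltW (a_gt0 n)).
    by rewrite ger0_norm// ler_piMr ?cnorm_ge0.
  - by move=> xi; rewrite Normc.normcM cnorm_cis mulr1.
  - exact: cintegrable_norm.
  - move=> xi.
    rewrite (_ : (fun n => _) = fun n =>
        cnorm (fourier f xi * cis (dotp x xi)) * `|laplace (a_ n) xi - 1|); last first.
      by apply/funext => n; exact: cnorm_mulB1.
    rewrite -[X in _ --> X](mulr0 (cnorm (fourier f xi * cis (dotp x xi)))).
    apply: cvgM; first exact: cvg_cst.
    have -> : 0 = `|1 - 1| :> R by rewrite subrr normr0.
    by apply: cvg_norm; exact: cvgB (laplace_cvg xi) (cvg_cst _).
have lim2 : cnorm (cint lebd (fun z : mrV d => f (x + a_ n *: (z : 'rV[R]_d)) *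
     ((poisson z)%:C)%C) -
   cint lebd (fun z : mrV d => f x * ((poisson z)%:C)%C)) @[n --> \oo] --> 0.
  have mp := cmeasurable_poisson.
  apply: (@cint_dominated _ _ _ lebd (fun n z => f (x + a_ n *: (z : 'rV[R]_d)) *
     ((poisson z)%:C)%C) _ (fun z => M * poisson z)) => //.
  - move=> n; apply: cmeasurableM => //; case: mf => m1 m2.
    by split; [exact: (measurableT_comp m1 (measurable_affine_rV _ _))|
      exact: (measurableT_comp m2 (measurable_affine_rV _ _))].
  - by apply: cmeasurableM => //; exact: cmeasurable_cst.
  - move=> n z; rewrite Normc.normcM cnorm_real ger0_norm ?poisson_ge0//.
    by rewrite ler_wpM2r ?poisson_ge0.
  - move=> z; rewrite Normc.normcM cnorm_real ger0_norm ?poisson_ge0//.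
    by rewrite ler_wpM2r ?poisson_ge0.
  - under [EFin \o _]eq_fun do rewrite /= EFinM.
    by apply: integrableZl => //; exact: integrable_poisson.
  - move=> z.
    rewrite (_ : (fun n => _) = fun n =>
        cnorm (f (x + a_ n *: z) - f x) * `|poisson z|); last first.
      by apply/funext => n; exact: cnorm_mulBl.
    rewrite -[X in _ --> X](mul0r `|poisson z|); apply: cvgM; last exact: cvg_cst.
    have xz : x + a_ n *: (z : 'rV[R]_d) @[n --> \oo] --> x.
      rewrite -[X in _ --> X]addr0 -[X in _ + X](scale0r z).
      by apply: cvgD; [exact: cvg_cst|apply: cvgZr_tmp; exact: a_0].
    exact: (cvg_comp _ _ xz (ccontinuous_cnormB x cf)).
have E2 : cint lebd (fun z : mrV d => f x * ((poisson z)%:C)%C) =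
    (((2 * pi) ^+ d)%:C)%C * f x.
  have [ci <-] := @cint_poisson R d.
  by rewrite (cintZ _ ci) mulrC.
rewrite -E2; apply: (clim_unique lim1).
under eq_fun do rewrite (fourier_summation x (a_gt0 _) bf).
exact: lim2.
Qed.

End Fourier.

(** * Fourier transform of a product *)

Section Convolution.
Context {R : realType} {d : nat}.
Notation lebd := (@leb R d).
Notation cmeas := (@cmeasurable R _ (mrV d)).
Notation cinteg := (@cintegrable R _ (mrV d) lebd).
Implicit Types f g : 'rV[R]_d -> R[i].

Lemma fourier_sup f : (\int[lebd]_xi (cnorm (fourier f xi))%:E < +oo)%E ->
  bcs f -> ccontinuous f -> forall x,
  (((2 * pi) ^+ d * cnorm (f x))%:E <= \int[lebd]_xi (cnorm (fourier f xi))%:E)%E.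
Proof.
move=> hfin bf cf x.
have mh := fourier_cmeasurable bf.
have hi : cinteg (fourier f) by apply/cintegrableP.
have hci : cinteg (fun xi => fourier f xi * cis (dotp x xi)).
  apply: cintegrable_le (cintegrable_norm hi).
    by apply: cmeasurableM => //; exact: cmeas_cis_dotpr.
  by move=> xi; rewrite Normc.normcM cnorm_cis mulr1.
have := cnorm_cint hci; rewrite fourier_inversion// Normc.normcM cnorm_real.
rewrite ger0_norm; last by rewrite exprn_ge0// mulr_ge0// pi_ge0.
move/le_trans; apply; apply: ge0_le_integral => //.
- by move=> xi _; rewrite lee_fin cnorm_ge0.
- apply/measurable_EFinP; apply: cmeasurable_norm.
  by apply: cmeasurableM => //; exact: cmeas_cis_dotpr.
- by apply/measurable_EFinP; exact: cmeasurable_norm.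
- by move=> xi _; rewrite lee_fin Normc.normcM cnorm_cis mulr1.
Qed.

Lemma bcsMM f g : bcs f -> bcs g -> bcs (fun x => f x * g x).
Proof.
move=> bf [mg [M [r [gM _]]]].
exact: (bcsM bf mg (ex_intro _ M gM)).
Qed.

Lemma measurable_sub_rV :
  measurable_fun setT (fun p : mrV d * mrV d => (p.1 : 'rV[R]_d) - (p.2 : 'rV[R]_d) : mrV d).
Proof.
apply: measurable_fun_rV => i; under eq_fun do rewrite !mxE.
by apply: measurable_funB; [exact: (measurableT_comp (measurable_coord i) measurable_fst)|
    exact: (measurableT_comp (measurable_coord i) measurable_snd)].
Qed.

(** Inserting the inversion formula for [f] in the transform of [f g] and
exchanging the integrals. *)
Lemma fourierM f g xi : bcs f -> ccontinuous f -> bcs g ->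
  (\int[lebd]_eta (cnorm (fourier f eta))%:E < +oo)%E ->
  cinteg (fun eta => fourier f eta * fourier g (xi - eta)) /\
  (((2 * pi) ^+ d)%:C)%C * fourier (fun x => f x * g x) xi =
  cint lebd (fun eta : mrV d => fourier f eta * fourier g (xi - (eta : 'rV[R]_d))).
Proof.
move=> bf cf bg hfin.
have mh := fourier_cmeasurable bf.
have hi : cinteg (fourier f) by apply/cintegrableP.
have gi := bcs_integrable bg.
have mg : cmeas g by case: bg.
pose H (p : mrV d * mrV d) : R[i] := fourier f p.1 * (g p.2 *
   cis (- dotp (p.2 : 'rV[R]_d) (xi - (p.1 : 'rV[R]_d)))).
have mH : cmeasurable H.
  apply: cmeasurableM; last apply: cmeasurableM.
  - by case: mh => m1 m2; split; [exact: (measurableT_comp m1 measurable_fst)|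
      exact: (measurableT_comp m2 measurable_fst)].
  - by case: mg => m1 m2; split; [exact: (measurableT_comp m1 measurable_snd)|
      exact: (measurableT_comp m2 measurable_snd)].
  - apply: cmeasurable_cis; apply: measurable_funN.
    under eq_fun do rewrite dotpDr dotpNr.
    apply: measurable_funB.
      exact: (measurableT_comp (measurable_dotpl xi) measurable_snd).
    by under eq_fun do rewrite dotpC; exact: measurable_dotp.
have nH eta x : cnorm (H (eta, x)) = cnorm (fourier f eta) * cnorm (g x).
  by rewrite /H !Normc.normcM cnorm_cis mulr1.
have ni := cintegrable_norm hi.
have ng := cintegrable_norm gi.
have Hfin : (\int[lebd]_eta \int[lebd]_x (cnorm (H (eta, x)))%:E < +oo)%E.
  have [c cE] : exists c, (\int[lebd]_x (cnorm (g x))%:E = c%:E)%E.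
    by exists (fine (\int[lebd]_x (cnorm (g x))%:E)); rewrite fineK// integrable_fin_num.
  have [e eE] : exists e, (\int[lebd]_y (cnorm (fourier f y))%:E = e%:E)%E.
    by exists (fine (\int[lebd]_y (cnorm (fourier f y))%:E)); rewrite fineK// integrable_fin_num.
  rewrite (_ : (\int[_]_y _)%E = (\int[lebd]_y ((cnorm (fourier f y))%:E * c%:E))%E).
    by rewrite integralZr// eE -EFinM ltry.
  apply: eq_integral => y _; rewrite -cE -integralZl//.
  by apply: eq_integral => x _; rewrite nH EFinM.
have sl1 x : cmeas (fun eta => H (eta, x)).
  by case: mH => m1 m2; split; [exact: (measurableT_comp m1 (pair2_measurable x))|
      exact: (measurableT_comp m2 (pair2_measurable x))].
have sl2 eta : cmeas (fun x => H (eta, x)).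
  by case: mH => m1 m2; split; [exact: (measurableT_comp m1 (pair1_measurable eta))|
      exact: (measurableT_comp m2 (pair1_measurable eta))].
have i2 eta : cintegrable lebd (fun x => H (eta, x)).
  apply: cintegrable_le (integrableZl measurableT (cnorm (fourier f eta)) ng).
    exact: sl2.
  by move=> x; rewrite nH lexx.
have i1 x : cintegrable lebd (fun eta => H (eta, x)).
  apply: cintegrable_le (integrableZr measurableT (cnorm (g x)) ni).
    exact: sl1.
  by move=> y; rewrite nH lexx.
have [HI HF] := cFubini mH Hfin i2 i1.
have HE eta : cint lebd (fun x => H (eta, x)) =
    fourier f eta * fourier g (xi - (eta : 'rV[R]_d)).
  have [fi' ->] := fourier_integrable (xi - (eta : 'rV[R]_d)) bg.
  exact: (cintZ (fourier f eta) fi').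
have fE : (fun eta => cint lebd (fun x => H (eta, x))) =
   fun eta => fourier f eta * fourier g (xi - (eta : 'rV[R]_d)).
  by apply/funext => eta; exact: HE.
rewrite -fE; split; first exact: HI.
rewrite HF.
have bfg := bcsMM bf bg.
have [fgi ->] := fourier_integrable xi bfg.
rewrite -(cintZ _ fgi); congr cint; apply/funext => x.
transitivity (cint lebd (fun eta : mrV d => (fourier f eta * cis (dotp (x : 'rV[R]_d) eta))
   * (g x * cis (- dotp (x : 'rV[R]_d) xi)))).
  have hci : cinteg (fun eta => fourier f eta * cis (dotp (x : 'rV[R]_d) eta)).
    apply: (cintegrable_le (cmeasurableM mh (cmeas_cis_dotpr _)) _ ni) => eta.
    by rewrite Normc.normcM cnorm_cis mulr1 lexx.
  rewrite (cintZr _ hci) (fourier_inversion x bf cf hfin).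
  by move: (f x) (g x) (cis _) (_%:C)%C => u v w t; ring.
congr cint; apply/funext => eta; rewrite /H dotpDr dotpNr opprD opprK cisD.
by move: (fourier f eta) (g x) (cis _) (cis _) => u v w t; ring.
Qed.

End Convolution.

(** * Weighted norms of Fourier transforms *)

Section WeightedNorm.
Context {R : realType} {d : nat}.
Notation lebd := (@leb R d).
Notation cmeas := (@cmeasurable R _ (mrV d)).
Notation cinteg := (@cintegrable R _ (mrV d) lebd).
Implicit Types f g : 'rV[R]_d -> R[i].
Implicit Types s : R -> R.

(** The part of [weight] that makes [expR (l * s |xi|)] submultiplicative. *)
Definition subadditive_weight s :=
  [/\ forall t, 0 <= t -> 0 <= s t,
      forall t u, 0 <= t -> t <= u -> s t <= s u &
      forall t u, 0 <= t -> 0 <= u -> s (t + u) <= s t + s u].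

Lemma measurable_weight_norm s : subadditive_weight s ->
  measurable_fun setT (fun xi : mrV d => s (euclidean_norm (xi : 'rV[R]_d))).
Proof.
move=> [_ snd _].
have -> : (fun xi : mrV d => s (euclidean_norm (xi : 'rV[R]_d))) =
   (fun t => s (Num.max t 0)) \o (fun xi : mrV d => euclidean_norm (xi : 'rV[R]_d)).
  by apply/funext => xi /=; rewrite max_l// euclidean_norm_ge0.
have ms : measurable_fun setT (fun t : R => s (Num.max t 0)).
  apply: nondecreasing_measurable => // x y xy.
  apply: snd; first by rewrite le_max lexx orbT.
  by rewrite ge_max !le_max xy lexx orbT.
exact: (measurableT_comp ms measurable_euclidean_norm).
Qed.

Lemma measurable_weighted s l f : subadditive_weight s -> bcs f ->
  measurable_fun setT (fun xi : mrV d =>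
    cnorm (fourier f xi) * expR (l * s (euclidean_norm (xi : 'rV[R]_d)))).
Proof.
move=> ws bf; apply: measurable_funM.
  by apply: cmeasurable_norm; exact: fourier_cmeasurable.
apply: measurableT_comp => //; apply: measurable_funM => //.
exact: measurable_weight_norm.
Qed.

Lemma wnormE s l f : subadditive_weight s -> bcs f ->
  wnorm s l f = (\int[lebd]_xi
   (cnorm (fourier f xi) * expR (l * s (euclidean_norm (xi : 'rV[R]_d))))%:E)%E.
Proof.
move=> ws bf; apply: integral_rVE.
- by apply/measurable_EFinP; exact: measurable_weighted.
- by move=> xi; rewrite lee_fin mulr_ge0 ?cnorm_ge0 ?expR_ge0.
Qed.

Lemma wnorm_ge0 s l f : subadditive_weight s -> bcs f -> (0 <= wnorm s l f)%E.
Proof.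
move=> ws bf; rewrite wnormE//; apply: integral_ge0 => xi _.
by rewrite lee_fin mulr_ge0 ?cnorm_ge0 ?expR_ge0.
Qed.

Lemma wnorm_ge_fourier s l f : subadditive_weight s -> bcs f -> 0 <= l ->
  (\int[lebd]_xi (cnorm (fourier f xi))%:E <= wnorm s l f)%E.
Proof.
move=> ws bf l0; rewrite wnormE//; apply: ge0_le_integral => //.
- by move=> x _; rewrite lee_fin cnorm_ge0.
- by apply/measurable_EFinP; apply: cmeasurable_norm; exact: fourier_cmeasurable.
- by apply/measurable_EFinP; exact: measurable_weighted.
- move=> xi _; rewrite lee_fin ler_peMr ?cnorm_ge0// -expR0 ler_expR.
  by case: ws => s0 _ _; rewrite mulr_ge0// s0// euclidean_norm_ge0.
Qed.

(** The transform of a product is a convolution and the exponential of a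
subadditive function is submultiplicative, so this is Young's inequality for
integrable functions against the weight [expR (l * s |xi|)]. *)
Lemma wnormM s l f g : subadditive_weight s -> 0 <= l ->
  bcs f -> ccontinuous f -> bcs g ->
  (wnorm s l f < +oo)%E -> (wnorm s l g < +oo)%E ->
  (wnorm s l (fun x => (f x * g x)%R) < +oo)%E.
Proof.
move=> ws l0 bf cf bg ffin gfin; have [s0 snd sadd] := ws.
have hfin := le_lt_trans (wnorm_ge_fourier ws bf l0) ffin.
have bfg := bcsMM bf bg.
pose c : R := (2 * pi) ^+ d.
have c0 : 0 < c by rewrite exprn_gt0// mulr_gt0// pi_gt0.
pose F xi := cnorm (fourier f xi) * expR (l * s (euclidean_norm xi)).
pose G xi := cnorm (fourier g xi) * expR (l * s (euclidean_norm xi)).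
have F0 xi : 0 <= F xi by rewrite mulr_ge0 ?cnorm_ge0 ?expR_ge0.
have G0 xi : 0 <= G xi by rewrite mulr_ge0 ?cnorm_ge0 ?expR_ge0.
have mF : measurable_fun setT (F : mrV d -> R) by exact: measurable_weighted.
have mG : measurable_fun setT (G : mrV d -> R) by exact: measurable_weighted.
have mGs : measurable_fun setT (fun p : mrV d * mrV d =>
    G ((p.1 : 'rV[R]_d) - (p.2 : 'rV[R]_d))).
  exact: (measurableT_comp mG measurable_sub_rV).
have mFG : measurable_fun setT (fun p : mrV d * mrV d =>
    F p.2 * G ((p.1 : 'rV[R]_d) - (p.2 : 'rV[R]_d))).
  by apply: measurable_funM => //; exact: (measurableT_comp mF measurable_snd).
have FG0 (p : mrV d * mrV d) : 0 <= F p.2 * G ((p.1 : 'rV[R]_d) - (p.2 : 'rV[R]_d)).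
  exact: mulr_ge0.
apply: (@le_lt_trans _ _ (c^-1%:E * (wnorm s l f * wnorm s l g))%E); last first.
  rewrite lte_mul_pinfty ?lee_fin ?invr_ge0 ?(ltW c0)//.
  by rewrite lte_mul_pinfty ?ge0_fin_numE ?wnorm_ge0.
rewrite [leLHS]wnormE//.
apply: (@le_trans _ _ (\int[lebd]_xi (c^-1%:E * \int[lebd]_eta
   (F eta * G ((xi : 'rV[R]_d) - (eta : 'rV[R]_d)))%:E))%E).
  apply: ge0_le_integral => //.
  - by move=> xi _; rewrite lee_fin mulr_ge0 ?cnorm_ge0 ?expR_ge0.
  - by apply/measurable_EFinP; exact: measurable_weighted.
  - apply: measurable_funeM.
    apply: (measurable_fun_fubini_tonelli_F (m2 := lebd) (fun p : mrV d * mrV d =>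
      (F p.2 * G ((p.1 : 'rV[R]_d) - (p.2 : 'rV[R]_d)))%:E)) => [|p].
      exact/measurable_EFinP.
    by rewrite lee_fin.
  move=> xi _.
  have [ci cE] := fourierM xi bf cf bg hfin.
  have cnE : cnorm (fourier (fun x => f x * g x) xi) = c^-1 * cnorm (cint lebd
      (fun eta : mrV d => fourier f eta * fourier g (xi - (eta : 'rV[R]_d)))).
    rewrite -cE Normc.normcM cnorm_real ger0_norm ?exprn_ge0 ?mulr_ge0 ?pi_ge0//.
    by rewrite -/c mulKf// gt_eqF.
  rewrite cnE -mulrA EFinM lee_pmul2l ?lte_fin ?invr_gt0//.
  rewrite EFinM muleC.
  apply: (@le_trans _ _ ((expR (l * s (euclidean_norm xi)))%:E * \int[lebd]_eta
     (cnorm (fourier f eta * fourier g (xi - (eta : 'rV[R]_d))))%:E)%E).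
    by rewrite lee_pmul2l ?lte_fin ?expR_gt0//; exact: cnorm_cint.
  rewrite -ge0_integralZl ?lee_fin ?expR_ge0//; last 2 first.
  - apply/measurable_EFinP; apply: cmeasurable_norm.
    by case/cintegrableP : ci.
  - by move=> eta _; rewrite lee_fin cnorm_ge0.
  apply: ge0_le_integral => //.
  - by move=> eta _; rewrite -EFinM lee_fin mulr_ge0 ?cnorm_ge0 ?expR_ge0.
  - apply: measurable_funeM; apply/measurable_EFinP; apply: cmeasurable_norm.
    by case/cintegrableP : ci.
  - apply/measurable_EFinP.
    exact: (measurableT_comp mFG (pair1_measurable (xi : mrV d))).
  - move=> eta _; rewrite -EFinM lee_fin Normc.normcM /F /G.
    rewrite [leRHS](_ : _ = expR (l * s (euclidean_norm eta)) *
      expR (l * s (euclidean_norm (xi - (eta : 'rV[R]_d)))) *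
      (cnorm (fourier f eta) * cnorm (fourier g (xi - (eta : 'rV[R]_d))))); last by ring.
    rewrite ler_wpM2r ?mulr_ge0 ?cnorm_ge0// -expRD ler_expR -mulrDr ler_wpM2l//.
    have := euclidean_normD (eta : 'rV[R]_d) (xi - (eta : 'rV[R]_d)).
    rewrite addrC subrK => /(snd _ _ (euclidean_norm_ge0 _)) /le_trans; apply.
    by apply: sadd; exact: euclidean_norm_ge0.
rewrite ge0_integralZl ?lee_fin ?invr_ge0 ?(ltW c0)//; last 2 first.
- apply: (measurable_fun_fubini_tonelli_F (m2 := lebd) (fun p : mrV d * mrV d =>
      (F p.2 * G ((p.1 : 'rV[R]_d) - (p.2 : 'rV[R]_d)))%:E)) => [|p].
    exact/measurable_EFinP.
  by rewrite lee_fin.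
- by move=> xi _; apply: integral_ge0 => eta _; rewrite lee_fin mulr_ge0.
rewrite lee_pmul2l ?lte_fin ?invr_gt0//.
rewrite (@fubini_tonelli _ _ _ _ _ lebd lebd (fun p : mrV d * mrV d =>
      (F p.2 * G ((p.1 : 'rV[R]_d) - (p.2 : 'rV[R]_d)))%:E)); last 2 first.
- exact/measurable_EFinP.
- by move=> p; rewrite lee_fin.
have -> : wnorm s l f = (\int[lebd]_xi (F xi)%:E)%E by exact: wnormE.
have -> : wnorm s l g = (\int[lebd]_xi (G xi)%:E)%E by exact: wnormE.
rewrite -ge0_integralZr//; last 3 first.
- exact/measurable_EFinP.
- by move=> xi _; rewrite lee_fin.
- by apply: integral_ge0 => xi _; rewrite lee_fin.
rewrite le_eqVlt; apply/orP; left; apply/eqP; apply: eq_integral => eta _ /=.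
have mGe : measurable_fun setT (fun xi : mrV d => (G ((xi : 'rV[R]_d) - (eta : 'rV[R]_d)))%:E).
  apply/measurable_EFinP.
  exact: (measurableT_comp mGs (pair2_measurable (eta : mrV d))).
have Ge0 (xi : mrV d) : setT xi -> (0 <= (G ((xi : 'rV[R]_d) - (eta : 'rV[R]_d)))%:E)%E.
  by move=> _; rewrite lee_fin.
have tr : (\int[lebd]_xi (G ((xi : 'rV[R]_d) - (eta : 'rV[R]_d)))%:E =
    \int[lebd]_xi (G xi)%:E)%E.
  have mG' : measurable_fun setT (fun z : mrV d => (G z)%:E) by exact/measurable_EFinP.
  have G0' z : (0 <= (G z)%:E)%E by rewrite lee_fin.
  rewrite [RHS](leb_affine (- (eta : 'rV[R]_d)) (@ltr01 R) mG' G0').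
  rewrite expr1n mul1e; apply: eq_integral => z _.
  by rewrite scale1r addrC.
under eq_integral do rewrite EFinM.
by rewrite (ge0_integralZl_EFin lebd measurableT Ge0 mGe (F0 eta)) tr.
Qed.

Lemma bcs_cis f (h : 'rV[R]_d -> R) : bcs f -> measurable_fun setT (h : mrV d -> R) ->
  bcs (fun x => f x * cis (h x)).
Proof.
move=> bf mh; apply: (bcsM bf); first exact: cmeasurable_cis.
by exists 1 => x; rewrite cnorm_cis lexx.
Qed.

(** Multiplying by a character translates the transform, which costs a factor
[expR (s |xi|)] by subadditivity. *)
Lemma wnorm_modulation s f xi : subadditive_weight s -> bcs f ->
  (wnorm s 1 (fun x => (f x * cis (- dotp x xi))%R) <=
   (expR (s (euclidean_norm xi)))%:E * wnorm s 1 f)%E.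
Proof.
move=> ws bf; have [s0 snd sadd] := ws.
have bfm : bcs (fun x => f x * cis (- dotp x xi)).
  by apply: bcs_cis => //; apply: measurable_funN; exact: measurable_dotpl.
have mf := measurable_weighted 1 ws bf.
rewrite !wnormE//.
under eq_integral do rewrite fourier_modulation//.
pose F (eta : 'rV[R]_d) := (cnorm (fourier f eta) * expR (1 * s (euclidean_norm (eta - xi))))%:E.
have mF : measurable_fun setT (F : mrV d -> \bar R).
  apply/measurable_EFinP; apply: measurable_funM.
    by apply: cmeasurable_norm; exact: fourier_cmeasurable.
  apply: measurableT_comp => //; apply: measurable_funM => //.
  exact: (measurableT_comp (measurable_weight_norm ws)
    (measurableT_comp measurable_sub_rV (pair2_measurable (xi : mrV d)))).
have F0 eta : (0 <= F eta)%E by rewrite lee_fin mulr_ge0 ?cnorm_ge0 ?expR_ge0.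
rewrite [leLHS](_ : _ = (\int[lebd]_eta F eta)%E); last first.
  rewrite [RHS](leb_affine xi (@ltr01 R) mF F0) expr1n mul1e.
  by apply: eq_integral => eta _; rewrite /F scale1r (addrC xi) addrK.
rewrite -ge0_integralZl ?lee_fin ?expR_ge0//; last 2 first.
- exact/measurable_EFinP.
- by move=> eta _; rewrite lee_fin mulr_ge0 ?cnorm_ge0 ?expR_ge0.
apply: ge0_le_integral => //.
- by apply: measurable_funeM; exact/measurable_EFinP.
- move=> eta _; rewrite /F -EFinM lee_fin mulrCA ler_wpM2l ?cnorm_ge0//.
  rewrite -expRD ler_expR !mul1r [leRHS]addrC.
  have nN : euclidean_norm (- xi) = euclidean_norm xi.
    by rewrite !euclidean_normE dotpNl dotpNr opprK.
  have := euclidean_normD (eta : 'rV[R]_d) (- xi); rewrite nN.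
  move=> /(snd _ _ (euclidean_norm_ge0 _)) /le_trans; apply.
  by apply: sadd; exact: euclidean_norm_ge0.
Qed.

End WeightedNorm.

(** * Weight functions *)

Section Weights.
Context {R : realType}.
Implicit Types w s v : R -> R.

Lemma weight_subadditive_weight w : weight w -> subadditive_weight w.
Proof.
by move=> ww; split;
  [exact: weight_ge0|exact: weight_nondecreasing|exact: weight_subadditive].
Qed.

Lemma subadditive_weight_scale w (N : R) : 0 <= N -> subadditive_weight w ->
  subadditive_weight (fun t => N * w t).
Proof.
move=> N0 [p m a]; split => [t t0|t v t0 tv|t v t0 v0].
- by rewrite mulr_ge0// p.
- by rewrite ler_wpM2l// m.
- by rewrite -mulrDr ler_wpM2l// a.
Qed.

Lemma weight_growth w : weight w -> forall M : R,
  \forall t \near +oo, M * ln (1 + t) <= w t.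
Proof.
move=> ww M.
have /cvgryPge /(_ M) H := weight_log ww.
near=> t; have t0 : 0 < t by near: t; apply: nbhs_pinfty_gt; exact: num_real.
have lt0 : 0 < ln (1 + t) by rewrite ln_gt0// ltrDl.
by rewrite -ler_pdivlMr//; near: t.
Unshelve. all: by end_near. Qed.

Lemma weight_cvgy w : weight w -> forall M : R, \forall t \near +oo, M <= w t.
Proof.
move=> ww M; near=> t.
have t1 : expR 1 <= t by near: t; apply: nbhs_pinfty_ge; exact: num_real.
have l1 : 1 <= ln (1 + t).
  rewrite -[leLHS](@expRK R) ler_ln ?posrE ?expR_gt0//.
    by rewrite (le_trans t1)// lerDr.
  by rewrite ltr_pwDl// (le_trans _ t1)// expR_ge0.
apply: (@le_trans _ _ (`|M| * ln (1 + t))).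
  by rewrite (le_trans (ler_norm M))// ler_peMr.
by near: t; exact: weight_growth.
Unshelve. all: by end_near. Qed.

Lemma near_pinfty_le (P : R -> Prop) : (\forall t \near +oo, P t) ->
  exists2 t0 : R, 0 <= t0 & forall t, t0 <= t -> P t.
Proof.
move=> [M [_ MP]]; exists (Num.max 0 (M + 1)); first by rewrite le_max lexx.
by move=> t; rewrite ge_max => /andP[_ Mt]; apply: MP; rewrite (lt_le_trans _ Mt)// ltrDl.
Qed.

Lemma weight_ll_le s v : weight s -> weight v -> weight_ll s v ->
  forall c : R, 0 < c -> exists C : R, forall t, 0 <= t -> s t <= c * v t + C.
Proof.
move=> ws wv sv c c0; have [t0 t00 H] := near_pinfty_le (sv c c0).
exists (s t0) => t t_ge0; have [tt0|/ltW t0t] := leP t t0.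
  rewrite (le_trans (weight_nondecreasing ws t_ge0 tt0))// lerDr.
  by rewrite mulr_ge0 ?(ltW c0)// weight_ge0.
have := H t t0t; rewrite !ger0_norm ?weight_ge0// => /le_trans; apply.
by rewrite lerDl weight_ge0.
Qed.

Lemma weight_integral_le w s (C : R) : weight w ->
  {within `[0, +oo[, continuous s} -> (forall t, 0 <= t -> 0 <= s t) ->
  (forall t, 0 <= t -> s t <= C * w t) ->
  (\int[lebesgue_measure]_(t in `[1%R, +oo[) (s t / t ^+ 2)%:E < +oo)%E.
Proof.
move=> ww cs s0 sC.
have M v : {within `[0, +oo[, continuous v} ->
    measurable_fun (`[1, +oo[%classic : set R) (fun t => v t / t ^+ 2).
  move=> cv; apply: measurable_funM.
    have mv : measurable_fun (`[0, +oo[%classic : set R) v.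
      exact: subspace_continuous_measurable_fun.
    apply: measurable_funS mv => //.
    by move=> t /=; rewrite !in_itv/= !andbT; apply: le_trans.
  apply: subspace_continuous_measurable_fun => //.
  apply: continuous_in_subspaceT => t; rewrite inE/= in_itv/= andbT => t1.
  apply: cvgV; first by rewrite expf_neq0// gt_eqF// (lt_le_trans _ t1).
  by apply: cvgM; exact: cvg_id.
have P (t : R) : 1 <= t -> 0 <= t by exact: le_trans.
have w0 t : 0 <= t -> 0 <= w t by exact: weight_ge0.
apply: (@le_lt_trans _ _ (\int[lebesgue_measure]_(t in `[1%R, +oo[)
  (`|C|%:E * (w t / t ^+ 2)%:E))%E).
  apply: ge0_le_integral => //.
  - move=> t; rewrite /= in_itv/= andbT => /P t0.
    by rewrite lee_fin divr_ge0 ?s0 ?sqr_ge0.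
  - by apply/measurable_EFinP; exact: M.
  - by apply: measurable_funeM; apply/measurable_EFinP; apply: M; exact: weight_continuous.
  - move=> t; rewrite /= in_itv/= andbT => /P t0.
    rewrite -EFinM lee_fin mulrA ler_wpM2r ?invr_ge0 ?sqr_ge0//.
    by rewrite (le_trans (sC t t0))// ler_wpM2r ?w0// ler_norm.
rewrite ge0_integralZl ?lee_fin//; last 2 first.
- by apply/measurable_EFinP; apply: M; exact: weight_continuous.
- move=> t; rewrite /= in_itv/= andbT => /P t0.
  by rewrite lee_fin divr_ge0 ?w0 ?sqr_ge0.
by rewrite lte_mul_pinfty ?lee_fin//; exact: weight_integral.
Qed.

Lemma weight_scale w v (N : R) : 0 < N -> weight w -> weight_ll w v ->
  weight (fun t => N * w t) /\ weight_ll (fun t => N * w t) v.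
Proof.
move=> N0 ww wv.
have cN : {within `[0, +oo[, continuous (fun t => N * w t)}.
  by move=> t; apply: cvgM; [exact: cvg_cst|exact: weight_continuous].
split; last first.
  move=> c c0; have := wv (c / N) (divr_gt0 c0 N0).
  apply: filterS => t; rewrite normrM (gtr0_norm N0) => h.
  by rewrite mulrC -ler_pdivlMr// mulrAC.
split.
- by move=> t t0; rewrite mulr_ge0 ?(ltW N0)// weight_ge0.
- by move=> t u t0 tu; rewrite ler_pM2l// weight_nondecreasing.
- exact: cN.
- by rewrite weight0 ?mulr0.
- by move=> t u t0 u0; rewrite -mulrDr ler_pM2l// weight_subadditive.
- apply: (weight_integral_le ww cN) => // t t0.
  by rewrite mulr_ge0 ?(ltW N0)// weight_ge0.
- apply/cvgryPge => M; have /cvgryPge /(_ (M / N)) := weight_log ww.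
  by apply: filterS => t; rewrite ler_pdivrMr// mulrC mulrA.
Qed.

(** Nondecreasing with [s t / t] nonincreasing.  Unlike subadditivity, both
conditions are stable under infima; for a function vanishing at 0 they imply
subadditivity, and they imply continuity away from 0. *)
Definition quasiconcave s := forall t u, 0 <= t -> t <= u ->
  s t <= s u /\ t * s u <= u * s t.

(** Monotonicity of [s t] and of [s t / t] makes [s] locally Lipschitz away from
0, and a bound [s <= C w] gives continuity at 0 and the integral condition. *)
Lemma quasiconcave_weight w s (C : R) : weight w -> quasiconcave s ->
  s 0 = 0 -> (forall t, 0 <= t -> s t <= C * w t) ->
  (forall M : R, \forall t \near +oo, M * ln (1 + t) <= s t) -> weight s.
Proof.
move=> ww qs s0 sC slog.
have sge0 t : 0 <= t -> 0 <= s t.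
  by move=> t0; have [+ _] := qs 0 t (lexx _) t0; rewrite s0.
have cs : {within `[0, +oo[, continuous s}.
  apply/continuous_within_itvcyP; split.
    move=> t; rewrite in_itv/= andbT => t0.
    apply/cvgrPdist_le => e e0.
    have L u : 0 < u -> `|s t - s u| <= `|t - u| * (s t / t).
      move=> u0; have [tu|/ltW ut] := leP t u.
        have [a b] := qs t u (ltW t0) tu.
        rewrite distrC ger0_norm ?subr_ge0// distrC ger0_norm ?subr_ge0//.
        by rewrite mulrA ler_pdivlMr// mulrBl [_ * t]mulrC; lra.
      have [a b] := qs u t (ltW u0) ut.
      rewrite ger0_norm ?subr_ge0// ger0_norm ?subr_ge0//.
      by rewrite mulrA ler_pdivlMr// !mulrBl [s u * t]mulrC; lra.
    have K0 : 0 < s t / t + 1.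
      by rewrite ltr_pwDr// divr_ge0 ?(ltW t0)// sge0// ltW.
    near=> u.
    have u0 : 0 < u by near: u; exact: lt_nbhsr.
    rewrite (le_trans (L u u0))//.
    apply: (@le_trans _ _ (`|t - u| * (s t / t + 1))).
      by rewrite ler_wpM2l// lerDl.
    rewrite -ler_pdivlMr//; near: u.
    by apply: cvgr_dist_le; [exact: cvg_id|exact: divr_gt0].
  have /continuous_within_itvcyP[_ w0] := weight_continuous ww.
  rewrite s0; have : C * w t @[t --> 0^'+] --> 0.
    have H : C * w t @[t --> 0^'+] --> C * w 0 by apply: cvgM; [exact: cvg_cst|exact: w0].
    by rewrite (weight0 ww) mulr0 in H.
  apply: squeeze_cvgr (cvg_cst 0); near=> t.
  have t0 : 0 < t by near: t; exact: nbhs_right_gt.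
  by rewrite sge0 ?sC// ltW.
split => //.
- by move=> t u t0 tu; have [] := qs t u t0 tu.
- move=> t u t0 u0.
  have [tu0|tu0] := eqVneq (t + u) 0.
    by rewrite tu0 s0 addr_ge0 ?sge0.
  have tup : 0 < t + u by rewrite lt_neqAle eq_sym tu0 addr_ge0.
  have [_ a] : s t <= s (t + u) /\ t * s (t + u) <= (t + u) * s t.
    by apply: qs => //; rewrite lerDl.
  have [_ b] : s u <= s (t + u) /\ u * s (t + u) <= (t + u) * s u.
    by apply: qs => //; rewrite lerDr.
  by rewrite -(ler_pM2l tup) mulrDr mulrDl; exact: lerD.
- exact: (weight_integral_le ww cs sge0 sC).
- apply/cvgryPge => M; near=> t.
  have t0 : 0 < t by near: t; apply: nbhs_pinfty_gt; exact: num_real.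
  have lt0 : 0 < ln (1 + t) by rewrite ln_gt0// ltrDl.
  by rewrite ler_pdivlMr//; near: t; exact: slog.
Unshelve. all: by end_near. Qed.

(** Subadditivity makes [w t / t] nonincreasing up to a factor 2, so that passing
to a quasiconcave majorant costs at most this factor. *)
Lemma weight_dilation w t u : weight w -> 0 < t -> 0 <= u ->
  w u <= (u / t + 1) * w t.
Proof.
move=> ww t0 u0.
have W n : w (n%:R * t) <= n%:R * w t.
  elim: n => [|n IH]; first by rewrite !mul0r weight0.
  rewrite -[n.+1]addn1 natrD !mulrDl !mul1r.
  rewrite (le_trans (weight_subadditive ww _ (ltW t0)))//.
    by rewrite mulr_ge0// ltW.
  by rewrite lerD2r.
have [n /andP[n1 n2]] : exists n : nat, u / t <= n%:R <= u / t + 1.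
  exists (Num.truncn (u / t)).+1.
  have := truncn_itv (divr_ge0 u0 (ltW t0)) => /andP[h1 h2].
  by rewrite ltW//= -addn1 natrD lerD2r.
apply: (@le_trans _ _ (w (n%:R * t))).
  by apply: weight_nondecreasing => //; rewrite -ler_pdivrMr.
by rewrite (le_trans (W n))// ler_wpM2r// weight_ge0// ltW.
Qed.

Section Hull.
Variables (w : R -> R) (ww : weight w).

Let slopes t : set R := [set Num.min 1 (t / u) * w u | u in [set u | 0 < u]].

(** The least quasiconcave majorant of [w]: each term of the supremum is the
smallest quasiconcave function taking the value [w u] at [u]. *)
Definition qhull t : R := sup (slopes t).

Let slopes_ub t : 0 <= t -> ubound (slopes t) (2 * w t).
Proof.
move=> t0 _ [u /= u0 <-]; have w0 := weight_ge0 ww.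
have [ut|/ltW tu] := leP u t.
  apply: (@le_trans _ _ (w u)).
    by apply: ler_piMl; [rewrite w0// ltW|rewrite ge_min lexx].
  rewrite (le_trans (weight_nondecreasing ww (ltW u0) ut))//.
  by rewrite ler_peMl ?w0// ler1n.
have [->|tn0] := eqVneq t 0.
  by rewrite mul0r min_r// mul0r weight0// mulr0.
have tp : 0 < t by rewrite lt_neqAle eq_sym tn0.
apply: (@le_trans _ _ (t / u * w u)).
  by rewrite ler_wpM2r ?w0 ?(ltW u0)// ge_min lexx orbT.
apply: (@le_trans _ _ (t / u * ((u / t + 1) * w t))).
  by rewrite ler_wpM2l ?divr_ge0 ?(ltW u0)// weight_dilation// ltW.
rewrite mulrA ler_wpM2r ?w0// mulrDr mulr1.
have -> : t / u * (u / t) = 1 by field; rewrite tn0 gt_eqF.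
have : t / u <= 1 by rewrite ler_pdivrMr// mul1r.
lra.
Qed.

Let slopes_sup t : 0 <= t -> has_sup (slopes t).
Proof.
move=> t0; split; last by exists (2 * w t); exact: slopes_ub.
by exists (Num.min 1 (t / 1) * w 1); exists 1 => //=; exact: ltr01.
Qed.

Lemma qhull_le t : 0 <= t -> qhull t <= 2 * w t.
Proof.
move=> t0; apply: ge_sup; first by case: (slopes_sup t0).
exact: slopes_ub.
Qed.

Let qhull_term t u : 0 <= t -> 0 < u -> Num.min 1 (t / u) * w u <= qhull t.
Proof.
by move=> t0 u0; apply: sup_upper_bound; [exact: slopes_sup|exists u].
Qed.

Lemma qhull_ge t : 0 <= t -> w t <= qhull t.
Proof.
rewrite le_eqVlt => /predU1P[<-|t0].
  have := @qhull_term 0 1 (lexx _) ltr01.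
  by rewrite mul0r min_r// mul0r (weight0 ww).
by have := qhull_term (ltW t0) t0; rewrite divff ?gt_eqF// minxx mul1r.
Qed.

Lemma qhull_quasiconcave : quasiconcave qhull.
Proof.
move=> t u t0 tu; have u0 := le_trans t0 tu.
have w0 := weight_ge0 ww.
split.
  apply: ge_sup; first by case: (slopes_sup t0).
  move=> _ [v /= v0 <-]; apply: le_trans (qhull_term u0 v0).
  rewrite ler_wpM2r ?w0 ?(ltW v0)//.
  rewrite le_min !ge_min lexx/= ler_pM2r ?invr_gt0// tu orbT//.
have [->|tn0] := eqVneq t 0.
  by rewrite mul0r mulr_ge0// (le_trans (w0 _ (lexx 0)))// qhull_ge.
have tp : 0 < t by rewrite lt_neqAle eq_sym tn0.
rewrite mulrC -ler_pdivlMr//; apply: ge_sup; first by case: (slopes_sup u0).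
move=> _ [v /= v0 <-]; rewrite ler_pdivlMr// mulrAC.
apply: (@le_trans _ _ (u * (Num.min 1 (t / v) * w v))); last first.
  by rewrite ler_wpM2l// qhull_term.
rewrite mulrA ler_wpM2r ?w0 ?(ltW v0)//.
rewrite mulrC minr_pMr// minr_pMr// !mulr1 le_min !ge_min.
have -> : t * (u / v) = u * (t / v) by rewrite mulrCA.
by rewrite tu lexx orbT.
Qed.

Variable (r : nat -> R).

Let K_ex (n : nat) : exists K : R, [/\ 0 <= K, (n == 0%N -> K = 0) &
  forall t, 0 <= t -> n%:R * ln (1 + t) <= w t / n.+1%:R + K].
Proof.
have w0 := weight_ge0 ww.
case: n => [|n].
  by exists 0; split => // t t0; rewrite mul0r addr0 divr1 w0.
have [t0 t00 H] := near_pinfty_le (weight_growth ww (n.+1%:R * n.+2%:R)).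
have l0 : 0 <= ln (1 + t0) by rewrite ln_ge0// lerDl.
exists (n.+1%:R * ln (1 + t0)); split => //; first by rewrite mulr_ge0.
move=> t tt0; have [tle|/ltW tge] := leP t t0.
  rewrite -[leLHS]add0r lerD ?divr_ge0 ?w0//.
  by rewrite ler_pM2l// ler_ln ?posrE ?ltr_wpDr// lerD2l.
rewrite -[leLHS]addr0 lerD ?mulr_ge0// ler_pdivlMr// mulrAC.
exact: H.
Qed.

Let K n : R := projT1 (cid (K_ex n)).

(* [K n] keeps the [n]-th term of the infimum below above [n ln (1 + t)], and the
   sum keeps it above [w] on [[0, r k]] for all [k < n]; [c_ 0 = 0] makes the
   infimum vanish at 0. *)
Let c_ n : R := K n + \sum_(k < n) w (Num.max 0 (r k)).

Let c_ge0 n : 0 <= c_ n.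
Proof.
have [K0 _ _] := projT2 (cid (K_ex n)).
by rewrite addr_ge0// sumr_ge0// => k _; rewrite weight_ge0// le_max lexx.
Qed.

Let c_0 : c_ 0 = 0.
Proof.
have [_ -> // _] := projT2 (cid (K_ex 0)).
by rewrite /c_ big_ord0 addr0 /K; case: (projT2 (cid (K_ex 0))) => _ ->.
Qed.

Let terms t : set R := [set qhull t / n.+1%:R + c_ n | n in [set: nat]].

Let sg t : R := inf (terms t).

Let qh0 t : 0 <= t -> 0 <= qhull t.
Proof. by move=> t0; rewrite (le_trans (weight_ge0 ww t0))// qhull_ge. Qed.

Let terms_lb t : 0 <= t -> lbound (terms t) 0.
Proof. by move=> t0 _ [n _ <-]; rewrite addr_ge0// divr_ge0// qh0. Qed.

Let terms_inf t : 0 <= t -> has_inf (terms t).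
Proof.
move=> t0; split; last by exists 0; exact: terms_lb.
by exists (qhull t / 1%:R + c_ 0); exists 0%N.
Qed.

Let sg_le t n : 0 <= t -> sg t <= qhull t / n.+1%:R + c_ n.
Proof. by move=> t0; apply: ge_inf; [case: (terms_inf t0)|exists n]. Qed.

Let sg_ge t x : 0 <= t -> (forall n, x <= qhull t / n.+1%:R + c_ n) -> x <= sg t.
Proof.
move=> t0 H; apply: lb_le_inf; first by case: (terms_inf t0).
by move=> _ [n _ <-].
Qed.

Let sg_quasiconcave : quasiconcave sg.
Proof.
move=> t u t0 tu; have u0 := le_trans t0 tu.
split.
  apply: sg_ge => // n; apply: le_trans (sg_le n t0) _.
  rewrite lerD2r ler_wpM2r ?invr_ge0//.
  by have [] := qhull_quasiconcave t0 tu.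
have [u00|un0] := eqVneq u 0.
  have -> : t = 0 by apply/le_anti; rewrite t0 -u00 tu.
  by rewrite u00 !mul0r.
have up : 0 < u by rewrite lt_neqAle eq_sym un0.
rewrite -ler_pdivrMl//; apply: sg_ge => // n.
apply: (@le_trans _ _ (u^-1 * (t * (qhull u / n.+1%:R + c_ n)))).
  by rewrite ler_wpM2l ?invr_ge0// ler_wpM2l// sg_le.
rewrite ler_pdivrMl// [leLHS]mulrDr [leRHS]mulrDr lerD//.
  rewrite !mulrA ler_wpM2r ?invr_ge0//.
  by have [] := qhull_quasiconcave t0 tu.
by rewrite ler_wpM2r.
Qed.

(** The infimum over [n] of [qhull / n.+1 + c_ n] is negligible with respect to
[w] because its [n]-th term is at most [2 w / n.+1] up to a constant.  On
[[0, r k]] the terms of index at most [k] are above [w / k.+1] by themselves and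
the others because of [c_ n]. *)
Theorem weight_below : exists s, [/\ weight s, weight_ll s w &
  forall k t, 0 <= t -> t <= r k -> w t / k.+1%:R <= s t].
Proof.
have w0 := weight_ge0 ww.
have Kle n t : 0 <= t -> n%:R * ln (1 + t) <= qhull t / n.+1%:R + c_ n.
  move=> t0; have [_ _ /(_ t t0) h] := projT2 (cid (K_ex n)).
  apply: le_trans h _; apply: lerD.
    by rewrite ler_wpM2r ?invr_ge0// qhull_ge.
  by rewrite lerDl sumr_ge0// => k _; rewrite w0// le_max lexx.
have wle n m t : 0 <= t -> (n <= m)%N -> w t / m.+1%:R <= qhull t / n.+1%:R + c_ n.
  move=> t0 nm; apply: (@le_trans _ _ (w t / n.+1%:R)).
    by rewrite ler_wpM2l ?w0// lef_pV2 ?posrE// ler_nat.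
  rewrite -[leLHS]addr0 lerD ?c_ge0//.
  by rewrite ler_wpM2r ?invr_ge0// qhull_ge.
exists sg; split.
- apply: (@quasiconcave_weight w sg 2 ww sg_quasiconcave).
  + apply/le_anti/andP; split; last by apply: sg_ge => // n; rewrite addr_ge0 ?c_ge0// divr_ge0// qh0.
    rewrite (le_trans (sg_le 0 (lexx 0)))// c_0 addr0 divr1.
    by rewrite (le_trans (qhull_le (lexx 0)))// (weight0 ww) mulr0.
  + move=> t t0; have := sg_le 0 t0.
    rewrite c_0 addr0 divr1 => /le_trans; apply; exact: qhull_le.
  + move=> M; pose N := (Num.truncn `|M|).+1.
    have MN : M <= N%:R.
      by rewrite (le_trans (ler_norm M))// ltW// truncnS_gt.
    near=> t.
    have t0 : 0 <= t by near: t; apply: nbhs_pinfty_ge; exact: num_real.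
    have l0 : 0 <= ln (1 + t) by rewrite ln_ge0// lerDl.
    apply: sg_ge => // n; have [nN|/ltnW Nn] := leqP n N; last first.
      apply: le_trans (Kle n t t0); rewrite ler_wpM2r//.
      by rewrite (le_trans MN)// ler_nat.
    apply: le_trans (wle n N t t0 nN).
    by rewrite ler_pdivlMr// mulrAC; near: t; exact: weight_growth.
- move=> c c0; pose n := (Num.truncn (4 / c)).
  have nc : 2 / n.+1%:R <= c / 2.
    have := truncnS_gt (4 / c); rewrite -/n => h.
    rewrite ler_pdivrMr// mulrAC ler_pdivlMr// -ler_pdivrMl//.
    by apply: le_trans (ltW h); rewrite mulrC; lra.
  near=> t.
  have t0 : 0 <= t by near: t; apply: nbhs_pinfty_ge; exact: num_real.
  have cn : c_ n <= c / 2 * w t.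
    rewrite mulrC -ler_pdivrMr ?divr_gt0//; near: t; exact: weight_cvgy.
  have s0 : 0 <= sg t.
    by apply: sg_ge => // m; rewrite addr_ge0 ?c_ge0// divr_ge0// qh0.
  rewrite !ger0_norm ?w0//.
  apply: le_trans (sg_le n t0) _.
  have -> : c * w t = c / 2 * w t + c / 2 * w t by lra.
  rewrite lerD//; apply: (@le_trans _ _ (2 / n.+1%:R * w t)).
    by rewrite mulrAC ler_wpM2r ?invr_ge0// qhull_le.
  by rewrite ler_wpM2r// w0.
- move=> k t t0 tr; apply: sg_ge => // n; have [nk|kn] := leqP n k; first exact: wle.
  apply: (@le_trans _ _ (w t)).
    by rewrite ler_piMr ?w0// invf_le1// ler1n.
  apply: (@le_trans _ _ (c_ n)); last by rewrite lerDr divr_ge0// qh0.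
  rewrite /c_ (bigD1 (Ordinal kn))//= addrCA -[leLHS]addr0 lerD//.
    by rewrite weight_nondecreasing// le_max tr orbT.
  have [K0 _ _] := projT2 (cid (K_ex n)).
  by rewrite addr_ge0// sumr_ge0// => j _; rewrite w0// le_max lexx.
Unshelve. all: by end_near. Qed.

End Hull.

End Weights.

(** * Roumieu and Beurling conditions *)

Section WeightsAndNorms.
Context {R : realType} {d : nat}.
Notation lebd := (@leb R d).
Notation cmeas := (@cmeasurable R _ (mrV d)).
Notation cinteg := (@cintegrable R _ (mrV d) lebd).
Implicit Types f g : 'rV[R]_d -> R[i].
Implicit Types s w : R -> R.

Lemma weight_polynomial s (N : nat) : weight s ->
  exists2 C : R, 0 < C & forall t, 0 <= t -> (1 + t) ^+ N <= C * expR (s t).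
Proof.
move=> ws; have [t0 t00 H] := near_pinfty_le (weight_growth ws N%:R).
have C1 : 1 <= (1 + t0) ^+ N by apply: exprn_ege1; rewrite lerDl.
exists ((1 + t0) ^+ N); first exact: lt_le_trans C1.
move=> t tt0; have p : 0 < 1 + t by rewrite ltr_wpDr.
have e1 : 1 <= expR (s t) by rewrite -expR0 ler_expR weight_ge0.
have [tle|/ltW tge] := leP t t0.
  apply: (@le_trans _ _ ((1 + t0) ^+ N)); first by rewrite lerXn2r ?nnegrE ?addr_ge0// lerD2l.
  by rewrite ler_peMr// exprn_ge0// addr_ge0.
apply: (@le_trans _ _ (expR (s t))); last by rewrite ler_peMl ?expR_ge0.
by rewrite -[X in X ^+ N](lnK (x := 1 + t)) ?posrE// -expRM_natl ler_expR; exact: H.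
Qed.

(** The Poisson kernel decays at most like [|xi| ^ (-2 d)], so any function decaying
faster is integrable by comparison. *)
Lemma poisson_euclidean (xi : 'rV[R]_d) :
  1 <= poisson xi * (1 + euclidean_norm xi) ^+ (2 * d).
Proof.
have n0 := euclidean_norm_ge0 xi.
rewrite exprM -{3}(card_ord d) -prodr_const /poisson -big_split/=.
have {1}-> : 1 = \prod_(i < d) 1 :> R by rewrite big1.
apply: ler_prod => i _.
rewrite ler01/= mulrAC ler_pdivlMr ?ltr_wpDr ?sqr_ge0// mul1r.
have := coord_le_euclidean_norm xi i.
rewrite -(ler_pXn2r (n := 2)) ?nnegrE// real_normK ?num_real// => h.
rewrite sqrrD expr1n; apply: (@le_trans _ _ (1 + euclidean_norm xi ^+ 2)).
  by rewrite lerD2l.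
have : 0 <= 1 * euclidean_norm xi *+ 2 by rewrite mulrn_wge0// mul1r.
have : 0 <= euclidean_norm xi ^+ 2 by exact: sqr_ge0.
lra.
Qed.

Lemma integrable_exp_weight s : weight s ->
  lebd.-integrable setT
    (fun xi : mrV d => (expR (- s (euclidean_norm (xi : 'rV[R]_d))))%:E).
Proof.
move=> ws; have [C C0 H] := weight_polynomial (2 * d) ws.
have mE : measurable_fun setT (fun xi : mrV d => expR (- s (euclidean_norm (xi : 'rV[R]_d)))).
  apply: measurableT_comp => //; apply: measurable_funN.
  exact: measurable_weight_norm (weight_subadditive_weight ws).
have pint := integrableZl measurableT C (@integrable_poisson R d).
apply: le_integrable pint => //; first exact/measurable_EFinP.
move=> xi _; rewrite /= lee_fin ger0_norm ?expR_ge0//.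
rewrite ger0_norm ?mulr_ge0 ?(ltW C0) ?poisson_ge0//.
have P := poisson_euclidean xi; have n0 := euclidean_norm_ge0 xi.
rewrite expRN -[leLHS]mul1r ler_pdivrMr ?expR_gt0//; apply: le_trans P _.
rewrite [leRHS](_ : _ = poisson xi * (C * expR (s (euclidean_norm xi)))).
  by rewrite ler_wpM2l ?poisson_ge0//; exact: H.
by rewrite mulrCA mulrA.
Qed.

Lemma wnorm_weight_ll s w l f : weight s -> weight w -> weight_ll s w -> 0 < l ->
  bcs f -> (wnorm w l f < +oo)%E -> (wnorm s 1 f < +oo)%E.
Proof.
move=> ws ww sw l0 bf; have [C H] := weight_ll_le ws ww sw l0.
have ss := weight_subadditive_weight ws; have sw' := weight_subadditive_weight ww.
rewrite !wnormE// => fin.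
apply: (@le_lt_trans _ _ (\int[lebd]_xi ((expR C)%:E * (cnorm (fourier f xi) *
    expR (l * w (euclidean_norm (xi : 'rV[R]_d))))%:E))%E).
  apply: ge0_le_integral => //.
  - by move=> xi _; rewrite lee_fin mulr_ge0 ?cnorm_ge0 ?expR_ge0.
  - by apply/measurable_EFinP; exact: measurable_weighted.
  - by apply: measurable_funeM; apply/measurable_EFinP; exact: measurable_weighted.
  - move=> xi _; rewrite -EFinM lee_fin mulrCA ler_wpM2l ?cnorm_ge0//.
    by rewrite -expRD ler_expR mul1r addrC; apply: H; exact: euclidean_norm_ge0.
rewrite ge0_integralZl_EFin ?expR_ge0//.
- by rewrite lte_mul_pinfty ?lee_fin ?expR_ge0.
- by move=> xi _; rewrite lee_fin mulr_ge0 ?cnorm_ge0 ?expR_ge0.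
- by apply/measurable_EFinP; exact: measurable_weighted.
Qed.

Lemma wnorm_le_l w l m f : weight w -> l <= m -> bcs f ->
  (wnorm w l f <= wnorm w m f)%E.
Proof.
move=> ww lm bf; have sw := weight_subadditive_weight ww.
rewrite !wnormE//; apply: ge0_le_integral => //.
- by move=> xi _; rewrite lee_fin mulr_ge0 ?cnorm_ge0 ?expR_ge0.
- by apply/measurable_EFinP; exact: measurable_weighted.
- by apply/measurable_EFinP; exact: measurable_weighted.
- move=> xi _; rewrite lee_fin ler_wpM2l ?cnorm_ge0// ler_expR.
  by rewrite ler_wpM2r// weight_ge0// euclidean_norm_ge0.
Qed.

Let eball (m : nat) : set (mrV d) := [set xi | euclidean_norm (xi : 'rV[R]_d) <= m%:R].

Let measurable_eball m : measurable (eball m).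
Proof.
rewrite (_ : eball m =
    (fun xi : mrV d => euclidean_norm (xi : 'rV[R]_d)) @^-1` `]-oo, m%:R]).
  by rewrite -[X in measurable X]setTI; apply: measurable_euclidean_norm.
by apply/seteqP; split => x /=; rewrite in_itv.
Qed.

(** If no norm with [l = 1 / n.+1] is finite, there are radii [r n] such that the
integral over the ball of radius [r n] is at least [n]; the weight that
[weight_below] associates with them has an infinite norm. *)
Theorem roumieu_of_beurling w f : weight w -> bcs f ->
  (forall s, weight s -> weight_ll s w -> (wnorm s 1 f < +oo)%E) ->
  exists2 l, 0 < l & (wnorm w l f < +oo)%E.
Proof.
move=> ww bf H; apply: contrapT => N.
have sw := weight_subadditive_weight ww.
have inf n : wnorm w n.+1%:R^-1 f = +oo%E.
  apply/eqP; rewrite -leye_eq leNgt; apply/negP => h; apply: N.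
  by exists n.+1%:R^-1 => //; rewrite invr_gt0.
pose F n xi := (cnorm (fourier f xi) * expR (n.+1%:R^-1 * w (euclidean_norm xi)))%:E.
have F0 n (xi : mrV d) : (0 <= F n xi)%E.
  by rewrite lee_fin mulr_ge0 ?cnorm_ge0 ?expR_ge0.
have mF n : measurable_fun setT (F n : mrV d -> \bar R).
  by apply/measurable_EFinP; exact: measurable_weighted.
have ex n : exists m : nat, (n%:R%:E <= \int[lebd]_(xi in eball m) F n xi)%E.
  apply: contrapT => /forallNP M.
  have nd : nondecreasing_seq eball.
    move=> m k mk; apply/subsetPset => xi /=; rewrite /eball/= => /le_trans; apply.
    by rewrite ler_nat.
  have U : \bigcup_m eball m = setT.
    apply/seteqP; split => // xi _; exists (Num.truncn (euclidean_norm (xi : 'rV[R]_d))).+1 => //.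
    by rewrite /eball/= ltW// truncnS_gt.
  have := @ge0_nondecreasing_set_cvg_integral _ _ R eball (F n) lebd nd
    measurable_eball (fun i => measurable_funTS (mF n)) (fun _ xi _ => F0 n xi).
  rewrite U => cv.
  have : (\int[lebd]_(xi in setT) F n xi <= n%:R%:E)%E.
    apply: (cvge_to_le cv); apply: nearW => m; rewrite leNgt; apply/negP => h.
    by apply: (M m); exact: ltW.
  by rewrite -[X in (X <= _)%E -> _](wnormE n.+1%:R^-1 sw bf) inf.
have /choice[r hr] := ex.
have [s [ws sl sge]] := weight_below ww (fun n => (r n)%:R).
have := H s ws sl.
have ss := weight_subadditive_weight ws.
rewrite wnormE// => fin.
set I := (\int[_]_xi _)%E in fin.
have I0 : (0 <= I)%E.
  by apply: integral_ge0 => xi _; rewrite lee_fin mulr_ge0 ?cnorm_ge0 ?expR_ge0.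
have IE : (fine I)%:E = I by rewrite fineK// ge0_fin_numE.
have : (((Num.truncn (fine I)).+1)%:R%:E <= I)%E.
  apply: le_trans (hr _) _.
  rewrite integral_mkcond; apply: ge0_le_integral => //.
  - by move=> xi _; rewrite patchE; case: ifP.
  - by apply/(measurable_restrictT _ _).1 => //; exact: measurable_funTS.
  - by apply/measurable_EFinP; exact: measurable_weighted.
  - move=> xi _; rewrite patchE; case: ifPn => [|_]; last first.
      by rewrite lee_fin mulr_ge0 ?cnorm_ge0 ?expR_ge0.
    rewrite inE /eball/= => xr; rewrite lee_fin ler_wpM2l ?cnorm_ge0//.
    rewrite ler_expR mul1r mulrC; apply: sge => //; exact: euclidean_norm_ge0.
by rewrite -IE lee_fin leNgt truncnS_gt.
Qed.

End WeightsAndNorms.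

(** * Smoothness from the decay of the transform *)

Section TrigonometricBounds.
Context {R : realType}.
Implicit Types t : R.

Lemma norm_sin_le t : `|sin t| <= `|t|.
Proof.
wlog t0 : t / 0 <= t.
  move=> H; have [/H//|/ltW t0] := leP 0 t.
  by rewrite -normrN -sinN -[leRHS]normrN; apply: H; rewrite oppr_ge0.
have [c _ ] := @MVT_segment R sin cos 0 t t0 (fun x _ => is_derive_sin x)
  (continuous_subspaceT (@continuous_sin R)).
rewrite sin0 !subr0 => ->; rewrite normrM ler_piMl// ler_norml cos_geN1.
exact: cos_le1.
Qed.

Lemma norm_cosB1_le t : `|cos t - 1| <= t ^+ 2.
Proof.
wlog t0 : t / 0 <= t.
  move=> H; have [/H//|/ltW t0] := leP 0 t.
  by rewrite -cosN -sqrrN; apply: H; rewrite oppr_ge0.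
have [c ] := @MVT_segment R cos (fun x => - sin x) 0 t t0 (fun x _ => is_derive_cos x)
  (continuous_subspaceT (@continuous_cos R)).
rewrite in_itv/= => /andP[c0 ct]; rewrite cos0 !subr0 => ->.
rewrite normrM normrN expr2 (ger0_norm t0) ler_wpM2r//.
by rewrite (le_trans (norm_sin_le c))// ger0_norm.
Qed.

Lemma norm_cosB1_le1 t : `|cos t - 1| <= `|t|.
Proof.
wlog t0 : t / 0 <= t.
  move=> H; have [/H//|/ltW t0] := leP 0 t.
  by rewrite -cosN -(normrN t); apply: H; rewrite oppr_ge0.
have [c _] := @MVT_segment R cos (fun x => - sin x) 0 t t0 (fun x _ => is_derive_cos x)
  (continuous_subspaceT (@continuous_cos R)).
rewrite cos0 !subr0 => ->.
rewrite normrM normrN ler_piMl// ler_norml sin_geN1.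
exact: sin_le1.
Qed.

Lemma norm_sinB_le t : `|sin t - t| <= t ^+ 2.
Proof.
wlog t0 : t / 0 <= t.
  move=> H; have [/H//|/ltW t0] := leP 0 t.
  have := H (- t); rewrite oppr_ge0 => /(_ t0).
  by rewrite sinN sqrrN -opprD normrN.
have dr (x : R) : is_derive x 1 (fun x => sin x - x) (cos x - 1).
  by apply: is_deriveB.
have ct : continuous (fun x : R => sin x - x).
  by move=> x; apply: cvgB; [exact: continuous_sin|exact: cvg_id].
have [c ] := @MVT_segment R (fun x => sin x - x) (fun x => cos x - 1) 0 t t0 (fun x _ => dr x)
  (continuous_subspaceT ct).
rewrite in_itv/= => /andP[c0 ctt]; rewrite sin0 !subr0 => ->.
rewrite normrM expr2 (ger0_norm t0) ler_wpM2r//.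
by rewrite (le_trans (norm_cosB1_le1 c))// ger0_norm.
Qed.

Lemma cisB1_le t : cnorm (cis t - 1) <= 2 * `|t|.
Proof.
rewrite (le_trans (cnorm_le _))// !cpart/= subr0 mulr_natl mulr2n lerD//.
  exact: norm_cosB1_le1.
exact: norm_sin_le.
Qed.

Lemma cis_taylor t : cnorm (cis t - 1 - (Complex 0 1) * (t%:C)%C) <= 2 * t ^+ 2.
Proof.
rewrite (le_trans (cnorm_le _))// !cpart/= !mul0r !mul1r subrr !subr0 add0r.
rewrite mulr_natl mulr2n lerD//; first exact: norm_cosB1_le.
exact: norm_sinB_le.
Qed.

End TrigonometricBounds.

Section Smoothness.
Context {R : realType} {d : nat}.
Notation lebd := (@leb R d).
Notation cmeas := (@cmeasurable R _ (mrV d)).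
Notation cinteg := (@cintegrable R _ (mrV d) lebd).
Implicit Types f g h : 'rV[R]_d -> R[i].

(** Decay that is preserved by multiplication with polynomials, hence by
differentiation of the inverse transform. *)
Definition moments h := cmeas h /\ forall N : nat,
  (\int[lebd]_xi (cnorm (h xi) * (1 + euclidean_norm (xi : 'rV[R]_d)) ^+ N)%:E < +oo)%E.

Definition ifourier h (x : 'rV[R]_d) : R[i] := cint lebd (fun xi => h xi * cis (dotp x xi)).

(** The symbol of the [i]-th partial derivative. *)
Definition idiff i h (xi : 'rV[R]_d) : R[i] := h xi * (Complex 0 1 * ((xi 0 i)%:C)%C).

Lemma measurable_moment h N : cmeas h -> measurable_fun setT
  (fun xi : mrV d => cnorm (h xi) * (1 + euclidean_norm (xi : 'rV[R]_d)) ^+ N).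
Proof.
move=> mh; apply: measurable_funM; first exact: cmeasurable_norm.
apply: measurable_funX; apply: measurable_funD => //.
exact: measurable_euclidean_norm.
Qed.

Lemma moment_ge0 h N (xi : 'rV[R]_d) : 0 <= cnorm (h xi) * (1 + euclidean_norm xi) ^+ N.
Proof. by rewrite mulr_ge0 ?cnorm_ge0// exprn_ge0// addr_ge0// euclidean_norm_ge0. Qed.

Lemma moment_integrable h N : moments h -> lebd.-integrable setT
  (fun xi : mrV d => (cnorm (h xi) * (1 + euclidean_norm (xi : 'rV[R]_d)) ^+ N)%:E).
Proof.
move=> [mh hN]; apply/integrableP; split.
  by apply/measurable_EFinP; exact: measurable_moment.
apply: le_lt_trans (hN N); rewrite le_eqVlt; apply/orP; left; apply/eqP.
by apply: eq_integral => xi _; rewrite /= ger0_norm// moment_ge0.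
Qed.

Lemma moments_le h k (C : R) (N : nat) : 0 <= C -> moments h -> cmeas k ->
  (forall xi, cnorm (k xi) <= C * (cnorm (h xi) * (1 + euclidean_norm xi) ^+ N)) ->
  moments k.
Proof.
move=> C0 mh mk kh; split => // M.
have [mh' hN] := mh.
apply: (@le_lt_trans _ _ (\int[lebd]_xi (C%:E *
    (cnorm (h xi) * (1 + euclidean_norm (xi : 'rV[R]_d)) ^+ (N + M))%:E))%E).
  apply: ge0_le_integral => //.
  - by move=> xi _; rewrite lee_fin moment_ge0.
  - by apply/measurable_EFinP; exact: measurable_moment.
  - by apply: measurable_funeM; apply/measurable_EFinP; exact: measurable_moment.
  - move=> xi _; rewrite -EFinM lee_fin exprD [X in _ <= C * X]mulrA [leRHS]mulrA ler_wpM2r//.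
    by rewrite exprn_ge0// addr_ge0// euclidean_norm_ge0.
rewrite ge0_integralZl_EFin//.
- by rewrite lte_mul_pinfty ?lee_fin.
- by move=> xi _; rewrite lee_fin moment_ge0.
- by apply/measurable_EFinP; exact: measurable_moment.
Qed.

Lemma moments_idiff i h : moments h -> moments (idiff i h).
Proof.
move=> mh; apply: (moments_le ler01 mh (N := 1)).
  case: mh => mh _; apply: cmeasurableM => //; apply: cmeasurableM.
    exact: cmeasurable_cst.
  by apply: cmeasurable_real; exact: measurable_coord.
move=> xi; rewrite mul1r expr1 /idiff !Normc.normcM cnorm_real ler_wpM2l ?cnorm_ge0//.
rewrite (_ : cnorm _ = 1) ?mul1r; last by rewrite cnormE/= expr0n/= expr1n add0r sqrtr1.
by rewrite (le_trans (coord_le_euclidean_norm _ _))// lerDr.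
Qed.

Lemma ifourier_integrable h x : moments h -> cinteg (fun xi => h xi * cis (dotp x xi)).
Proof.
move=> mh; apply: cintegrable_le (moment_integrable 0 mh).
  by apply: cmeasurableM; [case: mh|exact: cmeas_cis_dotpr].
by move=> xi; rewrite Normc.normcM cnorm_cis mulr1.
Qed.

Lemma cint_moment_le h k (C : R) (N : nat) : 0 <= C -> moments h -> cinteg k ->
  (forall xi, cnorm (k xi) <= C * (cnorm (h xi) * (1 + euclidean_norm xi) ^+ N)) ->
  cnorm (cint lebd k) <= C *
   fine (\int[lebd]_xi (cnorm (h xi) * (1 + euclidean_norm (xi : 'rV[R]_d)) ^+ N)%:E)%E.
Proof.
move=> C0 mh ik kh; have [mh' hN] := mh.
rewrite -lee_fin; apply: le_trans (cnorm_cint ik) _.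
rewrite EFinM fineK; last first.
  by rewrite ge0_fin_numE//; apply: integral_ge0 => xi _; rewrite lee_fin moment_ge0.
rewrite -ge0_integralZl_EFin//; last 2 first.
- by move=> xi _; rewrite lee_fin moment_ge0.
- by apply/measurable_EFinP; exact: measurable_moment.
apply: ge0_le_integral => //.
- by move=> xi _; rewrite lee_fin cnorm_ge0.
- by apply/measurable_EFinP; apply: cmeasurable_norm; case/cintegrableP: ik.
- by apply: measurable_funeM; apply/measurable_EFinP; exact: measurable_moment.
- by move=> xi _; rewrite -EFinM lee_fin.
Qed.

Lemma dotp_sup_le (z xi : 'rV[R]_d) : `|dotp z xi| <= d%:R * `|z| * euclidean_norm xi.
Proof.
rewrite (le_trans (ler_norm_sum _ _ _))//.
apply: (@le_trans _ _ (\sum_(i < d) `|z| * euclidean_norm xi)); last first.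
  by rewrite sumr_const card_ord -mulrA mulr_natl.
apply: ler_sum => i _; rewrite normrM ler_pM//; last exact: coord_le_euclidean_norm.
by rewrite [leRHS]mx_normrE (le_trans _ (le_bigmax _ _ (ord0, i)))//=.
Qed.

Lemma lipschitz_continuous_rV (u : 'rV[R]_d -> R) (C : R) :
  (forall x y, `|u y - u x| <= C * `|y - x|) -> continuous u.
Proof.
move=> B x.
have FF : ProperFilter (nbhs (x : 'rV[R]_d)) by exact: nbhs_pfilter.
have L : C * `|y - x| @[y --> x] --> (0 : R).
  rewrite -[X in _ --> X](mulr0 C); apply: cvgM; first exact: cvg_cst.
  have -> : 0 = `|x - x| :> R by rewrite subrr normr0.
  by apply: cvg_norm; exact: cvgB cvg_id (cvg_cst x).
suff : u y @[y --> x] --> u x by [].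
apply/cvgrPdist_lt => e e0; move/cvgrPdist_lt: L => /(_ e e0).
apply: filterS => y; rewrite sub0r normrN => /(le_lt_trans (ler_norm _)).
by apply: le_lt_trans; rewrite distrC; exact: B.
Qed.

Lemma continuous_dotp (xi : 'rV[R]_d) : continuous (fun x : 'rV[R]_d => dotp x xi).
Proof.
apply: (@lipschitz_continuous_rV _ (d%:R * euclidean_norm xi)) => x y.
by rewrite -dotpNl -dotpDl mulrAC; exact: dotp_sup_le.
Qed.

Lemma ifourier_continuous h : moments h ->
  continuous (fun x => cRe (ifourier h x)).
Proof.
move=> mh.
pose C := fine (\int[lebd]_xi (cnorm (h xi) * (1 + euclidean_norm (xi : 'rV[R]_d)) ^+ 1)%:E)%E.
apply: (@lipschitz_continuous_rV _ (2 * d%:R * C)) => x y.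
rewrite -cReN -cReD (le_trans (cRe_le _))//.
have iy := ifourier_integrable y mh; have ix := ifourier_integrable x mh.
rewrite -(cintB iy ix) (_ : 2 * d%:R * C * _ = 2 * (d%:R * `|y - x|) * C); last by ring.
apply: (cint_moment_le _ mh (cintegrableB iy ix)) => [|xi].
  by rewrite !mulr_ge0.
have -> : h xi * cis (dotp y xi) - h xi * cis (dotp x xi) =
    h xi * (cis (dotp x xi) * (cis (dotp (y - x) xi) - 1)).
  have -> : cis (dotp y xi) = cis (dotp x xi) * cis (dotp (y - x) xi).
    by rewrite -cisD -dotpDl addrC subrK.
  by move: (h xi) (cis _) (cis _) => a u v; ring.
rewrite !Normc.normcM cnorm_cis mul1r mulrCA ler_wpM2l ?cnorm_ge0//.
rewrite (le_trans (cisB1_le _))// -mulrA ler_wpM2l// expr1.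
rewrite (le_trans (dotp_sup_le _ _))// ler_wpM2l ?mulr_ge0//.
by rewrite lerDr.
Qed.

(** The second-order Taylor bound for [cis] compares the difference quotient with
the derivative under the integral, with an error [O(|t|)] controlled by the
second moment. *)
Lemma ifourier_derive h i x : moments h ->
  (t^-1 *: (cRe (ifourier h (t *: delta_mx 0 i + x)) - cRe (ifourier h x)))
   @[t --> 0^'] --> cRe (ifourier (idiff i h) x).
Proof.
move=> mh; have mi := moments_idiff i mh.
pose C := fine (\int[lebd]_xi (cnorm (h xi) * (1 + euclidean_norm (xi : 'rV[R]_d)) ^+ 2)%:E)%E.
have B (t : R) : t != 0 ->
  `|t^-1 *: (cRe (ifourier h (t *: delta_mx 0 i + x)) - cRe (ifourier h x)) -
    cRe (ifourier (idiff i h) x)| <= 2 * `|t| * C.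
  move=> t0.
  have iy := ifourier_integrable (t *: delta_mx 0 i + x) mh.
  have ix := ifourier_integrable x mh.
  have id := ifourier_integrable x mi.
  have ii := cintegrableB (cintegrableZ (t^-1%:C)%C (cintegrableB iy ix)) id.
  have -> : t^-1 *: (cRe (ifourier h (t *: delta_mx 0 i + x)) - cRe (ifourier h x)) -
    cRe (ifourier (idiff i h) x) = cRe (cint lebd (fun xi : mrV d =>
     (t^-1%:C)%C * (h xi * cis (dotp (t *: delta_mx 0 i + x) xi) - h xi * cis (dotp x xi))
      - idiff i h xi * cis (dotp x xi))).
    rewrite (cintB (cintegrableZ (t^-1%:C)%C (cintegrableB iy ix)) id).
    rewrite (cintZ (t^-1%:C)%C (cintegrableB iy ix)) (cintB iy ix).
    by rewrite !cpart/= mul0r subr0.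
  rewrite (le_trans (cRe_le _))//.
  apply: (cint_moment_le _ mh ii) => [|xi].
    by rewrite mulr_ge0.
  have -> : dotp (t *: delta_mx 0 i + x) xi = t * xi 0 i + dotp x xi.
    rewrite dotpDl dotpZl; congr (t * _ + _).
    rewrite /dotp (bigD1 i)//= big1 ?addr0 => [|j ji]; first by rewrite mxE !eqxx mul1r.
    by rewrite mxE (negbTE ji) andbF mul0r.
  have tC : (t%:C)%C * (t^-1%:C)%C = 1 :> R[i].
    by apply: cplx_ext; rewrite ?cpart/= ?mulr0 ?mul0r ?subr0 ?addr0 ?divff.
  have tM : ((t * xi 0 i)%:C)%C = (t%:C)%C * ((xi 0 i)%:C)%C :> R[i].
    by apply: cplx_ext; rewrite ?cpart/= ?mulr0 ?mul0r ?subr0 ?addr0.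
  have -> : (t^-1%:C)%C * (h xi * cis (t * xi 0 i + dotp x xi) - h xi * cis (dotp x xi))
      - idiff i h xi * cis (dotp x xi) =
    (t^-1%:C)%C * (h xi * (cis (dotp x xi) *
      (cis (t * xi 0 i) - 1 - Complex 0 1 * ((t * xi 0 i)%:C)%C))).
    rewrite cisD tM /idiff.
    move: (h xi) (cis _) (cis _) (Complex 0 1) (((xi 0 i)%:C)%C) tC => a u v I y.
    move: (t^-1%:C)%C (t%:C)%C => q p pq.
    rewrite (_ : a * (I * y) * u = p * q * (a * (I * y) * u)).
      by ring.
    by rewrite pq mul1r.
  rewrite !Normc.normcM cnorm_cis mul1r cnorm_real.
  rewrite (_ : 2 * `|t| * _ = `|t^-1| * (cnorm (h xi) *
      (2 * `|t| ^+ 2 * (1 + euclidean_norm xi) ^+ 2))); last first.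
    rewrite normfV; move: (cnorm _) => u; field; by rewrite normr_eq0.
  rewrite ler_wpM2l// ler_wpM2l ?cnorm_ge0// (le_trans (cis_taylor _))//.
  rewrite -mulrA ler_wpM2l// exprMn -normrX (ger0_norm (sqr_ge0 _)).
  rewrite ler_wpM2l ?sqr_ge0// -(ger0_norm (sqr_ge0 (xi 0 i))) normrX lerXn2r ?nnegrE//.
    by rewrite addr_ge0// euclidean_norm_ge0.
  by rewrite (le_trans (coord_le_euclidean_norm _ _))// lerDr.
have L : 2 * `|t| * C @[t --> (0 : R)^'] --> (0 : R).
  rewrite -[X in _ --> X](mul0r C) -[X in _ --> X * C](mulr0 2).
  apply: cvgM; last exact: cvg_cst.
  apply: cvgM; first exact: cvg_cst.
  rewrite -[X in _ --> X](normr0 R).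
  by apply: cvg_norm; exact: nbhs_dnbhs.
apply/cvgrPdist_lt => e e0; move/cvgrPdist_lt: L => /(_ e e0) L.
near=> t.
rewrite distrC; apply: le_lt_trans (B t _) _; first by near: t; exact: nbhs_dnbhs_neq.
apply: le_lt_trans (ler_norm _) _; rewrite -normrN -sub0r.
by near: t.
Unshelve. all: by end_near. Qed.

Lemma ifourier_Cn n Om h : moments h -> Cn_on n Om (fun x => cRe (ifourier h x)).
Proof.
elim: n h => [|n IH] h mh; split => //.
- by move=> x _; exact: ifourier_continuous.
- by move=> x _; exact: ifourier_continuous.
move=> i; have D (x : 'rV[R]_d) := ifourier_derive (i := i) (x := x) mh.
split; first by move=> x _; apply/cvg_ex; exists (cRe (ifourier (idiff i h) x)); exact: D.
have -> : (fun x => 'D_(delta_mx 0 i) (fun x => cRe (ifourier h x)) x) =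
    fun x => cRe (ifourier (idiff i h) x).
  by apply/funext => x; apply: cvg_lim => //; exact: D.
by apply: IH; exact: moments_idiff.
Qed.

Theorem csmooth_of_wnorm s Om A f : weight s -> Cc A f -> (wnorm s 1 f < +oo)%E ->
  csmooth_on Om f.
Proof.
move=> ws cf fin; have bf := Cc_bcs cf; have [ccf _ _] := cf.
have ss := weight_subadditive_weight ws.
have mf := fourier_cmeasurable bf.
have mof : moments (fourier f).
  split=> // N; have [C C0 H] := weight_polynomial N ws.
  apply: (@le_lt_trans _ _ (\int[lebd]_xi (C%:E * (cnorm (fourier f xi) *
    expR (1 * s (euclidean_norm (xi : 'rV[R]_d))))%:E))%E).
    apply: ge0_le_integral => //.
    - by move=> xi _; rewrite lee_fin moment_ge0.
    - by apply/measurable_EFinP; exact: measurable_moment.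
    - by apply: measurable_funeM; apply/measurable_EFinP; exact: measurable_weighted.
    - move=> xi _; rewrite -EFinM lee_fin mulrCA ler_wpM2l ?cnorm_ge0// mul1r.
      by apply: H; exact: euclidean_norm_ge0.
  rewrite ge0_integralZl_EFin ?(ltW C0)//.
  - by rewrite -wnormE// lte_mul_pinfty ?lee_fin ?(ltW C0)// wnorm_ge0.
  - by move=> xi _; rewrite lee_fin mulr_ge0 ?cnorm_ge0 ?expR_ge0.
  - by apply/measurable_EFinP; exact: measurable_weighted.
pose c : R := ((2 * pi) ^+ d)^-1.
have c0 : (2 * pi) ^+ d != 0 :> R by rewrite gt_eqF// exprn_gt0// mulr_gt0// pi_gt0.
have mh (a : R[i]) : moments (fun xi => a * fourier f xi).
  apply: (moments_le (cnorm_ge0 a) mof (N := 0)).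
    by apply: cmeasurableM => //; exact: cmeasurable_cst.
  by move=> xi; rewrite Normc.normcM expr0 mulr1.
have E (a : R[i]) x : ifourier (fun xi => a * fourier f xi) x =
    a * ((((2 * pi) ^+ d)%:C)%C * f x).
  have ii := ifourier_integrable x mof.
  rewrite -(fourier_inversion x bf ccf); last first.
    exact: le_lt_trans (wnorm_ge_fourier ss bf ler01) fin.
  rewrite -(cintZ a ii); congr cint; apply/funext => xi; exact/esym/mulrA.
move=> n; split.
- rewrite (_ : (fun x => _) =
      fun x => cRe (ifourier (fun xi => (c%:C)%C * fourier f xi) x)).
    exact: ifourier_Cn.
  by apply/funext => x; rewrite E !cpart/= !mul0r !subr0 mulrA mulVf// mul1r.
- rewrite (_ : (fun x => _) =
      fun x => cRe (ifourier (fun xi => (Complex 0 (- c)) * fourier f xi) x)).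
    exact: ifourier_Cn.
  apply/funext => x; rewrite E !cpart/= !mul0r addr0 sub0r mulNr opprK.
  by rewrite mulrA mulVf// mul1r.
Qed.

End Smoothness.

(** * Uniform limits and interpolation *)

Section GeometricLimits.
Context {R : realType}.

Lemma geometric_cvg0 (C : R) : C * 2 ^- n @[n --> \oo] --> (0 : R).
Proof.
have := @cvg_geometric R C 2^-1; rewrite ger0_norm// => /(_ _).
rewrite (_ : geometric C 2^-1 = fun n => C * 2 ^- n); last first.
  by apply/funext => n; rewrite /geometric/= exprVn.
by apply; rewrite invf_lt1// ltrDl.
Qed.

Lemma pow2_half (n : nat) : 2 ^- n.+1 = 2 ^- n / 2 :> R.
Proof. by rewrite exprS invfM mulrC. Qed.

Lemma pow2V_gt0 (n : nat) : 0 < 2 ^- n :> R.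
Proof. by rewrite invr_gt0 exprn_gt0. Qed.

(** Shifting [u n] down, respectively up, by the tail [2 C 2 ^- n] of the geometric
series gives a nondecreasing and a nonincreasing sequence enclosing the limit. *)
Lemma geometric_limit (u : nat -> R) (C : R) (N : nat) : 0 <= C ->
  (forall n, (N <= n)%N -> `|u n.+1 - u n| <= C * 2 ^- n) ->
  exists l, forall n, (N <= n)%N -> `|u n - l| <= 2 * C * 2 ^- n.
Proof.
move=> C0 H; pose v n := u n - 2 * C * 2 ^- n; pose a n := u n + 2 * C * 2 ^- n.
have E n : 2 * C * 2 ^- n = 2 * C * 2 ^- n.+1 + C * 2 ^- n.
  by rewrite pow2_half; field.
have vS n : (N <= n)%N -> v n <= v n.+1.
  move=> /H; rewrite ler_norml /v => /andP[h _]; have := E n; lra.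
have aS n : (N <= n)%N -> a n.+1 <= a n.
  move=> /H; rewrite ler_norml /a => /andP[_ h]; have := E n; lra.
have vm n k : (N <= n)%N -> v n <= v (n + k)%N.
  move=> Nn; elim: k => [|k IH]; first by rewrite addn0.
  by rewrite addnS (le_trans IH)// vS// (leq_trans Nn)// leq_addr.
have am n k : (N <= n)%N -> a (n + k)%N <= a n.
  move=> Nn; elim: k => [|k IH]; first by rewrite addn0.
  by rewrite addnS (le_trans _ IH)// aS// (leq_trans Nn)// leq_addr.
have va n : v n <= a n.
  by rewrite /v /a lerD2l (@le_trans _ _ 0)// ?oppr_le0 !mulr_ge0// ltW// pow2V_gt0.
have vam n m : (N <= n)%N -> (N <= m)%N -> v n <= a m.
  move=> Nn Nm; apply: le_trans (vm n m Nn) _; apply: le_trans (va _) _.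
  by rewrite addnC; exact: am.
pose S := [set v n | n in [set n | (N <= n)%N]].
have S0 : S !=set0 by exists (v N), N => /=.
exists (sup S) => n Nn; rewrite ler_distlC; apply/andP; split.
  apply: ub_le_sup; first by exists (a N) => _ [m Nm <-]; exact: vam.
  by exists n.
by apply: ge_sup => // _ [m Nm <-]; exact: vam.
Qed.

Lemma geometric_climit (u : nat -> R[i]) (C : R) (N : nat) : 0 <= C ->
  (forall n, (N <= n)%N -> cnorm (u n.+1 - u n) <= C * 2 ^- n) ->
  exists l, forall n, (N <= n)%N -> cnorm (u n - l) <= 4 * C * 2 ^- n.
Proof.
move=> C0 H.
have [|a Ha] := @geometric_limit (fun n => cRe (u n)) _ N C0.
  by move=> n /H h; rewrite -cReN -cReD (le_trans (cRe_le _)).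
have [|b Hb] := @geometric_limit (fun n => cIm (u n)) _ N C0.
  by move=> n /H h; rewrite -cImN -cImD (le_trans (cIm_le _)).
exists (Complex a b) => n Nn; rewrite (le_trans (cnorm_le _))// !cpart/=.
by have := Ha n Nn; have := Hb n Nn; lra.
Qed.

End GeometricLimits.

Section UniformLimits.
Context {R : realType} {d : nat}.
Notation lebd := (@leb R d).
Notation cmeas := (@cmeasurable R _ (mrV d)).
Notation cinteg := (@cintegrable R _ (mrV d) lebd).
Implicit Types f g h : 'rV[R]_d -> R[i].
Implicit Types Om K : set 'rV[R]_d.

Lemma ccontinuous_limit (u : nat -> 'rV[R]_d -> R[i]) f (C : R) (N : nat) :
  (forall n, ccontinuous (u n)) ->
  (forall n x, (N <= n)%N -> cnorm (u n x - f x) <= C * 2 ^- n) ->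
  ccontinuous f.
Proof.
move=> cu H.
have H' (r : R[i] -> R) : (forall a b, `|r a - r b| <= cnorm (a - b)) ->
    (forall n, continuous (fun x => r (u n x))) -> continuous (fun x => r (f x)).
  move=> rl cr x.
  have FF : ProperFilter (nbhs (x : 'rV[R]_d)) by exact: nbhs_pfilter.
  suff : r (f y) @[y --> x] --> r (f x) by [].
  apply/cvgrPdist_lt => e e0.
  have e3 : 0 < e / 3 by rewrite divr_gt0.
  have /cvgrPdist_lt /(_ _ e3) [M _ hM] := geometric_cvg0 C.
  pose n := maxn N M.
  have Cn : C * 2 ^- n < e / 3.
    have := hM n; rewrite /= leq_maxr sub0r normrN => /(_ isT).
    exact: le_lt_trans (ler_norm _).
  have : r (u n y) @[y --> x] --> r (u n x) by exact: cr.
  move=> /cvgrPdist_lt /(_ _ e3).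
  apply: filterS => y h.
  have h1 := le_lt_trans (le_trans (rl _ _) (H n y (leq_maxl _ _))) Cn.
  have h2 := le_lt_trans (le_trans (rl _ _) (H n x (leq_maxl _ _))) Cn.
  move: h h1 h2; rewrite !ltr_norml => /andP[? ?] /andP[? ?] /andP[? ?].
  by apply/andP; split; lra.
split.
- by apply: (H' (@complex.Re R)) => [a b|n]; [rewrite -cReN -cReD cRe_le|case: (cu n)].
- by apply: (H' (@complex.Im R)) => [a b|n]; [rewrite -cImN -cImD cIm_le|case: (cu n)].
Qed.

Lemma ccontinuousM f g : ccontinuous f -> ccontinuous g ->
  ccontinuous (fun x => f x * g x).
Proof.
move=> [f1 f2] [g1 g2]; split => x.
- under eq_fun do rewrite cReM.
  exact: cvgB (cvgM (f1 x) (g1 x)) (cvgM (f2 x) (g2 x)).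
- under eq_fun do rewrite cImM.
  exact: cvgD (cvgM (f1 x) (g2 x)) (cvgM (f2 x) (g1 x)).
Qed.

Lemma ccontinuous_cis (xi : 'rV[R]_d) : ccontinuous (fun x => cis (- dotp x xi)).
Proof.
have cd : continuous (fun x : 'rV[R]_d => - dotp x xi).
  by under eq_fun do rewrite -dotpNr; exact: continuous_dotp.
split => x.
- by apply: (continuous_comp (cd x)); exact: continuous_cos.
- by apply: (continuous_comp (cd x)); exact: continuous_sin.
Qed.

Lemma CcM Om f g : Cc Om f -> ccontinuous g -> Cc Om (fun x => f x * g x).
Proof.
move=> [cf ks sO] cg.
have ss : supp (fun x => f x * g x) `<=` supp f.
  by apply: closure_subset => x /=; apply: contra_neq => ->; rewrite mul0r.
split; first exact: ccontinuousM.
  by apply: subclosed_compact ks ss; exact: closed_closure.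
exact: subset_trans ss sO.
Qed.

Lemma Cc_vanishing Om K f : compact K -> K `<=` Om -> ccontinuous f ->
  (forall x, ~ K x -> f x = 0) -> Cc Om f.
Proof.
move=> cK KO cf f0.
have clK : closed K by apply: compact_closed cK; exact: norm_hausdorff.
have ss : supp f `<=` K.
  apply: (subset_trans _ clK); apply: closure_subset => x /= fx.
  by apply: contrapT => /f0 h; rewrite h eqxx in fx.
split => //; last exact: subset_trans KO.
by apply: subclosed_compact cK ss; exact: closed_closure.
Qed.

Lemma Cc_eq0 Om f x : Cc Om f -> ~ Om x -> f x = 0.
Proof.
move=> [_ _ sO] nO; apply/eqP/negPn/negP => fx; apply: nO; apply: sO.
exact: subset_closure.
Qed.

(** The constant is the volume of the cube. *)
Lemma fourier_le (r : R) : exists2 c : R, 0 <= c & forall h (M : R), bcs h ->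
  (forall x, cnorm (h x) <= M) -> (forall x, h x != 0 -> cube r x) ->
  forall xi, cnorm (fourier h xi) <= M * c.
Proof.
have lE : leb d (cube r) = (fine (leb d (cube r)))%:E.
  by rewrite fineK// ge0_fin_numE// leb_cube_fin.
exists (fine (leb d (cube r))); first exact: fine_ge0.
move=> h M bh hM hr xi.
have M0 : 0 <= M := le_trans (cnorm_ge0 (h 0)) (hM 0).
have [hi ->] := fourier_integrable xi bh.
rewrite -lee_fin; apply: le_trans (cnorm_cint hi) _.
have mc : measurable (cube r : set (mrV d)) by exact: measurable_cube.
rewrite EFinM -lE -integral_cst// [leRHS]integral_mkcond.
apply: ge0_le_integral => //.
- by move=> x _; rewrite lee_fin cnorm_ge0.
- by apply/measurable_EFinP; apply: cmeasurable_norm; case/cintegrableP: hi.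
- by apply/(measurable_restrictT _ _).1 => //; exact: measurable_cst.
- move=> x _; rewrite patchE; case: ifPn => [_|].
    by rewrite lee_fin Normc.normcM cnorm_cis mulr1.
  rewrite notin_setE => nc; rewrite lee_fin Normc.normcM cnorm_cis mulr1.
  have [->|/hr//] := eqVneq (h x) 0; by rewrite cnorm0.
Qed.

Lemma wnorm_triangle s l f g h : subadditive_weight s ->
  bcs f -> bcs g -> bcs h ->
  (forall xi, cnorm (fourier h xi) <= cnorm (fourier f xi) + cnorm (fourier g xi)) ->
  (wnorm s l h <= wnorm s l f + wnorm s l g)%E.
Proof.
move=> ss bf bg bh H; rewrite !wnormE// -ge0_integralD//; last 4 first.
- by move=> xi _; rewrite lee_fin mulr_ge0 ?cnorm_ge0 ?expR_ge0.
- by apply/measurable_EFinP; exact: measurable_weighted.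
- by move=> xi _; rewrite lee_fin mulr_ge0 ?cnorm_ge0 ?expR_ge0.
- by apply/measurable_EFinP; exact: measurable_weighted.
apply: ge0_le_integral => //.
- by move=> xi _; rewrite lee_fin mulr_ge0 ?cnorm_ge0 ?expR_ge0.
- by apply/measurable_EFinP; exact: measurable_weighted.
- by apply: emeasurable_funD; apply/measurable_EFinP; exact: measurable_weighted.
- by move=> xi _; rewrite -EFinD lee_fin -mulrDl ler_wpM2r ?expR_ge0.
Qed.

Lemma wnorm_le_sub s l f g : subadditive_weight s -> bcs f -> bcs g ->
  (wnorm s l g <= wnorm s l f + wnorm s l (fun x => (g x - f x)%R))%E.
Proof.
move=> ss bf bg; apply: wnorm_triangle => // [|xi]; first exact: bcsB.
rewrite fourierB//; apply: le_trans (cnormD _ _).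
by rewrite addrC subrK.
Qed.

Lemma wnorm_sub_le s l f g : subadditive_weight s -> bcs f -> bcs g ->
  (wnorm s l (fun x => (g x - f x)%R) <= wnorm s l g + wnorm s l f)%E.
Proof.
move=> ss bf bg; apply: wnorm_triangle => // [|xi]; first exact: bcsB.
by rewrite fourierB//; apply: le_trans (cnormD _ _) _; rewrite cnormN.
Qed.

Lemma wnorm_fatou s l (u : nat -> 'rV[R]_d -> R[i]) f (B : R) (N : nat) :
  subadditive_weight s -> bcs f -> (forall n, bcs (u n)) ->
  (forall xi, cnorm (fourier (u n) xi - fourier f xi) @[n --> \oo] --> 0) ->
  (forall n, (N <= n)%N -> (wnorm s l (u n) <= B%:E)%E) ->
  (wnorm s l f <= B%:E)%E.
Proof.
move=> ss bf bu uf uB.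
pose F n xi := (cnorm (fourier (u n) xi) * expR (l * s (euclidean_norm xi)))%:E.
have mF n : measurable_fun setT (F n : mrV d -> \bar R).
  by apply/measurable_EFinP; exact: measurable_weighted.
have F0 n (xi : mrV d) : setT xi -> (0 <= F n xi)%E.
  by move=> _; rewrite lee_fin mulr_ge0 ?cnorm_ge0 ?expR_ge0.
have cF xi : F n xi @[n --> \oo] -->
    (cnorm (fourier f xi) * expR (l * s (euclidean_norm xi)))%:E.
  apply: cvg_EFin; first by apply: nearW.
  apply: cvgM; last exact: cvg_cst.
  apply/cvgrPdist_lt => e e0; have /cvgrPdist_lt /(_ e e0) := uf xi.
  apply: filterS => n; rewrite sub0r normrN => /(le_lt_trans (ler_norm _)).
  apply: le_lt_trans; set a := fourier f xi; set b := fourier (u n) xi.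
  have := cnormD (b - a) a; have := cnormD (a - b) b; rewrite !subrK (cnormB a b).
  move=> h1 h2; rewrite ler_norml; apply/andP; split; lra.
have := fatou lebd measurableT mF F0.
rewrite wnormE// => fat.
have -> : (\int[lebd]_xi (cnorm (fourier f xi) *
     expR (l * s (euclidean_norm (xi : 'rV[R]_d))))%:E =
   \int[lebd]_xi limn_einf (F ^~ xi))%E.
  apply: eq_integral => xi _; apply/esym.
  have c := cF xi; rewrite is_cvg_limn_einfE; last exact: cvgP c.
  exact: cvg_lim c.
apply: le_trans fat _; rewrite limn_einf_lim.
apply: lime_le; first exact: is_cvg_einfs.
near=> n; apply: (@le_trans _ _ (\int[lebd]_xi F n xi)%E).
  by apply: ereal_inf_lbound; exists n => /=.
rewrite -(wnormE l ss (bu n)); apply: uB; near: n; exact: nbhs_infty_ge.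
Unshelve. all: by end_near. Qed.

(** With [A] the transform of [f] in modulus, the hypothesis gives
[(A e^s)^2 <= b^2 A e^(3 s) = b^2 (A e^(4 s)) e^(-s)], and the geometric mean of
the last two factors is at most their sum.  The weight [4 s] leaves the
integrable factor [e^(-s)]. *)
Lemma wnorm_interpolation s f (b : R) : weight s -> bcs f -> 0 <= b ->
  (forall xi, cnorm (fourier f xi) <= b ^+ 2 * expR (s (euclidean_norm xi))) ->
  (wnorm s 1 f <= b%:E * (wnorm (fun t => (4 * s t)%R) 1 f +
     \int[lebd]_xi (expR (- s (euclidean_norm (xi : 'rV[R]_d))))%:E))%E.
Proof.
move=> ws bf b0 H; have ss := weight_subadditive_weight ws.
have s4 : subadditive_weight (fun t => 4 * s t).
  exact: subadditive_weight_scale.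
have mE : measurable_fun setT (fun xi : mrV d => (expR (- s (euclidean_norm (xi : 'rV[R]_d))))%:E).
  have /integrableP[] := @integrable_exp_weight R d s ws.
  by [].
have mW l v : subadditive_weight v -> measurable_fun setT (fun xi : mrV d =>
    (cnorm (fourier f xi) * expR (l * v (euclidean_norm (xi : 'rV[R]_d))))%:E).
  by move=> sv; apply/measurable_EFinP; exact: measurable_weighted.
have W0 l v (xi : mrV d) : setT xi ->
    (0 <= (cnorm (fourier f xi) * expR (l * v (euclidean_norm (xi : 'rV[R]_d))))%:E)%E.
  by move=> _; rewrite lee_fin mulr_ge0 ?cnorm_ge0 ?expR_ge0.
rewrite (wnormE 1 ss bf) (wnormE 1 s4 bf).
rewrite -ge0_integralD//; last 2 first.
- by move=> xi _; rewrite lee_fin mulr_ge0 ?cnorm_ge0 ?expR_ge0.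
- exact: (mW 1 _ s4).
rewrite -ge0_integralZl_EFin//; last 2 first.
- by move=> xi _; rewrite adde_ge0// lee_fin ?expR_ge0// mulr_ge0 ?cnorm_ge0 ?expR_ge0.
- by apply: emeasurable_funD => //; exact: (mW 1 _ s4).
apply: ge0_le_integral => //.
- exact: (W0 1 s).
- exact: (mW 1 s ss).
- by apply: measurable_funeM; apply: emeasurable_funD => //; exact: (mW 1 _ s4).
move=> xi _; rewrite -EFinD -EFinM lee_fin !mul1r.
have := H xi; have := cnorm_ge0 (fourier f xi).
set x := cnorm _; set t := s _ => x0 xb.
rewrite -ler_sqr ?nnegrE ?mulr_ge0 ?addr_ge0 ?mulr_ge0 ?expR_ge0//.
have q0 : 0 < expR t by exact: expR_gt0.
have -> : expR (4 * t) = expR t ^+ 4 by rewrite -expRM_natl.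
rewrite expRN; move: q0 xb; set q := expR t => q0 xb.
apply: (@le_trans _ _ (b ^+ 2 * ((x * q ^+ 4) * q^-1))).
  rewrite (_ : (x * q) ^+ 2 = x * (x * q ^+ 2)); last by ring.
  rewrite (_ : b ^+ 2 * _ = x * (b ^+ 2 * q * q ^+ 2)); last first.
    by field; rewrite gt_eqF.
  by rewrite ler_wpM2l// ler_wpM2r// exprn_ge0// ltW.
rewrite exprMn ler_wpM2l ?sqr_ge0//.
have : 0 <= x * q ^+ 4 by rewrite mulr_ge0// exprn_ge0// ltW.
have : 0 <= q^-1 by rewrite invr_ge0 ltW.
move: (x * q ^+ 4) q^-1 => A e e0 A0.
rewrite sqrrD -subr_ge0 (_ : _ - _ = A ^+ 2 + A * e + e ^+ 2); last by ring.
by rewrite !addr_ge0 ?sqr_ge0 ?mulr_ge0.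
Qed.

End UniformLimits.

(** * Rapidly converging sequences in a Roumieu class *)

Section RoumieuLimits.
Context {R : realType} {d : nat}.
Notation lebd := (@leb R d).
Implicit Types (f g h chi : 'rV[R]_d -> R[i]) (u : nat -> 'rV[R]_d -> R[i]).
Implicit Types (Om K : set 'rV[R]_d) (s w : R -> R).

Lemma near0_dyadic (P : R -> Prop) : (\forall e \near 0^'+, P e) ->
  exists N, forall n, (N <= n)%N -> P (2 ^- n.+1).
Proof.
move=> [e /= e0 H].
have /cvgrPdist_lt /(_ _ e0) [N _ hN] := @geometric_cvg0 R 1.
exists N => n Nn; have := hN n.+1 (leqW Nn).
rewrite sub0r mul1r => h; apply: H; last exact: pow2V_gt0.
by rewrite /ball/= sub0r.
Qed.

Lemma near_pinfty_dyadic (P : R -> Prop) : (\forall t \near +oo, P t) ->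
  exists N, forall n, (N <= n)%N -> P (2 ^+ n.+1).
Proof.
move=> /near_pinfty_le[t t0 H].
exists (Num.truncn t) => n tn; apply: H; apply: ltW.
apply: lt_le_trans (truncnS_gt t) _; rewrite -natrX ler_nat.
by apply: leq_ltn_trans tn _; exact: ltn_trans (ltnSn n) (ltn_expl _ _).
Qed.

Lemma ccontinuousB f g : ccontinuous f -> ccontinuous g ->
  ccontinuous (fun x => f x - g x).
Proof.
move=> [f1 f2] [g1 g2]; split => x.
- under eq_fun do rewrite cReD cReN.
  exact: cvgB (f1 x) (g1 x).
- under eq_fun do rewrite cImD cImN.
  exact: cvgB (f2 x) (g2 x).
Qed.

Lemma Droumieu_Cc w Om f : Droumieu w Om f -> Cc Om f.
Proof. by case=> l _ []. Qed.

Lemma Droumieu_bcs w Om f : Droumieu w Om f -> bcs f.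
Proof. by move/Droumieu_Cc/Cc_bcs. Qed.

Lemma Droumieu_wnorm w Om s f : weight w -> weight s -> weight_ll s w ->
  Droumieu w Om f -> (wnorm s 1 f < +oo)%E.
Proof.
move=> ww ws sw [l l0 [/Cc_bcs bf fin]].
exact: (wnorm_weight_ll ws ww sw l0 bf fin).
Qed.

(** Interpolation with [b ^ 2 = A e^(-wb)] at [2 ^ n.+1]: the factor [e^(-wb / 2)]
beats the norms of [u n] and [u n.+1], because subadditivity bounds [winf] at
[2 ^ n.+2] by twice its value at [2 ^ n.+1], hence by [wb / 4] there. *)
Lemma increments_geometric (winf wb s : R -> R) u (A : R) (N M : nat) :
  weight winf -> weight wb -> weight_ll winf wb -> weight s ->
  (forall n, bcs (u n)) -> 0 <= A ->
  (forall n, (N <= n)%N -> forall xi,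
     cnorm (fourier (fun x => u n.+1 x - u n x) xi) <=
     A * expR (- wb (2 ^+ n.+1)) * expR (s (euclidean_norm xi))) ->
  (forall n, (M <= n)%N -> (wnorm (fun t => (4 * s t)%R) 1 (u n) <=
     (expR (winf (2 ^+ n.+1)))%:E)%E) ->
  exists2 C : R, 0 <= C & exists N', forall n, (N' <= n)%N ->
    (wnorm s 1 (fun x => (u n.+1 x - u n x)%R) <= (C * 2 ^- n)%:E)%E.
Proof.
move=> wi wwb ib ws bu A0 HA HM.
have c8 : 0 < 8^-1 :> R by rewrite invr_gt0.
have [N1 H1] := near_pinfty_dyadic (ib _ c8).
have [N2 H2] := near_pinfty_dyadic (weight_growth wwb 4).
have Jint := @integrable_exp_weight R d s ws.
have [J JE] : exists J : R,
    (\int[lebd]_xi (expR (- s (euclidean_norm (xi : 'rV[R]_d))))%:E = J%:E)%E.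
  exists (fine (\int[lebd]_xi (expR (- s (euclidean_norm (xi : 'rV[R]_d))))%:E)).
  by rewrite fineK// integrable_fin_num.
have J0 : 0 <= J.
  by rewrite -lee_fin -JE; apply: integral_ge0 => xi _; rewrite lee_fin expR_ge0.
have s4 : subadditive_weight (fun t => 4 * s t).
  by apply: subadditive_weight_scale => //; exact: weight_subadditive_weight.
exists (Num.sqrt A * (2 + J)); first by rewrite mulr_ge0 ?sqrtr_ge0// addr_ge0.
exists (maxn (maxn N M) (maxn N1 N2)) => n; rewrite !geq_max => /andP[/andP[nN nM] /andP[n1 n2]].
set t : R := 2 ^+ n.+1.
have t0 : 0 < t by exact: exprn_gt0.
have it : winf t <= wb t / 8.
  have := H1 n n1; rewrite -/t !ger0_norm ?(weight_ge0 wi) ?(weight_ge0 wwb) ?(ltW t0)//.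
  by rewrite mulrC.
have it2 : winf (2 * t) <= wb t / 4.
  have := weight_subadditive wi (ltW t0) (ltW t0).
  by rewrite (_ : t + t = 2 * t); [lra|ring].
have b0 : 0 <= wb t by rewrite (weight_ge0 wwb) ?ltW.
pose q := expR (wb t / 4).
have q0 : 0 < q by exact: expR_gt0.
have q1 : 1 <= q by rewrite -expR0 ler_expR divr_ge0.
pose b := Num.sqrt A * q ^- 2.
have b2 : b ^+ 2 = A * expR (- wb t).
  rewrite exprMn sqr_sqrtr// -exprVn -exprM -expRN -expRM_natl; congr (_ * expR _).
  by rewrite natrM; field.
have := wnorm_interpolation (b := b) ws (bcsB (bu n.+1) (bu n)).
have bg0 : 0 <= b by rewrite mulr_ge0 ?sqrtr_ge0// invr_ge0 exprn_ge0// ltW.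
move=> /(_ bg0); rewrite b2 => /(_ (HA n nN)) /le_trans; apply.
apply: (@le_trans _ _ (b%:E * ((q + q)%:E + (J * q)%:E))%E).
  rewrite lee_wpmul2l ?lee_fin//; apply: leeD; last first.
    by rewrite JE lee_fin ler_peMr.
  apply: le_trans (wnorm_sub_le 1 s4 (bu n) (bu n.+1)) _; rewrite EFinD; apply: leeD.
    apply: le_trans (HM n.+1 (leqW nM)) _; rewrite lee_fin ler_expR exprS.
    exact: it2.
  apply: le_trans (HM n nM) _; rewrite lee_fin ler_expR.
  by apply: le_trans it _; rewrite ler_wpM2l//; lra.
rewrite -EFinD -EFinM lee_fin.
rewrite (_ : b * _ = Num.sqrt A * (2 + J) * q^-1); last first.
  by rewrite /b; field; rewrite gt_eqF.
rewrite ler_wpM2l ?mulr_ge0 ?sqrtr_ge0 ?addr_ge0//.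
rewrite lef_pV2 ?posrE ?exprn_gt0//.
apply: (@le_trans _ _ (1 + t)).
  by rewrite /t exprS; have : 0 <= (2 : R) ^+ n by []; lra.
have p : 0 < 1 + t by rewrite addr_gt0.
rewrite -[leLHS](lnK (x := 1 + t)) ?posrE// ler_expR.
by rewrite ler_pdivlMr// mulrC; exact: H2.
Qed.

(** The constants may depend on the weight [s], but the limit does not: one weight
provides uniform convergence, and each of them then bounds its own norm of the
limit by Fatou's lemma. *)
Lemma roumieu_limit w Om K u : weight w -> compact K -> K `<=` Om ->
  (forall n, Droumieu w Om (u n)) -> (forall n x, ~ K x -> u n x = 0) ->
  (forall s, weight s -> weight_ll s w -> exists2 C : R, 0 <= C &
     exists N, forall n, (N <= n)%N ->
       (wnorm s 1 (fun x => (u n.+1 x - u n x)%R) <= (C * 2 ^- n)%:E)%E) ->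
  exists2 f, Droumieu w Om f & exists2 C : R, 0 <= C & exists N,
    forall n, (N <= n)%N -> forall x, cnorm (u n x - f x) <= C * 2 ^- n.
Proof.
move=> ww cK KO Du u0 H.
have bu n := Droumieu_bcs (Du n).
have cu n : ccontinuous (u n) by have [] := Droumieu_Cc (Du n).
have bD n := bcsB (bu n.+1) (bu n).
have [s [ws sw _]] := weight_below ww (fun=> 0).
have [C C0 [N HN]] := H s ws sw.
have ss := weight_subadditive_weight ws.
pose c : R := (2 * pi) ^+ d.
have c0 : 0 < c by rewrite exprn_gt0// mulr_gt0// pi_gt0.
have Dle n x : (N <= n)%N -> cnorm (u n.+1 x - u n x) <= c^-1 * C * 2 ^- n.
  move=> Nn; have le1 := le_trans (wnorm_ge_fourier ss (bD n) ler01) (HN n Nn).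
  have := fourier_sup (le_lt_trans le1 (ltry _)) (bD n) (ccontinuousB (cu n.+1) (cu n)) x.
  move=> /le_trans /(_ le1); rewrite lee_fin -/c -mulrA -ler_pdivlMl ?invr_gt0// invrK.
have C1 : 0 <= c^-1 * C by rewrite mulr_ge0// invr_ge0 ltW.
pose C' := 4 * (c^-1 * C).
have ex x : exists l : R[i], forall n, (N <= n)%N -> cnorm (u n x - l) <= C' * 2 ^- n.
  exact: (geometric_climit C1 (fun n => @Dle n x)).
have /choice[f Hf] := ex.
have C'0 : 0 <= C' by rewrite mulr_ge0.
have cf : ccontinuous f.
  exact: (ccontinuous_limit cu (fun n x => Hf x n)).
have f0 x : ~ K x -> f x = 0.
  move=> nK; apply: cnorm_eq0; apply/eqP; rewrite eq_le cnorm_ge0 andbT.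
  have L := @geometric_cvg0 R C'.
  apply: (cvgr_to_ge L); near=> n; rewrite -cnormN -[- f x]add0r -(u0 n x nK).
  by apply: Hf; near: n; exact: nbhs_infty_ge.
have Cf : Cc Om f by exact: Cc_vanishing cK KO cf f0.
have bf := Cc_bcs Cf.
have [r Kr] := compact_cube cK; have [a a0 fle] := @fourier_le R d r.
have Hfourier xi : cnorm (fourier (u n) xi - fourier f xi) @[n --> \oo] --> 0.
  have L := @geometric_cvg0 R (C' * a).
  apply: squeeze_cvgr (cvg_cst 0) L; near=> n.
  apply/andP; split; first exact: cnorm_ge0.
  have Efb := fourierB xi (bu n) bf.
  apply: (@le_trans _ _ (cnorm (fourier (fun x => u n x - f x) xi))).
    by rewrite Efb lexx.
  rewrite mulrAC; apply: fle; first exact: bcsB.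
    by move=> x; apply: Hf; near: n; exact: nbhs_infty_ge.
  move=> x nz; apply: Kr; apply: contrapT => nK.
  by rewrite u0// f0// subrr eqxx in nz.
exists f; last by exists C' => //; exists N => n Nn x; exact: Hf.
have [|l l0 fin] := roumieu_of_beurling ww bf; last by exists l.
move=> v wv vw; have [B B0 [M HM]] := H v wv vw.
have sv := weight_subadditive_weight wv.
have [b bE] : exists b : R, (wnorm v 1 (u M) = b%:E)%E.
  exists (fine (wnorm v 1 (u M))); rewrite fineK// ge0_fin_numE ?wnorm_ge0//.
  exact: Droumieu_wnorm (Du M).
have bnd k : (wnorm v 1 (u (M + k)%N) <= (b + 2 * B * 2 ^- M - 2 * B * 2 ^- (M + k))%:E)%E.
  elim: k => [|k IH]; first by rewrite addn0 addrK bE.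
  rewrite addnS; apply: le_trans (wnorm_le_sub 1 sv (bu (M + k)%N) (bu (M + k).+1)) _.
  apply: le_trans (leeD IH (HM (M + k)%N (leq_addr _ _))) _.
  by rewrite -EFinD lee_fin pow2_half; lra.
apply: le_lt_trans (ltry (b + 2 * B * 2 ^- M)).
apply: (wnorm_fatou (N := M) sv bf bu Hfourier) => n Mn.
rewrite -(subnKC Mn); apply: le_trans (bnd _) _; rewrite lee_fin gerDl oppr_le0.
by rewrite !mulr_ge0// ltW// pow2V_gt0.
Unshelve. all: by end_near. Qed.

Lemma Droumieu_Eroumieu w Om f : weight w -> Droumieu w Om f -> Eroumieu w Om f.
Proof.
move=> ww Df; have sw := weight_subadditive_weight ww; split.
  have [s [ws sl _]] := weight_below ww (fun=> 0).
  exact: (csmooth_of_wnorm Om ws (Droumieu_Cc Df) (Droumieu_wnorm ww ws sl Df)).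
move=> psi Dpsi; have [l l0 [Cf ffin]] := Df; have [m m0 [Cp pfin]] := Dpsi.
have bf := Cc_bcs Cf; have bp := Cc_bcs Cp.
have n0 : 0 < Num.min l m by rewrite lt_min l0 m0.
exists (Num.min l m) => //; split; first by apply: CcM Cp _; case: Cf.
have cp : ccontinuous psi by case: Cp.
apply: (wnormM sw (ltW n0) bp cp bf).
- by apply: le_lt_trans pfin; apply: wnorm_le_l => //; rewrite ge_min lexx orbT.
- by apply: le_lt_trans ffin; apply: wnorm_le_l => //; rewrite ge_min lexx.
Qed.

End RoumieuLimits.

(** * Strong association and regularity *)

Section Cutoffs.
Context {R : realType} {d : nat}.
Notation lebd := (@leb R d).
Implicit Types (f g h chi psi : 'rV[R]_d -> R[i]).
Implicit Types (Om K : set 'rV[R]_d) (s w : R -> R).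

Definition cutoff w Om K psi := Droumieu w Om psi /\ forall x, K x -> psi x = 1.

Lemma cutoff_exists w Om s K l f : (lnorm w Om s K l f < +oo)%E ->
  exists psi, cutoff w Om K psi.
Proof. by move=> /ereal_inf_lt[_ [psi psiK _] _]; exists psi. Qed.

Lemma vanishing_outside Om K f : supp_in Om f `<=` K° ->
  forall x, Om x -> ~ K x -> f x = 0.
Proof.
move=> sK x Ox nK; apply/eqP/negPn/negP => fx; apply: nK.
by apply: interior_subset; apply: sK; split => //; apply: subset_closure.
Qed.

Lemma cutoff_mul_eq w Om K chi psi f : cutoff w Om K chi -> cutoff w Om K psi ->
  (forall x, Om x -> ~ K x -> f x = 0) ->
  (fun x => psi x * f x) = (fun x => chi x * f x).
Proof.
move=> [/Droumieu_Cc Dc c1] [/Droumieu_Cc Dp p1] f0; apply/funext => x.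
have [Ox|nO] := pselect (Om x); last by rewrite (Cc_eq0 Dc nO) (Cc_eq0 Dp nO).
have [Kx|nK] := pselect (K x); first by rewrite c1// p1.
by rewrite f0// !mulr0.
Qed.

Lemma cutoff_mul_eq0 w Om K chi f : cutoff w Om K chi ->
  (forall x, Om x -> ~ K x -> f x = 0) -> forall x, ~ K x -> chi x * f x = 0.
Proof.
move=> [/Droumieu_Cc Dc _] f0 x nK; have [Ox|nO] := pselect (Om x).
  by rewrite f0// mulr0.
by rewrite (Cc_eq0 Dc nO) mul0r.
Qed.

(** For a function vanishing on [Om] off [K] the infimum defining [lnorm] is over
a single value. *)
Lemma wnorm_cutoff w Om K s l chi f : cutoff w Om K chi ->
  (forall x, Om x -> ~ K x -> f x = 0) ->
  (wnorm s l (fun x => (chi x * f x)%R) <= lnorm w Om s K l f)%E.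
Proof.
move=> cc f0; apply: le_ereal_inf_tmp => _ [psi psiK <-].
by rewrite (cutoff_mul_eq cc psiK f0).
Qed.

Lemma lnorm_le_cutoff w Om K s l chi f : cutoff w Om K chi ->
  (lnorm w Om s K l f <= wnorm s l (fun x => (chi x * f x)%R))%E.
Proof. by move=> cc; apply: ereal_inf_lbound; exists chi. Qed.

(** Tested on [chi(x) e^(-i x xi)], the pairing with [h] is the transform of
[chi h] at [xi], and the second factor [chi] needed to estimate [lnorm] leaves a
modulation of the fixed function [chi ^ 2].  The common value [T2 rho]
cancels. *)
Lemma fourier_sub_cutoff_le w Om K s chi (T2 : ('rV[R]_d -> R[i]) -> R[i]) h1 h2 (E : R) :
  weight w -> weight s -> weight_ll s w -> cutoff w Om K chi ->
  bcs (fun x => chi x * h1 x) -> bcs (fun x => chi x * h2 x) -> 0 <= E ->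
  (forall rho, Dbanach s 1 Om rho ->
     ((cnorm (T2 rho - pairing h1 rho))%:E <= E%:E * lnorm w Om s K 1 rho)%E) ->
  (forall rho, Dbanach s 1 Om rho ->
     ((cnorm (T2 rho - pairing h2 rho))%:E <= E%:E * lnorm w Om s K 1 rho)%E) ->
  forall xi, cnorm (fourier (fun x => chi x * h2 x - chi x * h1 x) xi) <=
    2 * E * fine (wnorm s 1 (fun x => chi x * chi x)) * expR (s (euclidean_norm xi)).
Proof.
move=> ww ws sw cc b1 b2 E0 H1 H2 xi; have [Dc _] := cc.
have ss := weight_subadditive_weight ws.
have bc := Droumieu_bcs Dc; have Cc_ := Droumieu_Cc Dc.
have ccc : ccontinuous chi by case: Cc_.
have fc := Droumieu_wnorm ww ws sw Dc.
have bcc := bcsMM bc bc.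
have fcc := wnormM ss ler01 bc ccc bc fc fc.
pose rho x := chi x * cis (- dotp x xi).
have Drho : Dbanach s 1 Om rho.
  split; first by apply: CcM => //; exact: ccontinuous_cis.
  apply: le_lt_trans (wnorm_modulation xi ss bc) _.
  by rewrite lte_mul_pinfty ?lee_fin ?expR_ge0.
have pE h : pairing h rho = fourier (fun x => chi x * h x) xi.
  rewrite /pairing /fourier; congr cintegral_rV; apply/funext => x.
  rewrite /rho /cis cosN sinN.
  by rewrite mulrA; congr (_ * _); exact: mulrC.
have lr : (lnorm w Om s K 1 rho <=
    (expR (s (euclidean_norm xi)) * fine (wnorm s 1 (fun x => chi x * chi x)%R))%:E)%E.
  apply: le_trans (lnorm_le_cutoff s 1 rho cc) _.
  rewrite (_ : (fun x => _) = fun x => (chi x * chi x) * cis (- dotp x xi)); last first.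
    by apply/funext => x; exact: mulrA.
  apply: le_trans (wnorm_modulation xi ss bcc) _.
  by rewrite EFinM fineK// ge0_fin_numE// wnorm_ge0.
have B h : (forall rho, Dbanach s 1 Om rho ->
     ((cnorm (T2 rho - pairing h rho))%:E <= E%:E * lnorm w Om s K 1 rho)%E) ->
   cnorm (T2 rho - fourier (fun x => chi x * h x) xi) <=
     E * (expR (s (euclidean_norm xi)) * fine (wnorm s 1 (fun x => chi x * chi x))).
  move=> /(_ rho Drho); rewrite pE => /le_trans H.
  rewrite -lee_fin EFinM; apply: H.
  by apply: lee_wpmul2l => //; rewrite lee_fin.
have B1 := B _ H1; have B2 := B _ H2.
have Ef := fourierB xi b2 b1.
apply: (@le_trans _ _ (cnorm (T2 rho - fourier (fun x => chi x * h1 x) xi) +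
   cnorm (T2 rho - fourier (fun x => chi x * h2 x) xi))).
  rewrite Ef -(cnormN (T2 rho - fourier (fun x => chi x * h2 x) xi)).
  apply: le_trans (cnormD _ _).
  move: (T2 rho) (fourier _ _) (fourier _ _) => a b c.
  have Eabc : c - b = a - b + - (a - c) by ring.
  by rewrite Eabc lexx.
apply: le_trans (lerD B1 B2) _.
rewrite le_eqVlt; apply/orP; left; apply/eqP.
by move: (fine _) (expR _) => p q; ring.
Qed.

Lemma pairing_sub_le r : exists2 c : R, 0 <= c & forall f g phi (M N : R),
  bcs f -> bcs g -> bcs phi -> (forall x, cnorm (f x - g x) <= M) ->
  (forall x, cnorm (phi x) <= N) -> (forall x, phi x != 0 -> cube r x) ->
  cnorm (pairing f phi - pairing g phi) <= M * N * c.
Proof.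
have [c c0 H] := @fourier_le R d r; exists c => // f g phi M N bf bg bp fg pN pr.
have pE h : pairing h phi = fourier (fun x => h x * phi x) 0.
  rewrite /pairing /fourier; congr cintegral_rV; apply/funext => x.
  rewrite (_ : dotp x 0 = 0); last by rewrite /dotp big1// => i _; rewrite mxE mulr0.
  rewrite (_ : Complex _ _ = 1) ?mulr1//.
  by apply: cplx_ext; rewrite /= ?cos0 ?sin0 ?oppr0.
have E := fourierB 0 (bcsMM bf bp) (bcsMM bg bp).
rewrite !pE -E; apply: H.
- exact: bcsB (bcsMM bf bp) (bcsMM bg bp).
- by move=> x; rewrite -mulrBl Normc.normcM ler_pM ?cnorm_ge0.
- by move=> x h; apply: pr; apply: contra_neq h => ->; rewrite !mulr0 subrr.
Qed.

End Cutoffs.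

Theorem theorem7p5 (R : realType) (d : nat) (Om : set 'rV[R]_d) (w : R -> R)
    (T : ('rV[R]_d -> R[i]) -> R[i])
    (G : set (R -> 'rV[R]_d -> R[i])) (g : R -> 'rV[R]_d -> R[i])
    (K : set 'rV[R]_d) (winf : R -> R)
    (Om_open : open Om) (w_weight : weight w)
    (T_dual : ultradistribution w Om T)
    (G_regular : regular_gfun w Om G) (gG : represents w Om g G)
    (K_compact : compact K) (K_Om : K `<=` Om)
    (T_supp : supp_dual w Om T `<=` K°)
    (g_supp : forall e : R, 0 < e < 1 -> supp_in Om (g e) `<=` K°)
    (winf_weight : weight winf)
    (g_bound : forall w' : R -> R, weight w' -> weight_ll w' w ->
       elittleo0 (fun e => lnorm w Om w' K 1 (g e))
                 (fun e => expR (winf e^-1)))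
    (T_assoc : exists2 e0 : R, 0 < e0 <= 1 &
       exists2 wb : R -> R, weight wb /\ weight_ll winf wb &
         strong_association w Om K T g e0 wb) :
  roumieu_regular w Om T.
Proof.
have [[gE gM] _] := gG; have [e0 /andP[e00 e01] [wb [wwb ib] assoc]] := T_assoc.
have [l l0 ml] := gM K K_compact K_Om 1 ltr01.
have [N0 hN0] := near0_dyadic (ml 1 ltr01).
(* Moderateness makes one [lnorm] finite, so the set of cutoffs is not empty. *)
have [chi cc] := cutoff_exists (le_lt_trans (hN0 N0 (leqnn _)) (ltry _)).
(* The successor keeps [e 0] below 1. *)
pose e n : R := 2 ^- n.+1.
have e_gt0 n : 0 < e n by exact: pow2V_gt0.
have e_lt1 n : e n < 1.
  by rewrite invf_lt1 ?exprn_gt0// exprn_egt1// ltr1n.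
have e_in n : 0 < e n < 1 by rewrite e_gt0 e_lt1.
have eV n : (e n)^-1 = 2 ^+ n.+1 by rewrite invrK.
have gv n := vanishing_outside (g_supp (e n) (e_in n)).
pose u n x := chi x * g (e n) x.
have Du n : Droumieu w Om (u n).
  by have [_] := gE (e n) (e_in n); apply; case: cc.
have bu n := Droumieu_bcs (Du n).
have u0 n x : ~ K x -> u n x = 0 by exact: cutoff_mul_eq0 cc (gv n) x.
have [N1 hN1] : exists N, forall n, (N <= n)%N -> e n < e0.
  by apply: (near0_dyadic (P := fun t => t < e0)); exact: nbhs_right_lt.
have incr s : weight s -> weight_ll s w -> exists2 C : R, 0 <= C &
     exists N, forall n, (N <= n)%N ->
       (wnorm s 1 (fun x => (u n.+1 x - u n x)%R) <= (C * 2 ^- n)%:E)%E.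
  move=> ws sw; have [T2 _ [C C0 HC]] := assoc s ws sw.
  have [w4 w4w] := weight_scale (ltr0Sn _ 3 : 0 < 4 :> R) ws sw.
  have [N2 hN2] := near0_dyadic (g_bound _ w4 w4w 1 ltr01).
  pose A := 2 * C * fine (wnorm s 1 (fun x => chi x * chi x)).
  have A0 : 0 <= A.
    rewrite mulr_ge0 ?mulr_ge0 ?(ltW C0)// fine_ge0//.
    have bc : bcs chi by case: cc => /Droumieu_bcs.
    by apply: wnorm_ge0; [exact: weight_subadditive_weight|exact: bcsMM].
  apply: (increments_geometric (N := N1) (M := N2) winf_weight wwb ib ws bu A0).
    move=> n nN xi; pose E := C * expR (- wb (2 ^+ n.+1)).
    have E0 : 0 <= E by rewrite mulr_ge0 ?expR_ge0 ?(ltW C0).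
    rewrite (_ : A * _ = 2 * E * fine (wnorm s 1 (fun x => chi x * chi x))); last first.
      by rewrite /A /E; move: (fine _) (expR _) => p q; ring.
    have H1 rho : Dbanach s 1 Om rho ->
        ((cnorm (T2 rho - pairing (g (e n)) rho))%:E <= E%:E * lnorm w Om s K 1 rho)%E.
      by move=> Dr; have := HC (e n) _ rho Dr; rewrite eV; apply; rewrite e_gt0 hN1.
    have H2 rho : Dbanach s 1 Om rho ->
        ((cnorm (T2 rho - pairing (g (e n.+1)) rho))%:E <= E%:E * lnorm w Om s K 1 rho)%E.
      move=> Dr; have en : 0 < e n.+1 < e0 by rewrite e_gt0 hN1// leqW.
      apply: le_trans (HC (e n.+1) en rho Dr) _; rewrite eV.
      apply: lee_wpmul2r.
        apply: le_ereal_inf_tmp => _ [psi [Dpsi _] <-].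
        apply: wnorm_ge0; first exact: weight_subadditive_weight.
        by apply: bcsMM; [exact: Droumieu_bcs Dpsi|case: Dr => /Cc_bcs].
      rewrite lee_fin ler_wpM2l ?(ltW C0)// ler_expR lerN2.
      apply: (weight_nondecreasing wwb); first exact: exprn_ge0.
      by rewrite (exprS _ n.+1) ler_peMl// ?exprn_ge0// ler1n.
    exact: (fourier_sub_cutoff_le w_weight ws sw cc (bu n) (bu n.+1) E0 H1 H2).
  move=> n nN; apply: le_trans (wnorm_cutoff _ 1 cc (gv n)) _.
  by have := hN2 n nN; rewrite mul1r invrK.
have [f Df [C C0 [N HN]]] := roumieu_limit w_weight K_compact K_Om Du u0 incr.
exists f; first exact: Droumieu_Eroumieu.
move=> phi Dphi.
(* One weight [s << w] suffices to make the association bound tend to 0. *)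
have [s [ws sw _]] := weight_below w_weight (fun=> 0).
have ss := weight_subadditive_weight ws.
have [T2 [_ TE] [C2 C20 HC]] := assoc s ws sw.
have Cphi := Droumieu_Cc Dphi; have bphi := Droumieu_bcs Dphi.
have [mphi [M [r [phiM phir]]]] := bphi.
have fphi := Droumieu_wnorm w_weight ws sw Dphi.
have pE n : pairing (g (e n)) phi = pairing (u n) phi.
  rewrite /pairing; congr cintegral_rV; apply/funext => x; rewrite /u.
  have [Ox|nO] := pselect (Om x); last by rewrite (Cc_eq0 Cphi nO) !mulr0.
  have [Kx|nK] := pselect (K x); last by rewrite gv// !(mulr0, mul0r).
  by case: cc => _ ->//; rewrite mul1r.
apply: (@clim_unique R (fun n => pairing (u n) phi)).
  have [bchi cchi] : bcs chi /\ ccontinuous chi.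
    by case: cc => Dc _; split; [exact: Droumieu_bcs Dc|have [] := Droumieu_Cc Dc].
  have fchi := Droumieu_wnorm w_weight ws sw (proj1 cc).
  have fcp := wnormM ss ler01 bchi cchi bphi fchi fphi.
  set B := wnorm s 1 _ in fcp.
  have BE : B = (fine B)%:E.
    by rewrite fineK// ge0_fin_numE// wnorm_ge0//; exact: bcsMM.
  have B0 : 0 <= fine B by rewrite fine_ge0// wnorm_ge0//; exact: bcsMM.
  have L := @geometric_cvg0 R (C2 * fine B).
  apply: squeeze_cvgr (cvg_cst 0) L.
  have [N3 hN3] := near_pinfty_dyadic (weight_growth wwb 1).
  exists (maxn N1 N3) => // n /=; rewrite geq_max => /andP[n1 n3].
  apply/andP; split; first exact: cnorm_ge0.
  rewrite -(cnormN (_ - _)) opprB -TE// -pE.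
  have Dp : Dbanach s 1 Om phi by split.
  have en : 0 < e n < e0 by rewrite e_gt0 hN1.
  rewrite -lee_fin; apply: le_trans (HC (e n) en phi Dp) _; rewrite eV.
  apply: (@le_trans _ _ ((C2 * expR (- wb (2 ^+ n.+1)))%:E * (fine B)%:E)%E).
    rewrite lee_wpmul2l ?lee_fin ?mulr_ge0 ?expR_ge0 ?(ltW C20)// -BE.
    exact: (lnorm_le_cutoff s 1 phi cc).
  rewrite -EFinM lee_fin mulrAC ler_wpM2l ?mulr_ge0 ?(ltW C20)//.
  rewrite expRN lef_pV2 ?posrE ?expR_gt0 ?exprn_gt0//.
  have p : 0 < 1 + (2 : R) ^+ n.+1 by rewrite addr_gt0// exprn_gt0.
  apply: (@le_trans _ _ (1 + 2 ^+ n.+1)).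
    by rewrite exprS; have : 0 <= (2 : R) ^+ n by []; lra.
  rewrite -[leLHS](lnK (x := 1 + _)) ?posrE// ler_expR.
  by have := hN3 n n3; rewrite mul1r.
have [c c0 Hc] := @pairing_sub_le R d r.
have L := @geometric_cvg0 R (C * M * c).
apply: squeeze_cvgr (cvg_cst 0) L; exists N => // n Nn.
apply/andP; split; first exact: cnorm_ge0.
rewrite (_ : C * M * c * _ = C * 2 ^- n * M * c); last by ring.
exact: Hc (bu n) (Droumieu_bcs Df) bphi (HN n Nn) phiM phir.
Qed.
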